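(* Let $\mathcal{R}$ be the set of all simple-2-column polyominoes with hexagonal cells (polyominoes being identified up to translation), and let $$G(q,w)=\sum_{P\in\mathcal{R}} q^{\text{area of }P}\, w^{\text{number of two-component columns of }P}.$$ Then $$G(q,w)=\frac{NUM}{DEN},$$ where \begin{align*} NUM ={}& (1-q)^4(\alpha+\gamma+2\alpha\eta-2\gamma\epsilon)\\ &+q^2w(1-q)^2(\iota+\lambda-\alpha\kappa-\alpha\mu+\beta\iota+\beta\lambda-\gamma\kappa-\gamma\mu+\delta\iota+\delta\lambda-2\epsilon\lambda+2\eta\iota\\ &\quad+2\alpha\zeta\lambda-2\alpha\eta\kappa-2\alpha\eta\mu+2\alpha\theta\lambda-2\beta\epsilon\lambda+2\beta\eta\iota+2\gamma\epsilon\kappa+2\gamma\epsilon\mu\\ &\quad-2\gamma\zeta\iota-2\gamma\theta\iota-2\delta\epsilon\lambda+2\delta\eta\iota)\\ &+4q^2w(1-q)(\alpha\lambda-\gamma\iota), \end{align*} \begin{align*} DEN ={}& (1-q)^4(1-\beta+\delta-\epsilon+\eta-\alpha\zeta+\alpha\theta+\beta\epsilon-\beta\eta+\gamma\zeta-\gamma\theta-\delta\epsilon+\delta\eta)\\ &-2(1-q)^3(\gamma+\alpha\eta-\gamma\epsilon)\\ &-2q^2w(1-q)^2(\kappa-\beta\mu+\delta\kappa-\epsilon\kappa+\zeta\iota-\zeta\lambda+\eta\kappa-\alpha\zeta\mu+\alpha\theta\kappa+\beta\epsilon\mu-\beta\eta\mu\\ &\quad-\beta\theta\iota+\beta\theta\lambda+\gamma\zeta\mu-\gamma\theta\kappa-\delta\epsilon\kappa+\delta\zeta\iota-\delta\zeta\lambda+\delta\eta\kappa)\\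 &-2q^2w(1-q)(\iota+\alpha\kappa-\alpha\mu-\beta\iota+2\beta\lambda-2\gamma\kappa+\delta\iota-\epsilon\lambda+\eta\iota+\alpha\zeta\lambda-\alpha\eta\kappa-\alpha\eta\mu\\ &\quad+\alpha\theta\lambda-\beta\epsilon\lambda+\beta\eta\iota+\gamma\epsilon\kappa+\gamma\epsilon\mu-\gamma\zeta\iota-\gamma\theta\iota-\delta\epsilon\lambda+\delta\eta\iota)\\ &-4q^2w(\alpha\lambda-\gamma\iota), \end{align*} and where $\alpha,\beta,\gamma,\delta,\epsilon,\zeta,\eta,\theta,\iota,\kappa,\lambda,\mu$ are the following series in $q,w$. For $i\ge 1$ put $$U_i=\frac{(-3)^{i-1}q^{i^2+2i-2}w^{i-1}}{(1-q)^{2i-2}\left[\prod_{k=1}^{i-1}(1-q^k)\right]^4},\qquad V_i=\frac{(-3)^{i-1}q^{i^2+3i}w^{i}}{(1-q)^{2i}\left[\prod_{k=1}^{i-1}(1-q^k)\right]^4},$$ $$s_i=4\sum_{k=1}^{i-1}\frac{q^k}{1-q^k},\qquad r_i=4\sum_{k=1}^{i-1}\frac{q^{2k}}{(1-q^k)^2}.$$ Then $$\alpha=\sum_{i\ge1}\frac{U_i}{1-q^i},\quad \beta=\sum_{i\ge1}\frac{U_i}{(1-q^i)^2},\quad \gamma=\sum_{i\ge1}\frac{V_i}{(1-q^i)^3},\quad \delta=\sum_{i\ge1}\frac{-3V_i}{(1-q^i)^4},$$ $$\epsilon=\sum_{i\ge1}\frac{U_i}{1-q^i}\left(2i-1+s_i+\frac{q^i}{1-q^i}\right),\qquad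 \zeta=\sum_{i\ge1}\frac{U_i}{(1-q^i)^2}\left(2i-1+s_i+\frac{2q^i}{1-q^i}\right),$$ $$\eta=\sum_{i\ge1}\frac{V_i}{(1-q^i)^3}\left(2i+s_i+\frac{3q^i}{1-q^i}\right),\qquad \theta=\sum_{i\ge1}\frac{-3V_i}{(1-q^i)^4}\left(2i+s_i+\frac{4q^i}{1-q^i}\right),$$ $$\iota=\frac12\sum_{i\ge1}\frac{U_i}{1-q^i}\left[\left(2i-1+s_i+\frac{q^i}{1-q^i}\right)^2-2i+1+r_i+\frac{q^{2i}}{(1-q^i)^2}\right],$$ $$\kappa=\frac12\sum_{i\ge1}\frac{U_i}{(1-q^i)^2}\left[\left(2i-1+s_i+\frac{2q^i}{1-q^i}\right)^2-2i+1+r_i+\frac{2q^{2i}}{(1-q^i)^2}\right],$$ $$\lambda=\frac12\sum_{i\ge1}\frac{V_i}{(1-q^i)^3}\left[\left(2i+s_i+\frac{3q^i}{1-q^i}\right)^2-2i+r_i+\frac{3q^{2i}}{(1-q^i)^2}\right],$$ $$\mu=\frac12\sum_{i\ge1}\frac{-3V_i}{(1-q^i)^4}\left[\left(2i+s_i+\frac{4q^i}{1-q^i}\right)^2-2i+r_i+\frac{4q^{2i}}{(1-q^i)^2}\right].$$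
   Context: Consider the regular hexagonal tiling of the Euclidean plane, oriented so that every hexagonal tile (cell) has two horizontal edges. A polyomino is a plane figure which is a (nonempty) union of finitely many cells and whose interior is connected. Two polyominoes are considered equal if and only if one is a translate of the other. The area of a polyomino is its number of cells. The cells of a polyomino $P$ are partitioned according to their horizontal projection (two cells are in the same block iff they have the same projection onto the horizontal axis, i.e. lie in the same vertical stack of hexagons); each block is called a column of $P$. A column need not be connected; its connected components are the connected components of the union of its cells (maximal runs of vertically consecutive cells). A column is a one-component (resp. two-component) column if it has exactly one (resp. exactly two) connected components. A 2-column polyomino is a polyomino each of whose columns has either one or two connected components. A simple-2-column polyomino is a 2-column polyomino in which no two consecutive (horizontally neighbouring) columns are both two-component columns. All identities are between formal power series in $q$ whose coefficients are polynomials in $w$; rational expressions such as $1/(1-q^k)$ are expanded as power series in $q$. Empty products equal $1$ and empty sums equal $0$. *)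

(* Defs.v *)
(* MathComp with MathComp-Analysis (classical sets, topology of the plane). *)
From HB Require Import structures.
From mathcomp Require Import all_boot all_order all_algebra.
From mathcomp Require Import finmap.
From mathcomp Require Import generic_quotient.
From mathcomp Require Import boolp classical_sets functions cardinality fsbigop.
From mathcomp Require Import reals topology normedtype.

Set Implicit Arguments.
Unset Strict Implicit.
Unset Printing Implicit Defensive.

Import Order.TTheory GRing.Theory Num.Theory.
Import numFieldTopology.Exports.

Local Open Scope classical_set_scope.
Local Open Scope ring_scope.

(* Formal power series in one variable; a record, so that the pointwise
   operations on functions are not inferred in place of the Cauchy product. *)
Record fps (A : Type) := Fps { fps_coef : nat -> A }.

HB.instance Definition _ (A : Type) := gen_eqMixin (fps A).
HB.instance Definition _ (A : Type) := gen_choiceMixin (fps A).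

Lemma fpsP (A : Type) (f g : fps A) :
  (forall n, fps_coef f n = fps_coef g n) -> f = g.
Proof. by case: f g => [f] [g] /= fg; congr Fps; apply/funext. Qed.

Section FpsRing.
Variable A : comNzRingType.
Implicit Types f g h : fps A.

Definition fps_const (a : A) := Fps (fun n => if n == 0%N then a else 0).
Definition fps_add f g := Fps (fun n => fps_coef f n + fps_coef g n).
Definition fps_opp f := Fps (fun n => - fps_coef f n).
Definition fps_mul f g :=
  Fps (fun n => \sum_(i < n.+1) fps_coef f i * fps_coef g (n - i)).

Lemma fps_addA : associative fps_add.
Proof. by move=> f g h; apply: fpsP => n /=; rewrite addrA. Qed.
Lemma fps_addC : commutative fps_add.
Proof. by move=> f g; apply: fpsP => n /=; rewrite addrC. Qed.
Lemma fps_add0 : left_id (fps_const 0) fps_add.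
Proof. by move=> f; apply: fpsP => n /=; rewrite if_same add0r. Qed.
Lemma fps_addN : left_inverse (fps_const 0) fps_opp fps_add.
Proof. by move=> f; apply: fpsP => n /=; rewrite if_same addNr. Qed.

HB.instance Definition _ :=
  GRing.isZmodule.Build (fps A) fps_addA fps_addC fps_add0 fps_addN.

Lemma fps_coef_mul_poly N f g n : (n <= N)%N ->
  fps_coef (fps_mul f g) n =
  ((\poly_(i < N.+1) fps_coef f i) * (\poly_(i < N.+1) fps_coef g i))`_n.
Proof.
move=> nN; rewrite coefM /=; apply: eq_bigr => i _.
rewrite !coef_poly !ltnS (leq_trans (leq_subr _ _) nN).
by rewrite (leq_trans _ nN) // -ltnS.
Qed.

Lemma fps_mulC : commutative fps_mul.
Proof.
by move=> f g; apply: fpsP => n; rewrite !(fps_coef_mul_poly _ _ (leqnn n)) mulrC.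
Qed.

Lemma fps_mulA : associative fps_mul.
Proof.
move=> f g h; apply: fpsP => n.
pose T f := \poly_(i < n.+1) fps_coef f i.
have Tn f' i : (i <= n)%N -> (T f')`_i = fps_coef f' i.
  by move=> i_n; rewrite coef_poly ltnS i_n.
transitivity ((T f * (T g * T h))`_n).
  rewrite coefM; apply: eq_bigr => i _.
  by rewrite Tn ?(fps_coef_mul_poly _ _ (leq_subr i n)) // -ltnS.
rewrite mulrA coefM; apply: eq_bigr => i _.
by rewrite Tn ?leq_subr // -(fps_coef_mul_poly (N := n)) // -ltnS.
Qed.

Lemma fps_mul1 : left_id (fps_const 1) fps_mul.
Proof.
move=> f; apply: fpsP => n /=.
rewrite big_ord_recl /= subn0 mul1r big1 ?addr0 // => i _.
by rewrite /= mul0r.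
Qed.

Lemma fps_mulDl : left_distributive fps_mul fps_add.
Proof.
move=> f g h; apply: fpsP => n /=.
by rewrite -big_split; apply: eq_bigr => i _; rewrite mulrDl.
Qed.

Lemma fps_oner_neq0 : fps_const 1 != fps_const 0.
Proof.
apply/eqP => /(congr1 (fun f => fps_coef f 0)) /= /eqP.
by rewrite oner_eq0.
Qed.

HB.instance Definition _ := GRing.Zmodule_isComNzRing.Build (fps A)
  fps_mulA fps_mulC fps_mul1 fps_mulDl fps_oner_neq0.

(* The inverse of f is the unique g with g * f = 1 whenever there is one. *)
Definition fps_unit : pred (fps A) := fun f => `[< exists g, g * f = 1 >].
Definition fps_inv f := xget f [set g | g * f = 1].

Lemma fps_mulVr : {in fps_unit, left_inverse 1 fps_inv *%R}.
Proof. by move=> f /asboolP fu; have /= := xgetPex f fu. Qed.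

Lemma fps_unitPl f g : g * f = 1 -> fps_unit f.
Proof. by move=> gf; apply/asboolP; exists g. Qed.

Lemma fps_inv_out : {in [predC fps_unit], fps_inv =1 id}.
Proof.
move=> f /negP fu; apply: xgetPN => g gf.
by apply: fu; apply: fps_unitPl gf.
Qed.

HB.instance Definition _ := GRing.ComNzRing_hasMulInverse.Build (fps A)
  fps_mulVr fps_unitPl fps_inv_out.

(* Sum of a possibly infinite family, taken coefficient by coefficient: each
   coefficient is a sum with finite support as soon as the family is summable
   (a coefficient with infinite support would be set to 0). *)
Definition fps_sum (I : choiceType) (D : set I) (F : I -> fps A) : fps A :=
  Fps (fun n => \sum_(i \in D) fps_coef (F i) n).

End FpsRing.

(* The cell (x, y) is the y-th hexagon of the x-th vertical stack; stack
   x + 1 is shifted upwards by half a cell with respect to stack x. *)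
Definition cell := (int * int)%type.

Section Tiling.
Variable R : realType.

Definition center (c : cell) : R * R :=
  (3%:R / 2%:R * c.1%:~R, Num.sqrt 3%:R * (c.2%:~R + c.1%:~R / 2%:R)).

(* Closed regular hexagon of side 1 with two horizontal edges. *)
Definition hexagon (c : cell) : set (R * R) :=
  [set p | let dx := `|p.1 - (center c).1| in
           let dy := `|p.2 - (center c).2| in
           2%:R * dy <= Num.sqrt 3%:R /\
           Num.sqrt 3%:R * dx + dy <= Num.sqrt 3%:R].

Definition figure (P : {fset cell}) : set (R * R) :=
  \bigcup_(c in [set` P]) hexagon c.

(* A polyomino is represented by the set of its cells. *)
Definition is_polyomino (P : {fset cell}) : Prop :=
  P != fset0 /\ connected (interior (figure P)).

End Tiling.

Definition columns (P : {fset cell}) : {fset int} := [fset c.1 | c in P]%fset.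

Definition column (P : {fset cell}) (x : int) : {fset cell} :=
  [fset c in P | c.1 == x]%fset.

Definition stacked (P : {fset cell}) (x : int) : rel (column P x) :=
  fun c d => `|(val c).2 - (val d).2| == 1.

(* Number of maximal runs of vertically consecutive cells. *)
Definition num_components (P : {fset cell}) (x : int) : nat :=
  n_comp (@stacked P x) predT.

Definition two_component_columns (P : {fset cell}) : {fset int} :=
  [fset x in columns P | num_components P x == 2%N]%fset.

Definition is_two_column (R : realType) (P : {fset cell}) : Prop :=
  is_polyomino R P /\
  forall x, x \in columns P ->
    num_components P x = 1%N \/ num_components P x = 2%N.

Definition is_simple_two_column (R : realType) (P : {fset cell}) : Prop :=
  is_two_column R P /\
  forall x, ~ (x \in two_component_columns P /\
               x + 1 \in two_component_columns P).

(* Since center is additive, this translates the figure by the vector center v;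
   these are the only translations carrying a cell to a cell. *)
Definition translate (v : cell) (P : {fset cell}) : {fset cell} :=
  [fset ((c.1 + v.1)%R, (c.2 + v.2)%R) | c in P]%fset.

Definition translated : rel {fset cell} :=
  fun P Q => `[< exists v, Q = translate v P >].

Lemma translateD v w P : translate w (translate v P) = translate (v + w) P.
Proof.
apply/fsetP => c; apply/imfsetP/imfsetP => /= [[d /imfsetP[e /= eP ->] ->]|[e eP ->]].
  by exists e => //=; rewrite !addrA.
exists (e.1 + v.1, e.2 + v.2); last by rewrite /= !addrA.
by apply/imfsetP; exists e.
Qed.

Lemma translate0 P : translate 0 P = P.
Proof.
apply/fsetP => c; apply/imfsetP/idP => /= [[d dP ->]|cP].
  by rewrite !addr0; case: d dP.
by exists c => //; rewrite !addr0; case: c {cP}.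
Qed.

Lemma translated_refl : reflexive translated.
Proof. by move=> P; apply/asboolP; exists 0; rewrite translate0. Qed.

Lemma translated_sym : symmetric translated.
Proof.
suff sub P Q : translated P Q -> translated Q P by move=> P Q; apply/idP/idP; apply: sub.
move=> /asboolP[v ->]; apply/asboolP; exists (- v).
by rewrite translateD subrr translate0.
Qed.

Lemma translated_trans : transitive translated.
Proof.
move=> Q P S /asboolP[v ->] /asboolP[w ->]; apply/asboolP.
by exists (v + w); rewrite translateD.
Qed.

Canonical translated_equiv :=
  EquivRel translated translated_refl translated_sym translated_trans.

(* Finite sets of cells up to translation. *)
Definition cells_mod_translation := {eq_quot translated_equiv}%qT.

(* Series in q whose coefficients are polynomials in w. *)
Definition series := fps {poly rat}.

Definition q : series := Fps (fun n => if n == 1%N then 1 else 0).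
Definition w : series := fps_const 'X.

(* Every class is evaluated on a representative; the area, the number of
   two-component columns and is_simple_two_column are translation invariant. *)
Definition G (R : realType) : series :=
  fps_sum [set C : cells_mod_translation | is_simple_two_column R (repr C)]
    (fun C => q ^+ #|` repr C| * w ^+ #|` two_component_columns (repr C)|).

Definition U (i : nat) : series :=
  (- 3%:R) ^+ (i - 1) * q ^+ (i ^ 2 + 2 * i - 2) * w ^+ (i - 1) /
  ((1 - q) ^+ (2 * i - 2) * (\prod_(1 <= k < i) (1 - q ^+ k)) ^+ 4).

Definition V (i : nat) : series :=
  (- 3%:R) ^+ (i - 1) * q ^+ (i ^ 2 + 3 * i) * w ^+ i /
  ((1 - q) ^+ (2 * i) * (\prod_(1 <= k < i) (1 - q ^+ k)) ^+ 4).

Definition s (i : nat) : series :=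
  4%:R * \sum_(1 <= k < i) q ^+ k / (1 - q ^+ k).

Definition r (i : nat) : series :=
  4%:R * \sum_(1 <= k < i) q ^+ (2 * k) / (1 - q ^+ k) ^+ 2.

Definition sum_ge1 (F : nat -> series) : series :=
  fps_sum [set i : nat | (1 <= i)%N] F.

Definition alpha : series := sum_ge1 (fun i => U i / (1 - q ^+ i)).

Definition beta : series := sum_ge1 (fun i => U i / (1 - q ^+ i) ^+ 2).

Definition gamma : series := sum_ge1 (fun i => V i / (1 - q ^+ i) ^+ 3).

Definition delta : series :=
  sum_ge1 (fun i => - 3%:R * V i / (1 - q ^+ i) ^+ 4).

Definition epsilon : series := sum_ge1 (fun i =>
  U i / (1 - q ^+ i) *
  (2%:R * i%:R - 1 + s i + q ^+ i / (1 - q ^+ i))).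

Definition zeta : series := sum_ge1 (fun i =>
  U i / (1 - q ^+ i) ^+ 2 *
  (2%:R * i%:R - 1 + s i + 2%:R * q ^+ i / (1 - q ^+ i))).

Definition eta : series := sum_ge1 (fun i =>
  V i / (1 - q ^+ i) ^+ 3 *
  (2%:R * i%:R + s i + 3%:R * q ^+ i / (1 - q ^+ i))).

Definition theta : series := sum_ge1 (fun i =>
  - 3%:R * V i / (1 - q ^+ i) ^+ 4 *
  (2%:R * i%:R + s i + 4%:R * q ^+ i / (1 - q ^+ i))).

Definition iota : series := 2%:R^-1 * sum_ge1 (fun i =>
  U i / (1 - q ^+ i) *
  ((2%:R * i%:R - 1 + s i + q ^+ i / (1 - q ^+ i)) ^+ 2
   - 2%:R * i%:R + 1 + r i + q ^+ (2 * i) / (1 - q ^+ i) ^+ 2)).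

Definition kappa : series := 2%:R^-1 * sum_ge1 (fun i =>
  U i / (1 - q ^+ i) ^+ 2 *
  ((2%:R * i%:R - 1 + s i + 2%:R * q ^+ i / (1 - q ^+ i)) ^+ 2
   - 2%:R * i%:R + 1 + r i + 2%:R * q ^+ (2 * i) / (1 - q ^+ i) ^+ 2)).

Definition lambda : series := 2%:R^-1 * sum_ge1 (fun i =>
  V i / (1 - q ^+ i) ^+ 3 *
  ((2%:R * i%:R + s i + 3%:R * q ^+ i / (1 - q ^+ i)) ^+ 2
   - 2%:R * i%:R + r i + 3%:R * q ^+ (2 * i) / (1 - q ^+ i) ^+ 2)).

Definition mu : series := 2%:R^-1 * sum_ge1 (fun i =>
  - 3%:R * V i / (1 - q ^+ i) ^+ 4 *
  ((2%:R * i%:R + s i + 4%:R * q ^+ i / (1 - q ^+ i)) ^+ 2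
   - 2%:R * i%:R + r i + 4%:R * q ^+ (2 * i) / (1 - q ^+ i) ^+ 2)).

Definition NUM : series :=
  (1 - q) ^+ 4 *
    (alpha + gamma + 2%:R * alpha * eta - 2%:R * gamma * epsilon)
  + q ^+ 2 * w * (1 - q) ^+ 2 *
    (iota + lambda - alpha * kappa - alpha * mu + beta * iota
     + beta * lambda - gamma * kappa - gamma * mu + delta * iota
     + delta * lambda - 2%:R * epsilon * lambda + 2%:R * eta * iota
     + 2%:R * alpha * zeta * lambda - 2%:R * alpha * eta * kappa
     - 2%:R * alpha * eta * mu + 2%:R * alpha * theta * lambda
     - 2%:R * beta * epsilon * lambda + 2%:R * beta * eta * iota
     + 2%:R * gamma * epsilon * kappa + 2%:R * gamma * epsilon * mu
     - 2%:R * gamma * zeta * iota - 2%:R * gamma * theta * iota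
     - 2%:R * delta * epsilon * lambda + 2%:R * delta * eta * iota)
  + 4%:R * q ^+ 2 * w * (1 - q) * (alpha * lambda - gamma * iota).

Definition DEN : series :=
  (1 - q) ^+ 4 *
    (1 - beta + delta - epsilon + eta - alpha * zeta + alpha * theta
     + beta * epsilon - beta * eta + gamma * zeta - gamma * theta
     - delta * epsilon + delta * eta)
  - 2%:R * (1 - q) ^+ 3 * (gamma + alpha * eta - gamma * epsilon)
  - 2%:R * q ^+ 2 * w * (1 - q) ^+ 2 *
    (kappa - beta * mu + delta * kappa - epsilon * kappa + zeta * iota
     - zeta * lambda + eta * kappa - alpha * zeta * mu
     + alpha * theta * kappa + beta * epsilon * mu - beta * eta * mu
     - beta * theta * iota + beta * theta * lambda + gamma * zeta * mu
     - gamma * theta * kappa - delta * epsilon * kappa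
     + delta * zeta * iota - delta * zeta * lambda + delta * eta * kappa)
  - 2%:R * q ^+ 2 * w * (1 - q) *
    (iota + alpha * kappa - alpha * mu - beta * iota
     + 2%:R * beta * lambda - 2%:R * gamma * kappa + delta * iota
     - epsilon * lambda + eta * iota + alpha * zeta * lambda
     - alpha * eta * kappa - alpha * eta * mu + alpha * theta * lambda
     - beta * epsilon * lambda + beta * eta * iota
     + gamma * epsilon * kappa + gamma * epsilon * mu
     - gamma * zeta * iota - gamma * theta * iota
     - delta * epsilon * lambda + delta * eta * iota)
  - 4%:R * q ^+ 2 * w * (alpha * lambda - gamma * iota).

(* Main.v *)
Require Import Defs.
From mathcomp Require Import all_boot all_order all_algebra.
From mathcomp Require Import reals.
From HB Require Import structures.
From mathcomp Require Import finmap generic_quotient zify ring lra.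
From mathcomp Require Import boolp classical_sets functions cardinality fsbigop.
From mathcomp Require Import topology normedtype.

Set Implicit Arguments.
Unset Strict Implicit.
Unset Printing Implicit Defensive.

Import Order.TTheory GRing.Theory Num.Theory.
Import numFieldNormedType.Exports.

Local Open Scope ring_scope.

(** Read a simple-2-column polyomino from left to right.  Its one-component
    columns form a chain; two consecutive ones either touch or are separated by
    one two-component column, and a two-component column may also come first or
    last.  A run of n cells and a run of a cells in neighbouring columns touch
    in n + a relative positions; a run of n cells touches both runs of a column
    with gap g in (n - g)^+ positions.  If the neighbours of a two-component
    column with runs a, b and gap g have heights n and m, the four runs form a
    cycle with four possible contacts, and they hang together iff at most one
    contact is missing.  Adding the four ways to impose three contacts and
    removing the surplus count of four contacts gives
      (n - g)^+ (2 m + a + b) + (m - g)^+ (2 n + a + b) - 3 (n - g)^+ (m - g)^+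
    placements.

    Let h_n be the series of everything that can stand to the right of a
    one-component column of height n (cont_gf), and F_j = sum_n C(n, j) q^n h_n
    (moment0, moment1, moment2).  Splitting off the next one-component column
    expresses h_n linearly in F_0, F_1, F_2, with coefficients polynomial in n,
    apart from the sum over g of (n - g)^+ (m - g)^+ (height_system,
    cont_gf_system).  That kernel is killed by differencing in n: four
    differences leave only the diagonal n = m, where the summand is q^n h_n.
    Hence H(z) = sum_n h_n z^n satisfies a q-difference equation, with H(q z) on
    the right (functional_equation).  Iterating it from z = q t solves it, since
    the products of kernels tend to 0 q-adically.  The coefficients of h^0, h^1,
    h^2 at t = 1 + h on the left are F_0, F_1, F_2; on the right they are linear
    combinations of F_0, F_1, F_2 and 1 whose coefficients are the twelve series
    alpha, ..., mu (greek_system).  The large brackets in those series are first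
    and second logarithmic derivatives of a product at t = 1.  Cramer's rule
    (cramer3) applied to the three equations gives F_0 + w q^2 / (1 - q)^2 F_2,
    which is G: the leftmost column is either a one-component column or a
    two-component column followed by one (fps_sum_codes).  DEN is invertible
    because its constant coefficient is 1 (unit_DEN).

    To see that G counts these descriptions, encode a polyomino by the heights,
    gaps and relative offsets of its columns.  Decoding such a code gives every
    polyomino of the class exactly once up to translation (polyomino_of_onto,
    polyomino_of_inj).  On the geometric side, closed hexagons that are not
    adjacent are disjoint, and the segment between the centres of two adjacent
    ones runs inside the interior of their union; so the interior is connected
    iff the cells are connected under adjacency (is_polyominoE). *)

(** * Formal power series *)

(** Over polynomials in w this is q; over series in q it serves as the
    generating variable z and as the deviation h from the point t = 1. *)
Definition fpsX (A : comNzRingType) : fps A :=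
  Fps (fun n => if n == 1%N then 1 else 0).

Section FpsCoef.
Variable A : comNzRingType.
Implicit Types f g : fps A.

Lemma fps_coefD f g n : fps_coef (f + g) n = fps_coef f n + fps_coef g n.
Proof. by []. Qed.

Lemma fps_coefB f g n : fps_coef (f - g) n = fps_coef f n - fps_coef g n.
Proof. by []. Qed.

Lemma fps_coef0 n : fps_coef (0 : fps A) n = 0.
Proof. by rewrite /= if_same. Qed.

Lemma fps_coefM f g n :
  fps_coef (f * g) n = \sum_(i < n.+1) fps_coef f i * fps_coef g (n - i).
Proof. by []. Qed.

Lemma fps_coef_sum (I : Type) (r : seq I) (P : pred I) (F : I -> fps A) n :
  fps_coef (\sum_(i <- r | P i) F i) n = \sum_(i <- r | P i) fps_coef (F i) n.
Proof.
elim/big_rec2: _ => [|i x y _ <-]; [exact: fps_coef0 | exact: fps_coefD].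
Qed.

Lemma fps_coefXM f n :
  fps_coef (fpsX A * f) n = if n is m.+1 then fps_coef f m else 0.
Proof.
rewrite fps_coefM; case: n => [|n]; first by rewrite big_ord1 mul0r.
rewrite 2!big_ord_recl /= mul0r add0r mul1r subn1 big1 ?addr0 // => i _.
by rewrite /= mul0r.
Qed.

Lemma fps_coefXnM f k n :
  fps_coef (fpsX A ^+ k * f) n =
  if (n < k)%N then 0 else fps_coef f (n - k).
Proof.
elim: k f n => [|k IHk] f n; first by rewrite expr0 mul1r subn0.
rewrite exprS -mulrA fps_coefXM; case: n => [//|n].
by rewrite IHk ltnS subSS.
Qed.

Lemma fps_constD a b : fps_const (a + b) = fps_const a + fps_const b :> fps A.
Proof. by apply: fpsP => n /=; case: eqP; rewrite ?addr0. Qed.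

Lemma fps_constN a : fps_const (- a) = - fps_const a :> fps A.
Proof. by apply: fpsP => n /=; case: eqP; rewrite ?oppr0. Qed.

Lemma fps_coefCM a f n : fps_coef (fps_const a * f) n = a * fps_coef f n.
Proof.
rewrite fps_coefM big_ord_recl /= subn0 big1 ?addr0 // => i _.
by rewrite /= mul0r.
Qed.

Lemma fps_constM a b : fps_const (a * b) = fps_const a * fps_const b :> fps A.
Proof.
apply: fpsP => n; rewrite fps_coefCM /=.
by case: eqP; rewrite ?mulr0.
Qed.

Lemma fps_const_sub_morph : zmod_morphism (@fps_const A).
Proof. by move=> a b; rewrite fps_constD fps_constN. Qed.

Lemma fps_const_mul_morph : monoid_morphism (@fps_const A).
Proof. by split=> // a b; rewrite fps_constM. Qed.

HB.instance Definition _ :=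
  GRing.isZmodMorphism.Build A (fps A) (@fps_const A) fps_const_sub_morph.
HB.instance Definition _ :=
  GRing.isMonoidMorphism.Build A (fps A) (@fps_const A) fps_const_mul_morph.

(** Equality is X-adic convergence; this is how limits are taken here. *)
Lemma fps_eq_modX f g :
  (forall N, exists r, f = g + fpsX A ^+ N * r) -> f = g.
Proof.
move=> fg; apply: fpsP => n; have [r ->] := fg n.+1.
by rewrite fps_coefD fps_coefXnM ltnSn addr0.
Qed.

(** The sum of X^i u_i over all i. The powers of X make every coefficient a
    finite sum, so no summability condition is carried along. *)
Definition qsum (u : nat -> fps A) : fps A :=
  Fps (fun N => \sum_(i < N.+1) fps_coef (u i) (N - i)).

Lemma eq_qsum u v : u =1 v -> qsum u = qsum v.
Proof. by move=> uv; congr qsum; apply/funext. Qed.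

Lemma qsum_recl u : qsum u = u 0%N + fpsX A * qsum (fun i => u i.+1).
Proof.
apply: fpsP => -[|n]; rewrite fps_coefD fps_coefXM.
  by rewrite addr0 /= big_ord1.
by rewrite /= big_ord_recl subn0.
Qed.

Lemma qsum_trunc N u :
  qsum u = \sum_(i < N) fpsX A ^+ i * u i
           + fpsX A ^+ N * qsum (fun i => u (N + i)%N).
Proof.
elim: N => [|N IHN]; first by rewrite big_ord0 add0r mul1r.
rewrite big_ord_recr /= -addrA {1}IHN; congr (_ + _).
rewrite [in LHS]qsum_recl addn0 mulrDr exprSr mulrA; congr (_ + _ * _).
by apply: eq_qsum => i; rewrite addnS.
Qed.

Lemma qsumD u v : qsum (fun i => u i + v i) = qsum u + qsum v.
Proof. by apply: fpsP => n; rewrite fps_coefD /= -big_split. Qed.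

Lemma qsumZ c u : qsum (fun i => c * u i) = c * qsum u.
Proof.
apply: fps_eq_modX => N.
exists (qsum (fun i => c * u (N + i)%N) - c * qsum (fun i => u (N + i)%N)).
rewrite (qsum_trunc N) [in RHS](qsum_trunc N u).
have -> : \sum_(i < N) fpsX A ^+ i * (c * u i) =
          c * \sum_(i < N) fpsX A ^+ i * u i.
  by rewrite mulr_sumr; apply: eq_bigr => i _; rewrite mulrCA.
ring.
Qed.

Lemma qsumN u : qsum (fun i => - u i) = - qsum u.
Proof.
by rewrite -mulN1r -qsumZ; apply: eq_qsum => i; rewrite mulN1r.
Qed.

Lemma qsumB u v : qsum (fun i => u i - v i) = qsum u - qsum v.
Proof. by rewrite qsumD qsumN. Qed.

Lemma qsum0 : qsum (fun=> 0) = 0.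
Proof.
rewrite -[RHS](mul0r (qsum (fun=> 0))) -qsumZ.
by apply: eq_qsum => i; rewrite mul0r.
Qed.

Lemma qsum_delta m c : qsum (fun i => if i == m then c else 0) = fpsX A ^+ m * c.
Proof.
elim: m => [|m IHm]; rewrite qsum_recl /=.
  by rewrite qsum0 mulr0 addr0 mul1r.
by rewrite add0r (eq_qsum (v := fun i => if i == m then c else 0)) // IHm exprS mulrA.
Qed.

Lemma fps_coef_qsum_const (u : nat -> A) n :
  fps_coef (qsum (fun i => fps_const (u i))) n = u n.
Proof.
rewrite /= big_ord_recr /= subnn eqxx big1 ?add0r // => i _.
by rewrite subn_eq0 leqNgt ltn_ord.
Qed.

(** The geometric series, which is the source of all inverses needed below. *)
Lemma qsum_geom g : (1 - fpsX A * g) * qsum (fun i => g ^+ i) = 1.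
Proof.
set S := qsum _.
have E : S = 1 + fpsX A * (g * S).
  by rewrite -qsumZ [LHS]qsum_recl; congr (_ + _ * _); apply: eq_qsum => i; rewrite exprS.
by rewrite mulrBl mul1r -mulrA {1}E addrK.
Qed.

Lemma fps_unit1 f : fps_coef f 0 = 1 -> f \is a GRing.unit.
Proof.
move=> f0; pose g := Fps (fun n => - fps_coef f n.+1).
suff -> : f = 1 - fpsX A * g.
  by apply/unitrPr; exists (qsum (fun i => g ^+ i)); rewrite qsum_geom.
apply: fpsP => -[|n]; rewrite fps_coefB fps_coefXM ?f0 ?subr0 //=.
by rewrite sub0r opprK.
Qed.

End FpsCoef.

(** * Jets at t = 1 *)

Notation jetring := (fps series).

Section Jets.
Local Notation h := (fpsX series).
Local Notation C := (@fps_const series).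

Lemma qE : q = fpsX _. Proof. by []. Qed.

Lemma unit_1subXM (A : comNzRingType) (g : fps A) :
  1 - fpsX A * g \is a GRing.unit.
Proof. by apply/unitrPr; exists (qsum (fun i => g ^+ i)); rewrite qsum_geom. Qed.

Lemma unit_1subq k : 1 - q ^+ k.+1 \is a GRing.unit.
Proof. by rewrite exprS unit_1subXM. Qed.

Lemma unit_1subq1 : 1 - q \is a GRing.unit.
Proof. exact: (unit_1subq 0). Qed.

(** E = e exp (L h + M h^2 / 2) up to h^2: L and M are the first and second
    logarithmic derivatives at h = 0. The factor 2 avoids a division. *)
Definition jet (E : jetring) (e L M : series) : Prop :=
  [/\ fps_coef E 0 = e, fps_coef E 1 = e * L &
      2%:R * fps_coef E 2 = e * (L ^+ 2 + M)].

(** Logarithmic derivatives of a product add; the inner sums of the twelve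
    series come from this. *)
Lemma jetM E E' e e' L L' M M' :
  jet E e L M -> jet E' e' L' M' -> jet (E * E') (e * e') (L + L') (M + M').
Proof.
move=> [E0 E1 E2] [F0 F1 F2]; split.
- by rewrite fps_coefM big_ord1 subn0 E0 F0.
- rewrite fps_coefM !big_ord_recl big_ord0 /= subn0 subnn E0 F0 E1 F1; ring.
rewrite fps_coefM !big_ord_recl big_ord0 /= !subSS !subn0 !/bump /= !add1n.
rewrite E0 E1 F0 F1.
have -> : e * e' * ((L + L') ^+ 2 + (M + M')) =
    e' * (2%:R * fps_coef E 2) + e * (2%:R * fps_coef E' 2) + 2%:R * (e * L * (e' * L')).
  by rewrite E2 F2; ring.
ring.
Qed.

Lemma jetX E e L M i : jet E e L M -> jet (E ^+ i) (e ^+ i) (i%:R * L) (i%:R * M).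
Proof.
move=> jE; elim: i => [|i IHi].
  by rewrite !mul0r; split; rewrite /=; ring.
by rewrite !exprS; have := jetM jE IHi; rewrite -[i.+1]add1n natrD !mulrDl !mul1r.
Qed.

Lemma jet_const c : jet (C c) c 0 0.
Proof. by split; rewrite /= ?mulr0 // expr0n addr0 mulr0. Qed.

(** The point z = q^(k+1) t with t = 1 + h. *)
Definition jet_arg k : jetring := C (q ^+ k.+1) * (1 + h).

Lemma jet_of_arg k : jet (jet_arg k) (q ^+ k.+1) 1 (-1).
Proof.
split; rewrite /jet_arg fps_coefCM fps_coefD /= ?addr0 ?add0r ?mulr1 //.
by rewrite mulr0 mulr0 expr1n subrr mulr0.
Qed.

(** Normalise the constant coefficient to 1. *)
Lemma unit_fps (A : comUnitRingType) (f : fps A) :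
  fps_coef f 0 \is a GRing.unit -> f \is a GRing.unit.
Proof.
move=> f0; have := @fps_unit1 A (fps_const (fps_coef f 0)^-1 * f).
rewrite fps_coefCM mulVr // => /(_ erefl).
by rewrite unitrM => /andP[].
Qed.

Lemma unit_1subx k : 1 - jet_arg k \is a GRing.unit.
Proof.
apply: unit_fps; rewrite fps_coefB /jet_arg fps_coefCM fps_coefD /= addr0 mulr1.
exact: unit_1subq.
Qed.

(** 1 - u t at t = 1 + h is (1 - u) (1 - y h) with y = u / (1 - u), so its
    inverse is geometric in h with ratio y; both logarithmic derivatives come
    out as powers of y. *)
Lemma jet_inv_1subx k : let y := q ^+ k.+1 / (1 - q ^+ k.+1) in
  jet (1 - jet_arg k)^-1 (1 - q ^+ k.+1)^-1 y (y ^+ 2).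
Proof.
set u := 1 - q ^+ k.+1 => y.
have uu : u \is a GRing.unit by exact: unit_1subq.
have -> : (1 - jet_arg k)^-1 = C u^-1 * qsum (fun i => C (y ^+ i)).
  have E : 1 - jet_arg k = C u * (1 - h * C y).
    rewrite mulrBr mulr1 [C u * (h * _)]mulrCA -fps_constM.
    rewrite /y [u * (_ / _)]mulrC divrK //.
    by rewrite /jet_arg /u rmorphB rmorph1 /=; ring.
  apply: (mulrI (unit_1subx k)); rewrite divrr ?unit_1subx // E.
  under eq_qsum do rewrite rmorphXn.
  by rewrite mulrACA qsum_geom mulr1 -fps_constM divrr.
split; rewrite fps_coefCM fps_coef_qsum_const ?mulr1 //.
by rewrite mulrCA; congr (_ * _); ring.
Qed.

(** * The functional equation of a height system *)

(** The value of the power series sum_n u_n z^n at z = jet_arg k, expanded in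
    h: the coefficient of h^j in z^n is C(n, j) q^((k+1) n), of which qsum
    supplies the factor q^n. *)
Definition jet_eval k (u : fps series) : jetring :=
  Fps (fun j => qsum (fun n => 'C(n, j)%:R * q ^+ (k * n) * fps_coef u n)).

Lemma jet_eval_coef k u j : fps_coef (jet_eval k u) j =
  qsum (fun n => 'C(n, j)%:R * q ^+ (k * n) * fps_coef u n).
Proof. by []. Qed.

Lemma jet_evalD k u v : jet_eval k (u + v) = jet_eval k u + jet_eval k v.
Proof.
apply: fpsP => j; rewrite fps_coefD !jet_eval_coef -qsumD.
by apply: eq_qsum => n; rewrite mulrDr.
Qed.

Lemma jet_evalZ k c u : jet_eval k (C c * u) = C c * jet_eval k u.
Proof.
apply: fpsP => j; rewrite fps_coefCM !jet_eval_coef -qsumZ.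
by apply: eq_qsum => n; rewrite fps_coefCM mulrCA.
Qed.

Lemma jet_evalB k u v : jet_eval k (u - v) = jet_eval k u - jet_eval k v.
Proof.
have E : u - v = u + C (- 1) * v by rewrite rmorphN1 mulN1r.
by rewrite E jet_evalD jet_evalZ rmorphN1 mulN1r.
Qed.

Lemma jet_eval1 k : jet_eval k 1 = 1.
Proof.
apply: fpsP => j; rewrite /= (eq_qsum (v := fun n => if n == 0%N then (j == 0%N)%:R else 0)).
  by rewrite qsum_delta mul1r; case: j.
case=> [|n] /=; last by rewrite mulr0.
by rewrite muln0 !mulr1 bin0n.
Qed.

Lemma jet_eval_const k c : jet_eval k (C c) = C c.
Proof. by rewrite -[C c]mulr1 jet_evalZ jet_eval1. Qed.

(** Multiplication by the variable becomes multiplication by the point of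
    evaluation; in coefficients this is Pascal's rule. *)
Lemma jet_evalX k u : jet_eval k (fpsX series * u) = jet_arg k * jet_eval k u.
Proof.
apply: fpsP => j; rewrite /jet_arg -mulrA fps_coefCM mulrDl mul1r fps_coefD fps_coefXM !jet_eval_coef.
rewrite qsum_recl fps_coefXM mulr0 add0r exprS -[fpsX _]qE -mulrA; congr (_ * _).
have -> : qsum (fun n => 'C(n, j)%:R * q ^+ (k * n) * fps_coef u n) +
    match j with 0 => 0
    | j'.+1 => qsum (fun n => 'C(n, j')%:R * q ^+ (k * n) * fps_coef u n) end
  = qsum (fun n => 'C(n.+1, j)%:R * q ^+ (k * n) * fps_coef u n).
  case: j => [|j]; first by rewrite addr0; apply: eq_qsum => n; rewrite !bin0.
  by rewrite -qsumD; apply: eq_qsum => n; rewrite binS natrD -!mulrDl.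
rewrite -qsumZ; apply: eq_qsum => n; rewrite fps_coefXM mulnS exprD; ring.
Qed.

(** The series of the two runs of a two-component column, whatever its gap: w
    times the sum of q^(a+b) over a, b > 0. *)
Definition wt_gapped : series := w * (q ^+ 2 / (1 - q) ^+ 2).

(** The only part of the step from a column of height n to one of height m that
    is not of finite rank in (n, m). *)
Definition double_hits (n m : nat) : nat := \sum_(1 <= g < n) (n - g) * (m - g).

(** source0, source1, source2 are the values at jet_arg k of the generating
    functions in n of 1, n and C(n, 2) (times wt_gapped), for n > 0. *)
Definition source0 k : jetring := jet_arg k / (1 - jet_arg k).
Definition source1 k : jetring := jet_arg k / (1 - jet_arg k) ^+ 2.
Definition source2 k : jetring := C wt_gapped * jet_arg k ^+ 2 / (1 - jet_arg k) ^+ 3.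
(** The factor in front of H(q z): four summations in n, one for each
    difference that reduces the double_hits sum to its diagonal. *)
Definition kern k : jetring := - 3%:R * C wt_gapped * jet_arg k ^+ 2 / (1 - jet_arg k) ^+ 4.

(** The equations satisfied by the series of the continuations of a column of
    height n. In hsS, 2 / (1 - q) is the mean of a + b over the pairs of runs
    counted by wt_gapped. *)
Record height_system (H : nat -> series) (F0 F1 F2 : series) : Prop := {
  hs0 : H 0%N = 0;
  hsF0 : F0 = qsum H;
  hsF1 : F1 = qsum (fun m => m%:R * H m);
  hsF2 : F2 = qsum (fun m => 'C(m, 2)%:R * H m);
  hsS : forall n, H n.+1 =
    (1 + F1 + 2%:R * wt_gapped / (1 - q) * F2) + n.+1%:R * (F0 + 2%:R * wt_gapped * F2)
    + wt_gapped * 'C(n.+1, 2)%:R * (1 + 2%:R * F1 + 2%:R / (1 - q) * F0)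
    - 3%:R * wt_gapped * qsum (fun m => (double_hits n.+1 m)%:R * H m)
}.

Section HeightSystem.
Variables (H : nat -> series) (F0 F1 F2 : series).
Hypothesis HS : height_system H F0 F1 F2.

(** K, K1, K2, K3 are the double_hits sums and their successive differences in
    n. *)
Let K := Fps (fun n => qsum (fun m => (double_hits n m)%:R * H m)).
Let K1 := Fps (fun n => qsum (fun m => (\sum_(1 <= g < n.+1) (m - g))%:R * H m)).
Let K2 := Fps (fun n => qsum (fun m => (m - n)%:R * H m)).
Let K3 := Fps (fun n => qsum (fun m => (n < m)%:R * H m)).
Let Z : fps series := fpsX series.

Lemma K_rec : K = Z * (K + K1).
Proof.
apply: fpsP => -[|n]; rewrite fps_coefXM /=.
  by rewrite -[RHS]qsum0; apply: eq_qsum => m; rewrite /double_hits big_geq ?mul0r.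
rewrite -qsumD; apply: eq_qsum => m; rewrite -mulrDl -natrD; congr (_%:R * _).
rewrite /double_hits; case: n => [|n]; first by rewrite !big_geq.
rewrite [in LHS]big_nat_recr //= [(\sum_(1 <= g < n.+2) (m - g))%N]big_nat_recr //= addnA -big_split /=.
congr (_ + _)%N; last by rewrite subSnn mul1n.
by apply: eq_big_nat => g /andP[_ gn]; rewrite subSn ?mulSn 1?addnC // ltnW.
Qed.

Lemma K1_rec : K1 = Z * K1 + (K2 - C F1).
Proof.
apply: fpsP => -[|n]; rewrite fps_coefD fps_coefXM fps_coefB /=.
  rewrite add0r (hsF1 HS) -qsumB.
  by apply: eq_qsum => m; rewrite big_geq // subn0 subrr mul0r.
rewrite subr0 -qsumD; apply: eq_qsum => m; rewrite -mulrDl -natrD.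
by rewrite big_nat_recr.
Qed.

Lemma K2_rec : K2 = C F1 + Z * (K2 - K3).
Proof.
apply: fpsP => -[|n]; rewrite fps_coefD fps_coefXM.
  by rewrite /= addr0 (hsF1 HS); apply: eq_qsum => m; rewrite subn0.
rewrite fps_coefB /= add0r -qsumB; apply: eq_qsum => m; rewrite -mulrBl.
congr (_ * _); case: ltnP => nm.
  by rewrite -[(m - n)%N](@prednK _) ?subn_gt0 // -subnS -natr1 addrK.
have [-> ->] : (m - n.+1 = 0 /\ m - n = 0)%N by lia.
by rewrite subr0.
Qed.

(** Coefficientwise, the substitution of q z for z. *)
Definition rescale (u : nat -> series) : fps series := Fps (fun n => q ^+ n * u n).

(** The fourth difference: only the term m = n survives, and there qsum
    attaches the factor q^n that turns H(z) into H(q z). *)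
Lemma K3_rec : K3 = C F0 + Z * K3 - rescale H.
Proof.
have HE n : q ^+ n * H n = qsum (fun m => (m == n)%:R * H m).
  rewrite -qsum_delta; apply: eq_qsum => m.
  by case: eqP => [->|]; rewrite ?mul1r ?mul0r.
apply: fpsP => n; rewrite fps_coefB fps_coefD fps_coefXM [fps_coef (rescale H) n]/= HE.
case: n => [|n] /=.
  rewrite addr0 (hsF0 HS) -qsumB; apply: eq_qsum => m.
  by case: m => [|m]; rewrite ?(hs0 HS) ?mulr0 ?subrr // mul1r mul0r subr0.
rewrite add0r -qsumB; apply: eq_qsum => m; rewrite -mulrBl; congr (_ * _).
have -> : ((n < m) = (n.+1 < m) + (m == n.+1) :> nat)%N.
  by rewrite (leq_eqVlt n.+1) [m == _]eq_sym; case: ltngtP.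
by rewrite natrD addrK.
Qed.

(** The sequences 1 (for n > 0), n and C(n, 2). *)
Let A := Fps (fun n => (0 < n)%:R : series).
Let B := Fps (fun n => n%:R : series).
Let D := Fps (fun n => 'C(n, 2)%:R : series).

Lemma A_rec : A = Z * (1 + A).
Proof. by apply: fpsP => -[|[|n]]; rewrite fps_coefXM ?fps_coefD /= ?addr0 ?add0r. Qed.

Lemma B_rec : B = A + Z * B.
Proof.
apply: fpsP => -[|n]; rewrite fps_coefD fps_coefXM /= ?addr0 //.
by rewrite -natr1 addrC.
Qed.

Lemma D_rec : D = Z * (D + B).
Proof.
by apply: fpsP => -[|n]; rewrite fps_coefXM // fps_coefD /= binS bin1 natrD.
Qed.

Lemma H_decomp : Fps H = C (1 + F1 + 2%:R * wt_gapped / (1 - q) * F2) * A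
  + C (F0 + 2%:R * wt_gapped * F2) * B
  + C (wt_gapped * (1 + 2%:R * F1 + 2%:R / (1 - q) * F0)) * D - C (3%:R * wt_gapped) * K.
Proof.
apply: fpsP => n; rewrite fps_coefB !fps_coefD !fps_coefCM /=.
case: n => [|n].
  rewrite (hs0 HS) [qsum _](_ : _ = 0); first by rewrite !mulr0 !addr0 subr0.
  by rewrite -[RHS]qsum0; apply: eq_qsum => m; rewrite /double_hits big_geq ?mul0r.
by rewrite (hsS HS) mulr1; ring.
Qed.

Lemma jet_eval_rescale k : jet_eval k (rescale H) = jet_eval k.+1 (Fps H).
Proof.
apply: fpsP => j; rewrite !jet_eval_coef; apply: eq_qsum => n /=.
by rewrite mulSn addnC exprD !mulrA.
Qed.

(** Each difference relation becomes a linear equation y = z + x y, solved by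
    multiplying with v = 1 / (1 - x). The double_hits sum evaluates to v^3 x^2
    F1 - v^4 x^2 (F0 - H(q z)); its F1 part has the shape of source2 and turns
    the coefficient 1 + 2 F1 there into 1 - F1. *)
Lemma functional_equation k : jet_eval k (Fps H) =
    source0 k * C (1 + F1 + 2%:R * wt_gapped / (1 - q) * F2) + source1 k * C (F0 + 2%:R * wt_gapped * F2)
  + source2 k * C (1 - F1 + 2%:R / (1 - q) * F0) + kern k * C (- F0)
  + kern k * jet_eval k.+1 (Fps H).
Proof.
set x := jet_arg k; set v := (1 - x)^-1.
have xv : v * (1 - x) = 1 by rewrite mulVr // unit_1subx.
have solve (y z : jetring) : y = z + x * y -> y = v * z.
  move=> E; rewrite -[y]mul1r -xv -mulrA; congr (_ * _).
  by rewrite mulrBl mul1r {1}E addrK.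
have eA : jet_eval k A = v * x.
  by apply: solve; rewrite {1}A_rec jet_evalX jet_evalD jet_eval1 -/x; ring.
have eB : jet_eval k B = v ^+ 2 * x.
  by rewrite expr2 -mulrA -eA; apply: solve; rewrite {1}B_rec jet_evalD jet_evalX.
have eD : jet_eval k D = v ^+ 3 * x ^+ 2.
  have -> : v ^+ 3 * x ^+ 2 = v * (x * (v ^+ 2 * x)) by ring.
  by rewrite -eB; apply: solve; rewrite {1}D_rec jet_evalX jet_evalD -/x; ring.
have e3 : jet_eval k K3 = v * (C F0 - jet_eval k.+1 (Fps H)).
  by apply: solve; rewrite {1}K3_rec jet_evalB jet_evalD jet_evalX jet_eval_const jet_eval_rescale -/x; ring.
have e2 : jet_eval k K2 = v * (C F1 - x * jet_eval k K3).
  by apply: solve; rewrite {1}K2_rec jet_evalD jet_evalX jet_evalB jet_eval_const -/x; ring.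
have e1 : jet_eval k K1 = v * (jet_eval k K2 - C F1).
  by apply: solve; rewrite {1}K1_rec jet_evalD jet_evalX jet_evalB jet_eval_const -/x; ring.
have eK : jet_eval k K = v * (x * jet_eval k K1).
  by apply: solve; rewrite {1}K_rec jet_evalX jet_evalD -/x; ring.
(* v - 1 = v * x gives the F1 part the shape of source2. *)
have vx : v = 1 + v * x by rewrite -xv; ring.
have eK' : jet_eval k K = v ^+ 3 * x ^+ 2 * C F1
    - v ^+ 4 * x ^+ 2 * (C F0 - jet_eval k.+1 (Fps H)).
  have -> : jet_eval k K = v ^+ 2 * x * (v * C F1 - C F1)
                     - v ^+ 4 * x ^+ 2 * (C F0 - jet_eval k.+1 (Fps H)).
    by rewrite eK e1 e2 e3; ring.
  by rewrite {2}vx; ring.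
rewrite {1}H_decomp jet_evalB !jet_evalD !jet_evalZ eA eB eD eK'.
rewrite /source0 /source1 /source2 /kern -/x -!exprVn -/v.
set c0 := 1 + F1 + _; set c1 := F0 + _; set c2 := 1 + _ * F1 + _.
have -> : 1 - F1 + 2%:R / (1 - q) * F0 = c2 - 3%:R * F1 by rewrite /c2; ring.
rewrite !(rmorphM, rmorphB, rmorphN, rmorph_nat) /=.
by ring.
Qed.

End HeightSystem.

(** * Iteration of the functional equation *)

Lemma unit_2 : (2%:R : series) \is a GRing.unit.
Proof.
rewrite -(rmorph_nat (@fps_const {poly rat})) -(rmorph_nat (@polyC rat)).
by rewrite rmorph_unit // rmorph_unit // unitfE.
Qed.

(** Turns a sum over a set of indices into a q-adic sum, once the factor q^i is
    exhibited. *)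
Lemma fps_sum_qsum (F : nat -> series) (D : set nat) (r : nat -> series) :
  (forall i, D i -> F i = q ^+ i * r i) -> (forall i, ~ D i -> r i = 0) ->
  fps_sum D F = qsum r.
Proof.
move=> Fr r0; apply: fpsP => n.
have Fn i : patch (fun=> 0) D (fun i => fps_coef (F i) n) i =
    if (i <= n)%N then fps_coef (r i) (n - i) else 0.
  rewrite /patch; case: ifPn; rewrite ?inE ?notin_setE => Di.
    by rewrite Fr // fps_coefXnM ltnNge; case: leqP.
  by rewrite r0 // fps_coef0 if_same.
rewrite /fps_sum [LHS]/= fsbig_mkcond.
under eq_fsbigr do rewrite Fn.
rewrite (fsbigE (index_iota 0 n.+1)) ?iota_uniq //; last first.
  by move=> i _; rewrite mem_index_iota /= ltnS => /negPf ->.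
rewrite big_mkord /= [LHS](eq_bigl xpredT) => [|i]; last by rewrite in_setT.
by apply: eq_bigr => i _; rewrite -ltnS ltn_ord.
Qed.

Lemma sum_ge1_qsum (F r : nat -> series) :
  (forall i, F i.+1 = q ^+ i.+1 * r i) -> sum_ge1 F = q * qsum r.
Proof.
move=> Fr; pose r' i := if i is j.+1 then r j else 0.
rewrite /sum_ge1 (@fps_sum_qsum _ _ r') => [|[|i] //= _|[|i] //=].
  by rewrite qsum_recl add0r.
Qed.

Definition kern_prod i := \prod_(k < i) kern k.

Lemma kern_prodS i : kern_prod i.+1 = kern_prod i * kern i.
Proof. by rewrite /kern_prod big_ord_recr. Qed.

Lemma functional_equation_iter H F0 F1 F2 N : height_system H F0 F1 F2 ->
  jet_eval 0 (Fps H) = \sum_(i < N)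
   (kern_prod i * source0 i * C (1 + F1 + 2%:R * wt_gapped / (1 - q) * F2)
  + kern_prod i * source1 i * C (F0 + 2%:R * wt_gapped * F2)
  + kern_prod i * source2 i * C (1 - F1 + 2%:R / (1 - q) * F0) + kern_prod i * kern i * C (- F0))
  + kern_prod N * jet_eval N (Fps H).
Proof.
move=> HS; elim: N => [|N IHN]; first by rewrite big_ord0 /kern_prod big_ord0; ring.
rewrite IHN (functional_equation HS N) [in RHS]big_ord_recr /=.
rewrite kern_prodS.
move: (\sum_(i < N) _) (jet_eval N.+1 _) (source0 N) (source1 N) (source2 N) (kern N) (kern_prod N).
move: (C _) (C _) (C _) (C _) => *.
by ring.
Qed.

(** The logarithmic derivative of 1 / (1 - q^(k+1) t) at t = 1; sums of these
    and of their squares give s and r. *)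
Definition lambert k := q ^+ k.+1 / (1 - q ^+ k.+1).

Definition qfact i : series := \prod_(1 <= k < i.+1) (1 - q ^+ k).

Lemma qfactS i : qfact i.+1 = qfact i * (1 - q ^+ i.+1).
Proof. by rewrite /qfact big_nat_recr. Qed.

Lemma unit_qfact i : qfact i \is a GRing.unit.
Proof.
elim: i => [|i IHi]; first by rewrite /qfact big_geq ?unitr1.
by rewrite qfactS unitrM IHi unit_1subq.
Qed.

Lemma s_one : s 1 = 0.
Proof. by rewrite /s big_geq // mulr0. Qed.

Lemma s_succ i : s i.+2 = s i.+1 + 4%:R * lambert i.
Proof. by rewrite /s big_nat_recr // mulrDr. Qed.

Lemma r_one : r 1 = 0.
Proof. by rewrite /r big_geq // mulr0. Qed.

Lemma r_succ i : r i.+2 = r i.+1 + 4%:R * lambert i ^+ 2.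
Proof. by rewrite /r big_nat_recr // mulrDr /lambert exprMn exprVn -exprM mulnC. Qed.

(** The value of kern_prod i at t = 1. *)
Definition kern_prod_at1 i : series :=
  (- 3%:R * wt_gapped) ^+ i * q ^+ (i * i.+1) * (qfact i)^-1 ^+ 4.

Lemma kern_prod_at1S i : kern_prod_at1 i.+1 =
  kern_prod_at1 i * ((- 3%:R * wt_gapped) * q ^+ i.+1 ^+ 2 * (1 - q ^+ i.+1)^-1 ^+ 4).
Proof.
rewrite /kern_prod_at1 qfactS; move: (- 3%:R * wt_gapped) => t.
rewrite (invrM (unit_qfact i) (unit_1subq i)) exprMn (exprS t).
have -> : (i.+1 * i.+2 = i * i.+1 + i.+1 * 2)%N by lia.
rewrite exprD (exprM q i.+1 2).
move: (qfact i)^-1 (1 - q ^+ i.+1)^-1 (t ^+ i) (q ^+ (i * i.+1)) (q ^+ i.+1).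
move=> *; ring.
Qed.

Lemma jet_eq E e L M e' L' M' :
  jet E e L M -> e = e' -> L = L' -> M = M' -> jet E e' L' M'.
Proof. by move=> ? <- <- <-. Qed.

Lemma jet_kern i : jet (kern i)
  ((- 3%:R * wt_gapped) * q ^+ i.+1 ^+ 2 * (1 - q ^+ i.+1)^-1 ^+ 4)
  (2%:R + 4%:R * lambert i) (- 2%:R + 4%:R * lambert i ^+ 2).
Proof.
rewrite /kern -exprVn.
have -> : - 3%:R * C wt_gapped = C (- 3%:R * wt_gapped).
  by rewrite (fps_constM (- 3%:R) wt_gapped) fps_constN rmorph_nat.
apply: jet_eq (jetM (jetM (jet_const (- 3%:R * wt_gapped)) (jetX 2 (jet_of_arg i)))
             (jetX 4 (jet_inv_1subx i))) _ _ _ => //.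
  by rewrite -/(lambert i); move: (lambert i) => y; ring.
by rewrite -/(lambert i); move: (lambert i) => y; ring.
Qed.

(** This is where s and r come from: each kern has the logarithmic derivatives
    2 + 4 lambert and -2 + 4 lambert^2. *)
Lemma jet_kern_prod i : jet (kern_prod i) (kern_prod_at1 i)
  (2%:R * i%:R + s i.+1) (- 2%:R * i%:R + r i.+1).
Proof.
elim: i => [|i IHi].
  rewrite /kern_prod big_ord0 s_one r_one !mulr0 !addr0.
  have -> : kern_prod_at1 0 = 1 by rewrite /kern_prod_at1 /qfact big_geq // invr1 expr1n !mulr1.
  exact: (jet_const 1).
rewrite kern_prodS kern_prod_at1S s_succ r_succ.
apply: jet_eq (jetM IHi (jet_kern i)) _ _ _ => //.
  by rewrite -[i.+1%:R]natr1; move: (lambert i) (s i.+1) => *; ring.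
by rewrite -[i.+1%:R]natr1; move: (lambert i) (r i.+1) => *; ring.
Qed.

(** The exponent of q splits as 2 i from the powers of wt_gapped, i (i + 1)
    from the squares of the points of evaluation, and i + 1 from the numerator
    of the source. *)
Lemma U_kern_prod i : U i.+1 = kern_prod_at1 i * q ^+ i.+1.
Proof.
have e1 : (i.+1 ^ 2 + 2 * i.+1 - 2 = (2 * i + i * i.+1) + i.+1)%N by lia.
have e2 : (2 * i.+1 - 2 = 2 * i)%N by lia.
rewrite /U e1 e2 subn1 /kern_prod_at1 /wt_gapped -/(qfact i) [_.-1]/=.
rewrite invrM ?unitrX ?unit_1subq1 ?unit_qfact //.
rewrite (exprD q _ i.+1) (exprD q (2 * i)) (exprM q 2 i) (exprM (1 - q) 2 i).
rewrite -!exprVn; move: (qfact i)^-1 (1 - q)^-1 (q ^+ (i * i.+1)) (q ^+ i.+1) => P v X Y.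
rewrite !(exprMn i); ring.
Qed.

Lemma V_kern_prod i : V i.+1 = kern_prod_at1 i * (wt_gapped * q ^+ i.+1 ^+ 2).
Proof.
have e1 : (i.+1 ^ 2 + 3 * i.+1 = (2 * i + i * i.+1) + (2 + i.+1 * 2))%N by lia.
have e2 : (2 * i.+1 = 2 * i + 2)%N by lia.
rewrite /V e1 e2 subn1 /kern_prod_at1 /wt_gapped -/(qfact i) [_.-1]/=.
rewrite invrM ?unitrX ?unit_1subq1 ?unit_qfact //.
rewrite (exprD q (_ + _)) (exprD q (2 * i)) (exprD q 2) (exprM q 2 i) (exprM q i.+1 2).
rewrite (exprD (1 - q) (2 * i)) (exprM (1 - q) 2 i) (exprS w).
rewrite -!exprVn; move: (qfact i)^-1 (q ^+ (i * i.+1)) (q ^+ i.+1) => P X Y.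
rewrite invrM ?unitrX ?unit_1subq1 // -!exprVn; move: (1 - q)^-1 => v.
rewrite !(exprMn i); ring.
Qed.

Lemma jet_source0 i : jet (kern_prod i * source0 i) (U i.+1 / (1 - q ^+ i.+1))
  (2%:R * i.+1%:R - 1 + s i.+1 + lambert i)
  (- 2%:R * i.+1%:R + 1 + r i.+1 + lambert i ^+ 2).
Proof.
apply: jet_eq (jetM (jet_kern_prod i) (jetM (jet_of_arg i) (jet_inv_1subx i))) _ _ _.
- by rewrite U_kern_prod mulrA.
- by rewrite -/(lambert i) -[i.+1%:R]natr1; move: (lambert i) (s i.+1) => *; ring.
- by rewrite -/(lambert i) -[i.+1%:R]natr1; move: (lambert i) (r i.+1) => *; ring.
Qed.

Lemma jet_source1 i : jet (kern_prod i * source1 i) (U i.+1 / (1 - q ^+ i.+1) ^+ 2)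
  (2%:R * i.+1%:R - 1 + s i.+1 + 2%:R * lambert i)
  (- 2%:R * i.+1%:R + 1 + r i.+1 + 2%:R * lambert i ^+ 2).
Proof.
rewrite /source1 -exprVn.
apply: jet_eq (jetM (jet_kern_prod i) (jetM (jet_of_arg i) (jetX 2 (jet_inv_1subx i)))) _ _ _.
- by rewrite U_kern_prod -exprVn mulrA.
- by rewrite -/(lambert i) -[i.+1%:R]natr1; move: (lambert i) (s i.+1) => *; ring.
- by rewrite -/(lambert i) -[i.+1%:R]natr1; move: (lambert i) (r i.+1) => *; ring.
Qed.

Lemma jet_source2 i : jet (kern_prod i * source2 i) (V i.+1 / (1 - q ^+ i.+1) ^+ 3)
  (2%:R * i.+1%:R + s i.+1 + 3%:R * lambert i)
  (- 2%:R * i.+1%:R + r i.+1 + 3%:R * lambert i ^+ 2).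
Proof.
rewrite /source2 -exprVn.
apply: jet_eq (jetM (jet_kern_prod i) (jetM (jetM (jet_const wt_gapped) (jetX 2 (jet_of_arg i)))
   (jetX 3 (jet_inv_1subx i)))) _ _ _.
- by rewrite V_kern_prod -exprVn mulrA.
- by rewrite -/(lambert i) -[i.+1%:R]natr1; move: (lambert i) (s i.+1) => *; ring.
- by rewrite -/(lambert i) -[i.+1%:R]natr1; move: (lambert i) (r i.+1) => *; ring.
Qed.

Lemma jet_kern_term i : jet (kern_prod i * kern i) (- 3%:R * V i.+1 / (1 - q ^+ i.+1) ^+ 4)
  (2%:R * i.+1%:R + s i.+1 + 4%:R * lambert i)
  (- 2%:R * i.+1%:R + r i.+1 + 4%:R * lambert i ^+ 2).
Proof.
apply: jet_eq (jetM (jet_kern_prod i) (jet_kern i)) _ _ _.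
- rewrite V_kern_prod -exprVn; move: (kern_prod_at1 i) wt_gapped (q ^+ i.+1) (_ ^-1) => *; ring.
- by rewrite -[i.+1%:R]natr1; move: (lambert i) (s i.+1) => *; ring.
- by rewrite -[i.+1%:R]natr1; move: (lambert i) (r i.+1) => *; ring.
Qed.

(** Divisibility by q^N of all coefficients in h, which expresses q-adic
    smallness of a jet. *)
Definition qdiv N (E : jetring) := exists E', E = C (q ^+ N) * E'.

Lemma qdiv_arg k E : qdiv k.+1 (jet_arg k * E).
Proof. by exists ((1 + h) * E); rewrite mulrA. Qed.

Lemma qdivMl N E E' : qdiv N E -> qdiv N (E' * E).
Proof. by case=> F ->; exists (E' * F); rewrite mulrCA. Qed.

Lemma qdiv_source0 i : qdiv i.+1 (source0 i).
Proof. exact: qdiv_arg. Qed.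

Lemma qdiv_source1 i : qdiv i.+1 (source1 i).
Proof. exact: qdiv_arg. Qed.

Lemma qdiv_source2 i : qdiv i.+1 (source2 i).
Proof.
have -> : source2 i = jet_arg i * (C wt_gapped * jet_arg i * ((1 - jet_arg i) ^+ 3)^-1).
  by rewrite /source2; move: (jet_arg i) (C wt_gapped) (_^-1) => *; ring.
exact: qdiv_arg.
Qed.

Lemma qdiv_kern i : qdiv i.+1 (kern i).
Proof.
have -> : kern i = jet_arg i * (- 3%:R * C wt_gapped * jet_arg i * ((1 - jet_arg i) ^+ 4)^-1).
  by rewrite /kern; move: (jet_arg i) (C wt_gapped) (_^-1) => *; ring.
exact: qdiv_arg.
Qed.

Lemma qdiv_kern_prod N : qdiv N (kern_prod N).
Proof.
elim: N => [|N [E EN]]; first by exists (kern_prod 0); rewrite rmorph1 mul1r.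
have [E' E'N] := qdiv_kern N.
exists (C (q ^+ N) * E * E'); rewrite kern_prodS EN E'N.
by rewrite mulrCA.
Qed.

(** Truncation of a series over i >= 1 at index N, with an error divisible by
    q^N. The factor c absorbs the 2 by which jet doubles second coefficients.
    *)
Lemma sum_ge1_jet (F : nat -> series) (T : nat -> jetring) j c :
  (forall i, qdiv i.+1 (T i)) -> (forall i, F i.+1 = c * fps_coef (T i) j) ->
  forall N, exists rho,
    sum_ge1 F = c * (fps_coef (\sum_(i < N) T i) j + q ^+ N * rho).
Proof.
move=> Tq FT N; have [T' TT'] := choice Tq.
pose t i := fps_coef (T' i) j.
have TE i : fps_coef (T i) j = q ^+ i.+1 * t i by rewrite TT' fps_coefCM.
rewrite (@sum_ge1_qsum F (fun i => c * t i)) => [|i]; last by rewrite FT TE mulrCA.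
exists (q * qsum (fun i => t (N + i)%N)).
rewrite qsumZ mulrCA (qsum_trunc N) -qE mulrDr fps_coef_sum mulr_sumr [q * (_ * _)]mulrCA.
congr (_ * (_ + _)).
by apply: eq_bigr => i _; rewrite TE exprS mulrA.
Qed.

(** * The twelve series of the statement *)

(** A is the q-adic limit of the coefficients of h^j in the partial sums of T.
    *)
Definition approx (T : nat -> jetring) j (A : series) :=
  forall N, exists rho, A = fps_coef (\sum_(i < N) T i) j + q ^+ N * rho.

Lemma approx_jet T F j : (forall i, qdiv i.+1 (T i)) ->
  (forall i, F i.+1 = fps_coef (T i) j) -> approx T j (sum_ge1 F).
Proof.
move=> Tq FT N; have [|rho ->] := @sum_ge1_jet F T j 1 Tq _ N.
  by move=> i; rewrite mul1r.
by exists rho; rewrite mul1r.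
Qed.

(** The factor 1/2 in front of iota, kappa, lambda and mu undoes the doubling
    in jet. *)
Lemma approx_jet2 T F : (forall i, qdiv i.+1 (T i)) ->
  (forall i, F i.+1 = 2%:R * fps_coef (T i) 2) ->
  approx T 2 (2%:R^-1 * sum_ge1 F).
Proof.
move=> Tq FT N; have [rho ->] := @sum_ge1_jet F T 2 2%:R Tq FT N.
by exists rho; rewrite mulrA mulVr ?unit_2 // mul1r.
Qed.

(** The summands of the iterated functional equation, without the constants in
    F0, F1, F2 that multiply them. *)
Definition term0 i := kern_prod i * source0 i.
Definition term1 i := kern_prod i * source1 i.
Definition term2 i := kern_prod i * source2 i.
Definition term3 i := kern_prod i * kern i.

Lemma qdiv_term0 i : qdiv i.+1 (term0 i).
Proof. exact/qdivMl/qdiv_source0. Qed.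
Lemma qdiv_term1 i : qdiv i.+1 (term1 i).
Proof. exact/qdivMl/qdiv_source1. Qed.
Lemma qdiv_term2 i : qdiv i.+1 (term2 i).
Proof. exact/qdivMl/qdiv_source2. Qed.
Lemma qdiv_term3 i : qdiv i.+1 (term3 i).
Proof. exact/qdivMl/qdiv_kern. Qed.

Lemma approx_alpha : approx term0 0 alpha.
Proof. by apply: (approx_jet qdiv_term0) => i; have [->] := jet_source0 i. Qed.
Lemma approx_beta : approx term1 0 beta.
Proof. by apply: (approx_jet qdiv_term1) => i; have [->] := jet_source1 i. Qed.
Lemma approx_gamma : approx term2 0 gamma.
Proof. by apply: (approx_jet qdiv_term2) => i; have [->] := jet_source2 i. Qed.
Lemma approx_delta : approx term3 0 delta.
Proof. by apply: (approx_jet qdiv_term3) => i; have [->] := jet_kern_term i. Qed.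

Lemma approx_epsilon : approx term0 1 epsilon.
Proof. by apply: (approx_jet qdiv_term0) => i; have [_ ->] := jet_source0 i. Qed.
Lemma approx_zeta : approx term1 1 zeta.
Proof.
by apply: (approx_jet qdiv_term1) => i; have [_ -> _] := jet_source1 i; rewrite /lambert !mulrA.
Qed.
Lemma approx_eta : approx term2 1 Defs.eta.
Proof.
by apply: (approx_jet qdiv_term2) => i; have [_ -> _] := jet_source2 i; rewrite /lambert !mulrA.
Qed.
Lemma approx_theta : approx term3 1 theta.
Proof.
by apply: (approx_jet qdiv_term3) => i; have [_ -> _] := jet_kern_term i; rewrite /lambert !mulrA.
Qed.

Lemma lambert2 i : lambert i ^+ 2 = q ^+ (2 * i.+1) / (1 - q ^+ i.+1) ^+ 2.
Proof. by rewrite /lambert exprMn exprVn -exprM mulnC. Qed.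

Lemma approx_iota : approx term0 2 Defs.iota.
Proof.
apply: (approx_jet2 qdiv_term0) => i; have [_ _ ->] := jet_source0 i.
rewrite -[q ^+ (2 * _) / _]lambert2 -/(lambert i).
move: (lambert i) (s i.+1) (r i.+1) (U i.+1 / _) => *; ring.
Qed.
Lemma approx_kappa : approx term1 2 kappa.
Proof.
apply: (approx_jet2 qdiv_term1) => i; have [_ _ ->] := jet_source1 i.
rewrite -[2%:R * q ^+ (2 * _) / _]mulrA -[q ^+ (2 * _) / _]lambert2.
rewrite -[2%:R * q ^+ _ / _]mulrA -/(lambert i).
move: (lambert i) (s i.+1) (r i.+1) (U i.+1 / _) => *; ring.
Qed.
Lemma approx_lambda : approx term2 2 lambda.
Proof.
apply: (approx_jet2 qdiv_term2) => i; have [_ _ ->] := jet_source2 i.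
rewrite -[3%:R * q ^+ (2 * _) / _]mulrA -[q ^+ (2 * _) / _]lambert2.
rewrite -[3%:R * q ^+ _ / _]mulrA -/(lambert i).
move: (lambert i) (s i.+1) (r i.+1) (V i.+1 / _) => *; ring.
Qed.
Lemma approx_mu : approx term3 2 mu.
Proof.
apply: (approx_jet2 qdiv_term3) => i; have [_ _ ->] := jet_kern_term i.
rewrite -[4%:R * q ^+ (2 * _) / _]mulrA -[q ^+ (2 * _) / _]lambert2.
rewrite -[4%:R * q ^+ _ / _]mulrA -/(lambert i).
move: (lambert i) (s i.+1) (r i.+1) (_ / _) => *; ring.
Qed.

Lemma approxD S T j A B : approx S j A -> approx T j B ->
  approx (fun i => S i + T i) j (A + B).
Proof.
move=> SA TB N; have [[x ->] [y ->]] := (SA N, TB N).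
by exists (x + y); rewrite big_split fps_coefD mulrDr addrACA.
Qed.

Lemma approxZ S j A c : approx S j A -> approx (fun i => S i * C c) j (A * c).
Proof.
move=> SA N; have [x ->] := SA N; exists (x * c).
by rewrite -mulr_suml [_ * C c]mulrC fps_coefCM mulrDl mulrA [c * _]mulrC.
Qed.

(** The remainder kern_prod N times the value at jet_arg N is divisible by q^N,
    so the iteration can be carried to the limit. *)
Lemma functional_equation_coef H F0 F1 F2 j A0 A1 A2 A3 : height_system H F0 F1 F2 ->
  approx term0 j A0 -> approx term1 j A1 -> approx term2 j A2 -> approx term3 j A3 ->
  fps_coef (jet_eval 0 (Fps H)) j =
     A0 * (1 + F1 + 2%:R * wt_gapped / (1 - q) * F2) + A1 * (F0 + 2%:R * wt_gapped * F2)
   + A2 * (1 - F1 + 2%:R / (1 - q) * F0) + A3 * (- F0).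
Proof.
move=> HS a0 a1 a2 a3; apply: fps_eq_modX => N; rewrite -qE.
have [x xE] := approxD (approxD (approxD (approxZ (1 + F1 + 2%:R * wt_gapped / (1 - q) * F2) a0)
  (approxZ (F0 + 2%:R * wt_gapped * F2) a1))
  (approxZ (1 - F1 + 2%:R / (1 - q) * F0) a2)) (approxZ (- F0) a3) N.
have [D DE] := qdiv_kern_prod N.
exists (fps_coef (D * jet_eval N (Fps H)) j - x).
rewrite xE (functional_equation_iter N HS) fps_coefD DE -[C _ * D * _]mulrA fps_coefCM.
by rewrite mulrBr addrACA subrr addr0.
Qed.

(** At jet_arg 0 the coefficient of h^j is F_j itself, so the coefficients of
    h^0, h^1, h^2 close the system. *)
Lemma greek_system H F0 F1 F2 : height_system H F0 F1 F2 ->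
  let c0 := 1 + F1 + 2%:R * wt_gapped / (1 - q) * F2 in
  let c1 := F0 + 2%:R * wt_gapped * F2 in
  let c2 := 1 - F1 + 2%:R / (1 - q) * F0 in
  [/\ F0 = alpha * c0 + beta * c1 + gamma * c2 - delta * F0,
      F1 = epsilon * c0 + zeta * c1 + Defs.eta * c2 - theta * F0 &
      F2 = Defs.iota * c0 + kappa * c1 + lambda * c2 - mu * F0].
Proof.
move=> HS c0 c1 c2; rewrite -!mulrN; split.
- rewrite -(functional_equation_coef HS approx_alpha approx_beta approx_gamma approx_delta).
  rewrite jet_eval_coef {1}(hsF0 HS); apply: eq_qsum => n.
  by rewrite bin0 mul0n expr0 !mul1r.
- rewrite -(functional_equation_coef HS approx_epsilon approx_zeta approx_eta approx_theta).
  rewrite jet_eval_coef {1}(hsF1 HS); apply: eq_qsum => n.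
  by rewrite bin1 mul0n expr0 mulr1.
- rewrite -(functional_equation_coef HS approx_iota approx_kappa approx_lambda approx_mu).
  rewrite jet_eval_coef {1}(hsF2 HS); apply: eq_qsum => n.
  by rewrite mul0n expr0 mulr1.
Qed.

End Jets.

(** * Solution of the linear system *)

(** P stands for wt_gapped and v for 1 / (1 - q). The brackets are the
    determinant of the system and the numerator belonging to the form F0 + P
    F2. *)
Lemma cramer3 (A : comNzRingType)
  (alpha beta gamma delta epsilon zeta eta theta iota kappa lambda mu : A)
  (P v F0 F1 F2 : A)
  (c0 := 1 + F1 + 2%:R * P * v * F2) (c1 := F0 + 2%:R * P * F2)
  (c2 := 1 - F1 + 2%:R * v * F0) :
  F0 = alpha * c0 + beta * c1 + gamma * c2 - delta * F0 ->
  F1 = epsilon * c0 + zeta * c1 + eta * c2 - theta * F0 ->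
  F2 = iota * c0 + kappa * c1 + lambda * c2 - mu * F0 ->
  (F0 + P * F2) *
  ((1 - beta + delta - epsilon + eta - alpha * zeta + alpha * theta
     + beta * epsilon - beta * eta + gamma * zeta - gamma * theta
     - delta * epsilon + delta * eta)
  - 2%:R * v * (gamma + alpha * eta - gamma * epsilon)
  - 2%:R * P *
    (kappa - beta * mu + delta * kappa - epsilon * kappa + zeta * iota
     - zeta * lambda + eta * kappa - alpha * zeta * mu
     + alpha * theta * kappa + beta * epsilon * mu - beta * eta * mu
     - beta * theta * iota + beta * theta * lambda + gamma * zeta * mu
     - gamma * theta * kappa - delta * epsilon * kappa
     + delta * zeta * iota - delta * zeta * lambda + delta * eta * kappa)
  - 2%:R * P * v *
    (iota + alpha * kappa - alpha * mu - beta * iota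
     + 2%:R * beta * lambda - 2%:R * gamma * kappa + delta * iota
     - epsilon * lambda + eta * iota + alpha * zeta * lambda
     - alpha * eta * kappa - alpha * eta * mu + alpha * theta * lambda
     - beta * epsilon * lambda + beta * eta * iota
     + gamma * epsilon * kappa + gamma * epsilon * mu
     - gamma * zeta * iota - gamma * theta * iota
     - delta * epsilon * lambda + delta * eta * iota)
  - 4%:R * P * v ^+ 2 * (alpha * lambda - gamma * iota)) =
  (alpha + gamma + 2%:R * alpha * eta - 2%:R * gamma * epsilon)
  + P *
    (iota + lambda - alpha * kappa - alpha * mu + beta * iota
     + beta * lambda - gamma * kappa - gamma * mu + delta * iota
     + delta * lambda - 2%:R * epsilon * lambda + 2%:R * eta * iota
     + 2%:R * alpha * zeta * lambda - 2%:R * alpha * eta * kappa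
     - 2%:R * alpha * eta * mu + 2%:R * alpha * theta * lambda
     - 2%:R * beta * epsilon * lambda + 2%:R * beta * eta * iota
     + 2%:R * gamma * epsilon * kappa + 2%:R * gamma * epsilon * mu
     - 2%:R * gamma * zeta * iota - 2%:R * gamma * theta * iota
     - 2%:R * delta * epsilon * lambda + 2%:R * delta * eta * iota)
  + 4%:R * P * v * (alpha * lambda - gamma * iota).
Proof.
move=> /eqP; rewrite -subr_eq0 => /eqP E0.
move=> /eqP; rewrite -subr_eq0 => /eqP E1.
move=> /eqP; rewrite -subr_eq0 => /eqP E2.
(* a_ij is the matrix of the system; (k0, k1, k2) is the row (1, 0, P) times
   its adjugate, so that combining the equations with weights k0, k1, k2 leaves
   det * (F0 + P * F2). *)
pose a00 := 1 - beta - 2%:R * v * gamma + delta.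
pose a01 := gamma - alpha.
pose a02 := - 2%:R * P * (v * alpha + beta).
pose a10 := theta - zeta - 2%:R * v * eta.
pose a11 := 1 + eta - epsilon.
pose a12 := - 2%:R * P * (v * epsilon + zeta).
pose a20 := mu - kappa - 2%:R * v * lambda.
pose a21 := lambda - iota.
pose a22 := 1 - 2%:R * P * (v * iota + kappa).
pose k0 := (a11 * a22 - a12 * a21) + P * (a10 * a21 - a11 * a20).
pose k1 := (a02 * a21 - a01 * a22) + P * (a01 * a20 - a00 * a21).
pose k2 := (a01 * a12 - a02 * a11) + P * (a00 * a11 - a01 * a10).
apply/eqP; rewrite -subr_eq0; apply/eqP.
(* The zeros stand for the three equations, whose left-hand sides replace them. *)
transitivity (k0 * 0 + k1 * 0 + k2 * 0); last by rewrite !mulr0 !addr0.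
rewrite -{1}E0 -{1}E1 -{1}E2 /c0 /c1 /c2.
rewrite /k0 /k1 /k2 /a00 /a01 /a02 /a10 /a11 /a12 /a20 /a21 /a22.
ring.
Qed.

(** Every term is divisible by q. *)
Lemma approx_coef0 T j A : (forall i, qdiv i.+1 (T i)) -> approx T j A ->
  fps_coef A 0 = 0.
Proof.
move=> Tq TA; have [x ->] := TA 1%N; have [E TE] := Tq 0%N.
rewrite fps_coefD expr1 (fps_coefXM x) addr0 big_ord1 TE fps_coefCM expr1.
exact: (fps_coefXM (fps_coef E j) 0).
Qed.

(** Passage to q = 0, as a ring morphism. *)
Definition coef0 (f : series) : {poly rat} := fps_coef f 0.

Lemma coef0_sub : zmod_morphism coef0.
Proof. by []. Qed.

Lemma coef0_mul : monoid_morphism coef0.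
Proof. by split=> // f g; rewrite /coef0 fps_coefM big_ord1. Qed.

HB.instance Definition _ := GRing.isZmodMorphism.Build series {poly rat} coef0 coef0_sub.
HB.instance Definition _ := GRing.isMonoidMorphism.Build series {poly rat} coef0 coef0_mul.

Lemma unit_DEN : DEN \is a GRing.unit.
Proof.
apply: fps_unit1; rewrite -/(coef0 DEN) /DEN.
have := approx_coef0 qdiv_term0 approx_alpha.
have := approx_coef0 qdiv_term1 approx_beta.
have := approx_coef0 qdiv_term2 approx_gamma.
have := approx_coef0 qdiv_term3 approx_delta.
have := approx_coef0 qdiv_term0 approx_epsilon.
have := approx_coef0 qdiv_term2 approx_eta.
rewrite -/(coef0 Defs.eta) -/(coef0 epsilon) -/(coef0 delta) -/(coef0 gamma)
  -/(coef0 beta) -/(coef0 alpha).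
have : coef0 q = 0 by [].
move: alpha beta gamma delta epsilon zeta Defs.eta theta Defs.iota kappa lambda mu.
move: q w => q w al be ga de ep ze et th io ka la mu q0 et0 ep0 de0 ga0 be0 al0.
rewrite !(rmorphB, rmorphD, rmorphM, rmorphXn, rmorph1, rmorph_nat) /=.
rewrite q0 et0 ep0 de0 ga0 be0 al0; ring.
Qed.

(** With u = 1 - q, v its inverse and t = q^2: restores the powers of 1 - q by
    which numerator and denominator are multiplied in the final formula. *)
Lemma clear_denominators (A : comNzRingType) (u v t w a b c d e : A) : u * v = 1 ->
  u ^+ 4 * a - 2%:R * u ^+ 3 * b - 2%:R * t * w * u ^+ 2 * c
    - 2%:R * t * w * u * d - 4%:R * t * w * e =
  u ^+ 4 * (a - 2%:R * v * b - 2%:R * (w * (t * v ^+ 2)) * c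
    - 2%:R * (w * (t * v ^+ 2)) * v * d - 4%:R * (w * (t * v ^+ 2)) * v ^+ 2 * e).
Proof.
move=> uv; have uv2 : u ^+ 2 * v ^+ 2 = 1 by rewrite -exprMn uv expr1n.
transitivity (u ^+ 4 * a - 2%:R * u ^+ 3 * (u * v) * b
  - 2%:R * t * w * u ^+ 2 * (u ^+ 2 * v ^+ 2) * c
  - 2%:R * t * w * u * (u * v) * (u ^+ 2 * v ^+ 2) * d
  - 4%:R * t * w * (u ^+ 2 * v ^+ 2) * (u ^+ 2 * v ^+ 2) * e); last by ring.
by rewrite uv uv2 !mulr1.
Qed.

Lemma clear_denominators_num (A : comNzRingType) (u v t w a b c : A) : u * v = 1 ->
  u ^+ 4 * a + t * w * u ^+ 2 * b + 4%:R * t * w * u * c =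
  u ^+ 4 * (a + (w * (t * v ^+ 2)) * b + 4%:R * (w * (t * v ^+ 2)) * v * c).
Proof.
move=> uv; have uv2 : u ^+ 2 * v ^+ 2 = 1 by rewrite -exprMn uv expr1n.
transitivity (u ^+ 4 * a + t * w * u ^+ 2 * (u ^+ 2 * v ^+ 2) * b
  + 4%:R * t * w * u * (u * v) * (u ^+ 2 * v ^+ 2) * c); last by ring.
by rewrite uv uv2 !mulr1.
Qed.

Lemma height_system_solution H F0 F1 F2 : height_system H F0 F1 F2 ->
  F0 + wt_gapped * F2 = NUM / DEN.
Proof.
move=> HS; have [E0 E1 E2] := greek_system HS.
apply: (mulIr unit_DEN); rewrite divrK ?unit_DEN //.
have uv : (1 - q) * (1 - q)^-1 = 1 by rewrite divrr ?unit_1subq1.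
have cramer := cramer3 E0 E1 E2; rewrite exprVn in cramer.
rewrite /NUM /DEN (clear_denominators _ _ _ _ _ _ _ uv).
rewrite (clear_denominators_num _ _ _ _ _ uv) exprVn -/wt_gapped [LHS]mulrCA.
by rewrite cramer.
Qed.

(** * Summable families of series *)

Section SumsOfFamilies.
Local Open Scope classical_set_scope.

Section Summable.
Variable A : comNzRingType.

(** Only finitely many members contribute to each coefficient; otherwise
    fps_sum would silently drop the coefficient. *)
Definition summable (I : choiceType) (D : set I) (F : I -> fps A) :=
  forall n, finite_set (D `&` [set i | fps_coef (F i) n <> 0]).

Lemma summableS (I : choiceType) (D D' : set I) (F : I -> fps A) :
  D' `<=` D -> summable D F -> summable D' F.
Proof.
by move=> DD sF n; apply: sub_finite_set (sF n) => i [/DD Di Fi].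
Qed.

(** A weight with finitely many members below each bound makes a family
    summable; the weight will be the area. *)
Lemma summable_order (I : choiceType) (D : set I) (F : I -> fps A) (d : I -> nat) :
  (forall i, D i -> exists r, F i = fpsX A ^+ d i * r) ->
  (forall n, finite_set (D `&` [set i | (d i <= n)%N])) -> summable D F.
Proof.
move=> FE dfin n; apply: sub_finite_set (dfin n) => i [Di Fi]; split=> //=.
have [r Fr] := FE i Di; rewrite leqNgt; apply/negP => nd.
by apply: Fi; rewrite Fr fps_coefXnM nd.
Qed.

Lemma eq_fps_sum (I : choiceType) (D : set I) (F G : I -> fps A) :
  (forall i, D i -> F i = G i) -> fps_sum D F = fps_sum D G.
Proof.
move=> FG; apply: fpsP => n; apply: eq_fsbigr => i.
by rewrite inE => /FG ->.
Qed.

Lemma eq_summable (I : choiceType) (D : set I) (F G : I -> fps A) :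
  (forall i, D i -> F i = G i) -> summable D F -> summable D G.
Proof.
move=> FG sF n; apply: sub_finite_set (sF n) => i [Di Gi].
by split=> //=; rewrite FG.
Qed.

Lemma fps_sum_image (I J : choiceType) (D : set I) (f : I -> J) (F : J -> fps A) :
  set_inj D f -> fps_sum (f @` D) F = fps_sum D (F \o f).
Proof. by move=> fI; apply: fpsP => n; apply: fsbig_image. Qed.

(** A coefficient of an infinite sum may be computed on any finite set
    containing the support. *)
Lemma fps_sum_supp (I : choiceType) (D : set I) (F : I -> fps A) (r : {fset I}) n :
  [set` r] `<=` D -> (forall i, D i -> i \notin r -> fps_coef (F i) n = 0) ->
  fps_coef (fps_sum D F) n = \sum_(i <- r) fps_coef (F i) n.
Proof.
move=> rD F0; rewrite /= (fsbigE (enum_fset r)) ?fset_uniq // big_seq_cond [RHS]big_seq.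
by apply: eq_bigl => i; case: (boolP (i \in r)) => //= /rD /mem_set ->.
Qed.

Lemma supp_fset (I : choiceType) (D : set I) (F : I -> fps A) n : summable D F ->
  exists r : {fset I}, [/\ [set` r] `<=` D,
    forall i, D i -> i \notin r -> fps_coef (F i) n = 0 &
    forall i, i \in r -> fps_coef (F i) n <> 0].
Proof.
move=> /(_ n) /finite_fsetP[r rE]; exists r; split.
- by rewrite -rE => i [].
- move=> i Di /negP ir; apply: contrapT => Fi; apply: ir.
  by rewrite -[is_true _]/([set` r] i) -rE.
- by move=> i ir; have : [set` r] i by []; rewrite -rE => -[].
Qed.

Lemma fps_sumZ (I : choiceType) (D : set I) (F : I -> fps A) c :
  summable D F -> fps_sum D (fun i => c * F i) = c * fps_sum D F.
Proof.
move=> sF; apply: fpsP => n; rewrite fps_coefM.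
have [r [rD r0]] : exists r : {fset I}, [set` r] `<=` D /\
    forall k i, (k <= n)%N -> D i -> i \notin r -> fps_coef (F i) k = 0.
  (* One finite set supports all coefficients up to n. *)
  have [R RP] := choice (fun k => supp_fset k sF).
  exists (\bigcup_(k <- index_iota 0 n.+1) R k)%fset; split=> [i|k i kn Di].
    by move/bigfcupP => [k _]; have [+ _ _] := RP k; apply.
  have [_ + _] := RP k => /(_ i Di) R0 inotin; apply: R0.
  apply: contra inotin => iR; apply/bigfcupP.
  by exists k; rewrite ?mem_index_iota ?ltnS ?kn.
rewrite (fps_sum_supp rD) => [|i Di ir]; last first.
  rewrite fps_coefM big1 // => k _.
  by rewrite (r0 (n - k)%N) ?mulr0 // leq_subr.
under eq_bigr do rewrite fps_coefM; rewrite exchange_big; apply: eq_bigr => k _.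
rewrite (fps_sum_supp rD) => [|i Di ir]; first by rewrite mulr_sumr.
by apply: r0 => //; rewrite leq_subr.
Qed.

Section Fibre.
Variables (I J : choiceType) (D : set I) (E : set J) (p : I -> J) (F : I -> fps A).
Hypotheses (sF : summable D F) (pE : forall i, D i -> E (p i)).

Let fib j := [set i | D i /\ p i = j].

Lemma fps_sum_fib_coef n (r : {fset I}) j :
  [set` r] `<=` D -> (forall i, D i -> i \notin r -> fps_coef (F i) n = 0) ->
  fps_coef (fps_sum (fib j) F) n = \sum_(i <- r | p i == j) fps_coef (F i) n.
Proof.
move=> rD r0; rewrite (@fps_sum_supp _ _ _ [fset i in r | p i == j]%fset).
- by rewrite big_fset.
- by move=> i; rewrite /= !inE => /andP[/rD Di /eqP pij]; split.
- move=> i [Di pi]; rewrite !inE pi eqxx andbT; exact: r0.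
Qed.

Lemma summable_fibre : summable E (fun j => fps_sum (fib j) F).
Proof.
move=> n; have [r [rD r0 _]] := supp_fset n sF.
apply: (@sub_finite_set _ _ (p @` [set` r])); last exact/finite_image/finite_fset.
move=> j [_ nz]; apply: contrapT => nj; apply: nz.
rewrite (fps_sum_fib_coef _ rD r0) big_seq_cond big1 // => i /andP[ir /eqP pi].
by case: nj; exists i.
Qed.

(** Summation by the value of a statistic p, the tool for sorting objects by
    their heights and run sizes. *)
Lemma fps_sum_fibre : fps_sum D F = fps_sum E (fun j => fps_sum (fib j) F).
Proof.
apply: fpsP => n; have [r [rD r0 _]] := supp_fset n sF.
rewrite (fps_sum_supp rD r0) (@fps_sum_supp _ _ _ (p @` r)%fset).
- rewrite (partition_big_imfset _ p); apply: eq_bigr => j _.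
  by rewrite (fps_sum_fib_coef _ rD r0).
- by move=> j /imfsetP[i /= /rD Di ->]; exact: pE.
- move=> j _ jr; rewrite (fps_sum_fib_coef _ rD r0) big_seq_cond big1 // => i /andP[ir /eqP pi].
  by move/negP: jr; case; apply/imfsetP; exists i.
Qed.
End Fibre.

Lemma fps_sum_finite (I : choiceType) (D : set I) (r : seq I) (F : I -> fps A) :
  uniq r -> (forall i, D i <-> i \in r) -> fps_sum D F = \sum_(i <- r) F i.
Proof.
move=> ur Dr; apply: fpsP => n; rewrite fps_coef_sum /=.
by rewrite [RHS]fsbig_seq //; apply: eq_fsbigl; apply/seteqP; split=> i /Dr.
Qed.

Lemma fps_sum1 (I : choiceType) (i : I) (F : I -> fps A) : fps_sum [set i] F = F i.
Proof.
rewrite (@fps_sum_finite _ _ [:: i]) ?big_seq1 // => j.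
by rewrite inE; split=> /eqP.
Qed.

Lemma fps_sumU (I : choiceType) (D D' : set I) (F : I -> fps A) :
  summable (D `|` D') F -> (forall i, D i -> ~ D' i) ->
  fps_sum (D `|` D') F = fps_sum D F + fps_sum D' F.
Proof.
move=> sF dis; rewrite (@fps_sum_fibre _ _ _ setT (fun i => `[< D i >])) //.
rewrite (@fps_sum_finite _ _ [:: true; false]) // => [|[]]; last 2 first.
- by split.
- by split.
rewrite big_cons big_seq1.
have -> : [set i | (D `|` D') i /\ `[< D i >] = true] = D.
  apply/seteqP; split=> i /=; first by case=> _ /asboolP.
  by move=> Di; split; [left | apply/asboolP].
have -> // : [set i | (D `|` D') i /\ `[< D i >] = false] = D'.
apply/seteqP; split=> i /=; first by case=> -[Di|//]; rewrite asboolT.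
by move=> D'i; split; [right | apply/asboolPn => /dis].
Qed.

End Summable.

End SumsOfFamilies.

(** * Codes of polyominoes *)

Section Enumeration.
Local Open Scope classical_set_scope.

(** A two-component column up to vertical position: sizes of the lower run, of
    the gap and of the upper run. *)
Definition gapped := (nat * nat * nat)%type.
Definition low (t : gapped) := t.1.1.
Definition gap (t : gapped) := t.1.2.
Definition high (t : gapped) := t.2.

(** The passage from one one-component column to the next: an optional
    two-component column between them with the offset of its lowest cell from
    that of the preceding column, then the offset and the height of the next
    one-component column. Offsets are relative, so that codes do not see
    translations. *)
Definition step := (option (int * gapped) * (int * nat))%type.
(** What follows a one-component column: steps, then possibly a last
    two-component column. *)
Definition cont := (seq step * option (int * gapped))%type.
(** The first step carries the leftmost one-component column and, if present,
    the two-component column to its left. *)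
Definition code := (step * cont)%type.

(** Contact between the run of a cells from level u and the run of b cells from
    level v in the next column to the right. That column is half a cell higher,
    hence one inequality is strict and the other is not. *)
Definition touch (u : int) (a : nat) (v : int) (b : nat) : bool :=
  (v < u + a%:Z) && (u <= v + b%:Z).

Definition gapped_ok (t : gapped) := [&& (0 < low t)%N, (0 < gap t)%N & (0 < high t)%N].
Definition hits_low n z t := touch 0 n z (low t).
Definition hits_high n z t := touch 0 n (z + (low t + gap t)%:Z) (high t).
Definition low_hits t z m := touch 0 (low t) z m.
Definition high_hits t z m := touch (low t + gap t)%:Z (high t) z m.

(** At most one of the four contacts of a two-component column is missing: a
    cycle of four blocks stays connected iff at least three of its edges are
    present. *)
Definition linked (a1 a2 b1 b2 : bool) := [&& a1, a2 & b1 || b2] || [&& a1 || a2, b1 & b2].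

Definition height (st : step) := st.2.2.

Definition step_ok n (st : step) :=
  (0 < height st)%N &&
  match st.1 with
  | None => touch 0 n st.2.1 st.2.2
  | Some (z, t) => gapped_ok t &&
      linked (hits_low n z t) (hits_high n z t)
             (low_hits t st.2.1 st.2.2) (high_hits t st.2.1 st.2.2)
  end.

Definition tail_ok n (o : option (int * gapped)) :=
  if o is Some (z, t) then [&& gapped_ok t, hits_low n z t & hits_high n z t]
  else true.

Fixpoint steps_ok n (ss : seq step) o :=
  if ss is st :: ss' then step_ok n st && steps_ok (height st) ss' o
  else tail_ok n o.

Definition cont_ok n (c : cont) := steps_ok n c.1 c.2.

(** The offset 0 fixes the lowest cell of the leftmost column as the origin. A
    two-component column in first place has a neighbour on one side only, so
    that neighbour must touch both runs. *)
Definition first_ok (st : step) :=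
  (0 < height st)%N &&
  match st.1 with
  | None => st.2.1 == 0
  | Some (z, t) => [&& z == 0, gapped_ok t,
      low_hits t st.2.1 st.2.2 & high_hits t st.2.1 st.2.2]
  end.

Definition code_ok (c : code) := first_ok c.1 && cont_ok (height c.1) c.2.

Definition area_opt (o : option (int * gapped)) :=
  if o is Some (_, t) then (low t + high t)%N else 0%N.
Definition area_step (st : step) := (area_opt st.1 + height st)%N.
Definition area_cont (c : cont) := (\sum_(st <- c.1) area_step st + area_opt c.2)%N.
Definition twos_cont (c : cont) : nat := (\sum_(st <- c.1) isSome st.1 + isSome c.2)%N.

Definition wt_opt (o : option (int * gapped)) : series := q ^+ area_opt o * w ^+ isSome o.
Definition wt_step (st : step) : series := wt_opt st.1 * q ^+ height st.
Definition wt_cont (c : cont) : series := q ^+ area_cont c * w ^+ twos_cont c.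
Definition wt_code (c : code) : series := wt_step c.1 * wt_cont c.2.

Lemma wt_cont_nil o : wt_cont ([::], o) = wt_opt o.
Proof. by rewrite /wt_cont /area_cont /twos_cont !big_nil. Qed.

Lemma wt_cont_cons st ss o :
  wt_cont (st :: ss, o) = wt_step st * wt_cont (ss, o).
Proof.
rewrite /wt_cont /area_cont /twos_cont /wt_step /wt_opt /= !big_cons /area_step.
rewrite -!addnA !exprD; ring.
Qed.

Lemma finite_int_ball K : finite_set [set z : int | (`|z| <= K)%N].
Proof.
apply: (@sub_finite_set _ _ ((fun i : nat => i%:Z - K%:Z) @` `I_(K + K).+1)).
  move=> z /= zK; exists (absz (z + K%:Z)) => /=; lia.
exact/finite_image/finite_II.
Qed.

Lemma finite_nat_le K : finite_set [set n : nat | (n <= K)%N].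
Proof. by apply: sub_finite_set (finite_II K.+1) => n; rewrite /= ltnS. Qed.

Lemma finite_gapped K : finite_set
  [set t : gapped | [/\ (low t <= K)%N, (gap t <= K)%N & (high t <= K)%N]].
Proof.
pose L := [set n : nat | (n <= K)%N].
apply: (@sub_finite_set _ _ ((L `*` L) `*` L)).
  by case=> -[a g] b [/= ? ? ?].
by do 2?apply: finite_setX; apply: finite_nat_le.
Qed.

Lemma finite_opt K : finite_set [set o : option (int * gapped) |
  if o is Some (z, t) then
    [/\ (`|z| <= K)%N, (low t <= K)%N, (gap t <= K)%N & (high t <= K)%N]
  else True].
Proof.
pose T := [set t : gapped | [/\ (low t <= K)%N, (gap t <= K)%N & (high t <= K)%N]].
apply: (@sub_finite_set _ _ ([set None] `|` Some @` ([set z : int | (`|z| <= K)%N] `*` T))).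
  case=> [[z t] /= [? ? ? ?]|_]; last by left.
  by right; exists (z, t).
rewrite finite_setU; split; first exact: finite_set1.
apply/finite_image/finite_setX; [exact: finite_int_ball | exact: finite_gapped].
Qed.

(** A contact bounds the offset by the heights, and a run touching both sides
    of a gap bounds the gap. *)
Lemma finite_steps n N : finite_set [set st | step_ok n st /\ (area_step st <= N)%N].
Proof.
pose K := (2 * (n + N))%N.
pose O := [set o : option (int * gapped) | if o is Some (z, t) then
    [/\ (`|z| <= K)%N, (low t <= K)%N, (gap t <= K)%N & (high t <= K)%N]
  else True].
apply: (@sub_finite_set _ _ (O `*` ([set z : int | (`|z| <= K)%N] `*` [set m | (m <= K)%N]))).
  case=> -[[z [[a g] b]]|] [y m] [/= + ar]; rewrite /area_step /height /= in ar *.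
    rewrite /step_ok /= /height /gapped_ok /linked /hits_low /hits_high /low_hits /high_hits /touch.
    rewrite /low /gap /high /= in ar * => ok.
    by split=> /=; [split | split => /=]; rewrite /K; lia.
  by rewrite /step_ok /= /height /touch => ok; split=> //=; split=> /=; rewrite /K; lia.
apply: finite_setX; first exact: finite_opt.
by apply: finite_setX; [exact: finite_int_ball | exact: finite_nat_le].
Qed.

Lemma finite_tails n N : finite_set [set o | tail_ok n o /\ (area_opt o <= N)%N].
Proof.
pose K := (2 * (n + N))%N.
apply: sub_finite_set (finite_opt K) => -[[z [[a g] b]]|] //= [].
rewrite /gapped_ok /hits_low /hits_high /touch /low /gap /high /= => ok ar.
by split; rewrite /K; lia.
Qed.

(** * Generating functions of continuations *)

Definition conts n := [set c : cont | cont_ok n c].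

(** Strong induction on the area bound, which every step lowers by its positive
    height. *)
Lemma finite_conts N : forall n,
  finite_set (conts n `&` [set c | (area_cont c <= N)%N]).
Proof.
elim/ltn_ind: N => N IHN n.
pose S := [set st | step_ok n st /\ (area_step st <= N)%N].
pose T := [set o | tail_ok n o /\ (area_opt o <= N)%N].
pose next st := conts (height st) `&` [set c | (area_cont c <= N - area_step st)%N].
pose add (st : step) (c : cont) : cont := (st :: c.1, c.2).
apply: (@sub_finite_set _ _ ((fun o => ([::], o) : cont) @` T `|`
          \bigcup_(st in S) (add st @` next st))).
  case=> -[|st ss] o; rewrite /conts /cont_ok /area_cont /= ?big_nil ?big_cons.
    by move=> [ok ar]; left; exists o.
  move=> [/andP[ok1 ok2] ar]; right; exists st; first by split=> //; lia.
  by exists (ss, o) => //; split=> //=; rewrite /area_cont /=; lia.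
rewrite finite_setU; split; first exact/finite_image/finite_tails.
apply: bigcup_finite => [|st [/andP[st0 _] stN]]; first exact: finite_steps.
have [N0|N0] := posnP N; first by move: stN; rewrite /area_step; lia.
by apply/finite_image/IHN; rewrite ltn_subrL N0 andbT /area_step ltn_addl.
Qed.

Lemma summable_conts n : summable (conts n) wt_cont.
Proof.
apply: (@summable_order _ _ _ _ area_cont); last by move=> N; exact: finite_conts.
by move=> c _; exists (w ^+ twos_cont c).
Qed.

(** Every column has positive height; the value 0 at n = 0 makes that index
    disappear from the moments. *)
Definition cont_gf n : series := if n is 0%N then 0 else fps_sum (conts n) wt_cont.

Lemma cont_gf_gt0 n : (0 < n)%N -> cont_gf n = fps_sum (conts n) wt_cont.
Proof. by case: n. Qed.

(** A code factors into its first step and the continuation, whose series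
    depends on the step only through the height of the column reached. *)
Lemma fps_sum_first_step (P : set step) : (forall st, P st -> (0 < height st)%N) ->
  summable [set c : step * cont | P c.1 /\ conts (height c.1) c.2] wt_code ->
  fps_sum [set c : step * cont | P c.1 /\ conts (height c.1) c.2] wt_code =
    fps_sum P (fun st => wt_step st * cont_gf (height st))
  /\ summable P (fun st => wt_step st * cont_gf (height st)).
Proof.
move=> P0 sP.
have E st : P st -> wt_step st * cont_gf (height st) =
    fps_sum [set c | (P c.1 /\ conts (height c.1) c.2) /\ c.1 = st] wt_code.
  move=> Pst; rewrite cont_gf_gt0 ?P0 // -fps_sumZ; last exact: summable_conts.
  have -> : [set c | (P c.1 /\ conts (height c.1) c.2) /\ c.1 = st] =
            (fun c => (st, c)) @` conts (height st).
    apply/seteqP; split=> [[st' c] /= [[_ cok] <-]|_ [c cok <-]]; last by [].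
    by exists c.
  by rewrite fps_sum_image // => c c' _ _ [].
split; last first.
  apply: eq_summable (fun st Pst => esym (E st Pst)) _.
  by apply: summable_fibre => // c [].
rewrite (fps_sum_fibre (p := fst) (E := P) sP) => [|c [] //].
by apply: eq_fps_sum => st Pst; rewrite E.
Qed.

Definition steps n := [set st | step_ok n st].
Definition tails n := [set o | tail_ok n o].

(** A continuation is a tail or begins with a step. *)
Lemma cont_gf_split n : (0 < n)%N ->
  cont_gf n = fps_sum (tails n) wt_opt +
          fps_sum (steps n) (fun st => wt_step st * cont_gf (height st))
  /\ summable (steps n) (fun st => wt_step st * cont_gf (height st)).
Proof.
move=> n0; rewrite cont_gf_gt0 //.
pose Q := [set c : step * cont | steps n c.1 /\ conts (height c.1) c.2].
pose nilc (o : option (int * gapped)) : cont := ([::], o).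
pose addc (c : step * cont) : cont := (c.1 :: c.2.1, c.2.2).
have addI : set_inj Q addc by move=> [st [ss o]] [st' [ss' o']] _ _ [-> -> ->].
have DE : conts n = nilc @` tails n `|` addc @` Q.
  apply/seteqP; split=> [[[|st ss] o] /= ok|c [[o ok <-]|[[st [ss o]] [ok1 ok2] <-]] //].
  - by left; exists o.
  - by right; move/andP: ok => [ok1 ok2]; exists (st, (ss, o)).
  - by rewrite /conts /= /cont_ok /=; apply/andP.
have sD := @summable_conts n; rewrite DE in sD *.
rewrite fps_sumU //; last by move=> _ [o _ <-] [[st c] _].
rewrite !fps_sum_image //; last by move=> o o' _ _ [].
have wE c : Q c -> (wt_cont \o addc) c = wt_code c.
  by case: c => st [ss o] _; rewrite /= wt_cont_cons.
have sQ : summable Q wt_code.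
  move=> N; have := sD N => fD.
  apply: (@sub_finite_set _ _ ((fun c => (head (None, (0, 0%N)) c.1, (behead c.1, c.2)))
     @` ((nilc @` tails n `|` addc @` Q) `&` [set i | fps_coef (wt_cont i) N <> 0]))).
    move=> c [Qc nz]; exists (addc c); last by case: c {Qc nz} => st [].
    by split; [right; exists c | rewrite /mkset (wE c Qc : wt_cont (addc c) = _)].
  exact: finite_image.
have [|E1 E2] := @fps_sum_first_step (steps n) _ sQ; first by move=> st /andP[].
split=> //; rewrite -E1; congr (_ + _); last exact: eq_fps_sum.
by apply: eq_fps_sum => o _; rewrite /= wt_cont_nil.
Qed.

(** * Relative positions of two columns *)

Lemma count_interval K lo hi : (lo <= hi <= K)%N ->
  (\sum_(0 <= i < K) (lo <= i < hi))%N = (hi - lo)%N.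
Proof.
move=> /andP[lohi hiK].
rewrite (big_cat_nat (n := hi)) //= (big_cat_nat (n := lo)) //=.
have S0 : (\sum_(0 <= i < lo) (lo <= i < hi) = \sum_(0 <= i < lo) 0)%N.
  by apply: eq_big_nat => i; lia.
have S1 : (\sum_(lo <= i < hi) (lo <= i < hi) = \sum_(lo <= i < hi) 1)%N.
  by apply: eq_big_nat => i; lia.
have S2 : (\sum_(hi <= i < K) (lo <= i < hi) = \sum_(hi <= i < K) 0)%N.
  by apply: eq_big_nat => i; lia.
by rewrite S0 S1 S2 !sum_nat_const_nat; lia.
Qed.

Lemma sum_sub n G : (n <= G)%N -> (\sum_(1 <= g < G.+1) (n - g))%N = 'C(n, 2).
Proof.
move=> nG; elim: n nG => [|n IHn] nG.
  by rewrite big1 // => g _; rewrite sub0n.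
rewrite binS bin1 -IHn; last exact: ltnW.
transitivity (\sum_(1 <= g < G.+1) ((n - g) + (1 <= g < n.+1)))%N.
  by apply: eq_big_nat => g /andP[g0 _]; case: (ltnP g n.+1); lia.
rewrite big_split /=; congr (_ + _)%N.
transitivity (\sum_(0 <= i < G.+1) (1 <= i < n.+1))%N.
  by rewrite [RHS]big_ltn.
by rewrite count_interval; lia.
Qed.

Lemma double_hits_le n m G : (n <= G)%N ->
  (\sum_(1 <= g < G.+1) (n - g) * (m - g))%N = double_hits n m.
Proof.
case: n => [|n] nG.
  rewrite /double_hits [RHS]big_geq // big1 // => g _; by rewrite sub0n.
rewrite /double_hits (big_cat_nat (n := n.+1)) //=; last exact: leqW.
have -> : (\sum_(n.+1 <= g < G.+1) (n.+1 - g) * (m - g) = \sum_(n.+1 <= g < G.+1) 0)%N.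
  by apply: eq_big_nat => g /andP[+ _]; rewrite -subn_eq0 => /eqP ->.
by rewrite sum_nat_const_nat muln0 addn0.
Qed.

Section Counts.
Variable A : comNzRingType.

(** The indicator of at least three of four conditions is the sum of the four
    triple products minus three times the product of all four, which the four
    triple products count four times. *)
Lemma sum_linked (I J : Type) (r : seq I) (r' : seq J) (A1 A2 : I -> bool) (B1 B2 : J -> bool)
   (a1 a2 a12 b1 b2 b12 : nat) :
  (\sum_(i <- r) A1 i = a1)%N -> (\sum_(i <- r) A2 i = a2)%N ->
  (\sum_(i <- r) (A1 i && A2 i) = a12)%N ->
  (\sum_(j <- r') B1 j = b1)%N -> (\sum_(j <- r') B2 j = b2)%N ->
  (\sum_(j <- r') (B1 j && B2 j) = b12)%N ->
  \sum_(i <- r) \sum_(j <- r') (linked (A1 i) (A2 i) (B1 j) (B2 j))%:R =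
    a12%:R * (b1%:R + b2%:R) + (a1%:R + a2%:R) * b12%:R - 3%:R * (a12%:R * b12%:R) :> A.
Proof.
move=> <- <- <- <- <- <-; rewrite !natr_sum.
set S1 := \sum_(i <- r) _; set S2 := \sum_(i <- r) _; set S12 := \sum_(i <- r) _.
set T1 := \sum_(j <- r') _; set T2 := \sum_(j <- r') _; set T12 := \sum_(j <- r') _.
have E i j : (linked (A1 i) (A2 i) (B1 j) (B2 j))%:R =
    (A1 i && A2 i)%:R * ((B1 j)%:R + (B2 j)%:R - 3%:R * (B1 j && B2 j)%:R)
    + ((A1 i)%:R + (A2 i)%:R) * (B1 j && B2 j)%:R :> A.
  by rewrite /linked; case: (A1 i) (A2 i) (B1 j) (B2 j) => [] [] [] [] /=; ring.
transitivity (\sum_(i <- r) ((A1 i && A2 i)%:R * (T1 + T2 - 3%:R * T12)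
    + ((A1 i)%:R + (A2 i)%:R) * T12)).
  apply: eq_bigr => i _; rewrite (eq_bigr _ (fun j _ => E i j)).
  by rewrite big_split /= -!mulr_sumr sumrB big_split /= -mulr_sumr.
by rewrite big_split /= -!mulr_suml big_split /= -/S1 -/S2 -/S12; ring.
Qed.

(** The placements of a gapped column with runs a, b between runs of n and m
    cells, as (gap, (i, j)). With offsets z of the gapped column and z' of the
    following run, i = z + (a + gap + b) and j = z' + m are natural numbers as
    soon as there is some contact on each side. *)
Definition via_offsets (n m a b : nat) : set (nat * (nat * nat)) :=
  [set x | (0 < x.1)%N /\
    linked (x.1 + b <= x.2.1 < n + a + x.1 + b)%N (x.2.1 < n + b)%N
           (x.2.2 < a + m)%N (a + x.1 <= x.2.2 < a + x.1 + b + m)%N].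

(** The placement count summed over the gap, with sum_g (n - g)^+ = C(n, 2). *)
Definition via_count (n m a b : nat) : A :=
  'C(n, 2)%:R * (2 * m + a + b)%:R + 'C(m, 2)%:R * (2 * n + a + b)%:R - 3%:R * (double_hits n m)%:R.

(** For each gap the contacts with the left run depend on i alone and those
    with the right run on j alone, so sum_linked applies; the intervals of i
    and j have lengths n + a, n + b, n - g and a + m, b + m, m - g. *)
Lemma fps_sum_via n m a b (c : fps A) :
  fps_sum (via_offsets n m a b) (fun=> c) = fps_const (via_count n m a b) * c.
Proof.
(* G bounds the gap and L the offsets of a placement satisfying P. *)
pose G := (n + m)%N; pose L := (2 * (n + m) + a + b)%N.
pose P (x : nat * (nat * nat)) := linked (x.1 + b <= x.2.1 < n + a + x.1 + b)%N (x.2.1 < n + b)%N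
           (x.2.2 < a + m)%N (a + x.1 <= x.2.2 < a + x.1 + b + m)%N.
pose box := [seq (i, j) | i <- index_iota 0 L, j <- index_iota 0 L].
pose s := [seq (g, ij) | g <- index_iota 1 G.+1, ij <- box].
have us : uniq s.
  apply: allpairs_uniq; [exact: iota_uniq | | by move=> [? ?] [? ?] _ _ [-> ->]].
  by apply: allpairs_uniq; [exact: iota_uniq | exact: iota_uniq | move=> [? ?] [? ?] _ _ [-> ->]].
rewrite (@fps_sum_finite _ _ _ [seq x <- s | P x]) ?filter_uniq //; last first.
  move=> [g [i j]]; rewrite mem_filter; split; last first.
    move=> /andP[Px /allpairsP[[g' ij] /= [+ _ [gg _]]]].
    by rewrite -gg mem_index_iota => /andP[g0 _]; split.
  move=> [g0 Px]; apply/andP; split; first exact: Px.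
  apply/allpairsP; exists (g, (i, j)); split=> //=.
    by rewrite mem_index_iota; move: Px g0; rewrite /P /linked /G /=; lia.
  apply/allpairsP; exists (i, j); split=> //=.
    by rewrite mem_index_iota; move: Px g0; rewrite /P /linked /L /=; lia.
  by rewrite mem_index_iota; move: Px g0; rewrite /P /linked /L /=; lia.
rewrite big_filter big_mkcond big_allpairs /=.
transitivity (\sum_(1 <= g < G.+1) fps_const (
    (n - g)%:R * ((a + m)%:R + (b + m)%:R) + ((n + a)%:R + (n + b)%:R) * (m - g)%:R
    - 3%:R * ((n - g) * (m - g))%:R) * c).
  apply: eq_big_nat => g /andP[g0 gG]; rewrite big_allpairs natrM.
  rewrite -(@sum_linked _ _ (index_iota 0 L) (index_iota 0 L)
     (fun i => g + b <= i < n + a + g + b)%N (fun i => i < n + b)%N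
     (fun j => j < a + m)%N (fun j => a + g <= j < a + g + b + m)%N
     (n + a) (n + b) (n - g) (a + m) (b + m) (m - g)).
  - rewrite rmorph_sum mulr_suml; apply: eq_bigr => i _.
    rewrite rmorph_sum mulr_suml; apply: eq_bigr => j _.
    by rewrite /P /=; case: ifP; rewrite ?rmorph1 ?rmorph0 ?mul1r ?mul0r.
  - by rewrite count_interval /L; lia.
  - by rewrite (@count_interval L 0) /L; lia.
  - have [gn|ng] := leqP g n.
      rewrite (eq_bigr (fun i => (g + b <= i < n + b)%N : nat)) => [|i _]; last lia.
      by rewrite count_interval /L; lia.
    by rewrite big1 => [|i _]; lia.
  - by rewrite (@count_interval L 0) /L; lia.
  - by rewrite count_interval /L; lia.
  - have [gm|mg] := leqP g m.
      rewrite (eq_bigr (fun i => (a + g <= i < a + m)%N : nat)) => [|i _]; last lia.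
      by rewrite count_interval /L; lia.
    by rewrite big1 => [|i _]; lia.
rewrite -mulr_suml -rmorph_sum sumrB big_split /= -mulr_suml -mulr_sumr -mulr_sumr.
rewrite -!natr_sum !sum_sub ?double_hits_le ?leq_addr ?leq_addl //.
rewrite /via_count.
have -> : (2 * m + a + b = (a + m) + (b + m))%N by lia.
have -> : (2 * n + a + b = (n + a) + (n + b))%N by lia.
by rewrite -!natrD; congr (fps_const _ * _); ring.
Qed.
End Counts.

(** Summation by parts, which lowers the degree of a polynomial summand. *)
Lemma qsum_diff (u : nat -> series) :
  (1 - q) * qsum u = u 0%N + q * qsum (fun i => u i.+1 - u i).
Proof. by rewrite qsumB mulrBl mul1r {1}qsum_recl -qE; ring. Qed.

Lemma qsum_pos (X : series) :
  qsum (fun b => if b == 0%N then 0 else X) = q / (1 - q) * X.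
Proof.
apply: (mulrI unit_1subq1); rewrite mulrA mulrCA divrr ?unit_1subq1 // mulr1.
rewrite qsum_diff add0r (eq_qsum (v := fun i => if i == 0%N then X else 0)).
  by rewrite qsum_delta mul1r.
by case=> [|i] /=; rewrite ?subr0 ?subrr.
Qed.

Lemma qsum_posn (Y : series) :
  qsum (fun b => if b == 0%N then 0 else b%:R * Y) = q / (1 - q) ^+ 2 * Y.
Proof.
have U : (1 - q) ^+ 2 \is a GRing.unit by rewrite unitrX ?unit_1subq1.
apply: (mulrI U); rewrite [RHS]mulrA mulrCA divrr // mulr1.
rewrite expr2 -[X in X = _]mulrA qsum_diff add0r [LHS]mulrCA; congr (_ * _).
rewrite (eq_qsum (v := fun=> Y)); last first.
  by case=> [|i] /=; [rewrite subr0 mul1r | rewrite -mulrBl -natrB // subSnn mul1r].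
rewrite qsum_diff (eq_qsum (v := fun=> 0)) => [|i]; last by rewrite subrr.
by rewrite qsum0 mulr0 addr0.
Qed.

Definition pos_pairs := [set ab : nat * nat | (0 < ab.1)%N && (0 < ab.2)%N].

Lemma finite_pos_pairs n : finite_set (pos_pairs `&` [set ab | (ab.1 + ab.2 <= n)%N]).
Proof.
apply: (@sub_finite_set _ _ ([set a | (a <= n)%N] `*` [set b | (b <= n)%N])).
  by case=> a b [_ /= abn]; split=> /=; lia.
by apply: finite_setX; apply: finite_nat_le.
Qed.

Lemma summable_pos_pairs (r : nat -> nat -> series) :
  summable pos_pairs (fun ab => q ^+ (ab.1 + ab.2) * r ab.1 ab.2).
Proof.
apply: (@summable_order _ _ _ _ (fun ab => ab.1 + ab.2)%N); last exact: finite_pos_pairs.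
by move=> ab _; exists (r ab.1 ab.2).
Qed.

(** Sum over the two run sizes of a weight that is affine in their total, the
    only dependence on a and b that occurs. *)
Lemma fps_sum_pos_pairs (X Y : series) :
  fps_sum pos_pairs (fun ab => q ^+ (ab.1 + ab.2) * (X + (ab.1 + ab.2)%:R * Y))
  = q ^+ 2 / (1 - q) ^+ 2 * (X + 2%:R / (1 - q) * Y).
Proof.
have S := summable_pos_pairs (fun a b => X + (a + b)%:R * Y).
rewrite (fps_sum_fibre (p := fst) (E := [set a | (0 < a)%N]) S) => [|[a b] /andP[]//].
pose u a b : series := if b == 0%N then 0 else X + (a + b)%:R * Y.
rewrite (fps_sum_qsum (r := fun a => if a == 0%N then 0 else qsum (u a))) => [|a a0|a a0]; last 2 first.
- rewrite (gtn_eqF a0).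
  have -> : [set i | pos_pairs i /\ i.1 = a] = (fun b => (a, b)) @` [set b | (0 < b)%N].
    apply/seteqP; split=> [[a1 b] [/andP[_ b0] /= <-]|_ [b b0 <-]]; first by exists b.
    by split=> //; apply/andP.
  rewrite fps_sum_image => [|b b' _ _ []//].
  rewrite (fps_sum_qsum (r := fun b => q ^+ a * u a b)) ?qsumZ // => b b0.
    by rewrite /u (gtn_eqF b0) /= exprD -mulrA mulrCA.
  by rewrite /u; case: b b0 => [_|b []] //; rewrite mulr0.
- by case: a a0 => // a [].
have E a : qsum (u a) = q / (1 - q) * X + a%:R * (q / (1 - q) * Y) + q / (1 - q) ^+ 2 * Y.
  rewrite -qsum_pos -qsum_pos -qsum_posn -qsumZ -!qsumD; apply: eq_qsum => -[|b] /=.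
    by rewrite mulr0 !addr0.
  by rewrite /u /= natrD; ring.
under eq_qsum do rewrite E.
rewrite (eq_qsum (v := fun a => (if a == 0%N then 0 else q / (1 - q) * X + q / (1 - q) ^+ 2 * Y)
   + (if a == 0%N then 0 else a%:R * (q / (1 - q) * Y)))) => [|a].
  rewrite qsumD qsum_pos qsum_posn -exprVn; move: (1 - q)^-1 => v; ring.
by case: eqP => _; rewrite ?addr0 //; ring.
Qed.

(** The placements (gap, i) of a two-component column next to a single run of n
    cells touching both of its runs; as above, i is the offset made
    nonnegative. *)
Definition end_offsets (n b : nat) : set (nat * nat) :=
  [set x | (0 < x.1)%N /\ (x.1 + b <= x.2 < n + b)%N].

Lemma fps_sum_end (A : comNzRingType) n b (c : fps A) :
  fps_sum (end_offsets n b) (fun=> c) = 'C(n, 2)%:R * c.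
Proof.
pose s := [seq (g, i) | g <- index_iota 1 n.+1, i <- index_iota 0 (n + b)].
pose P (x : nat * nat) := (x.1 + b <= x.2 < n + b)%N.
have us : uniq s.
  by apply: allpairs_uniq; [exact: iota_uniq | exact: iota_uniq | move=> [? ?] [? ?] _ _ [-> ->]].
rewrite (@fps_sum_finite _ _ _ [seq x <- s | P x]) ?filter_uniq //; last first.
  move=> [g i]; rewrite mem_filter; split; last first.
    move=> /andP[Px /allpairsP[[g' i'] /= [+ _ [gg _]]]].
    by rewrite -gg mem_index_iota => /andP[g0 _]; split.
  move=> [g0 Px]; apply/andP; split; first exact: Px.
  by apply/allpairsP; exists (g, i); split=> //=; rewrite mem_index_iota; move: Px g0 => /=; lia.
rewrite big_filter big_mkcond big_allpairs /=.
rewrite -(sum_sub (leqnn n)) natr_sum mulr_suml; apply: eq_big_nat => g /andP[g0 gn].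
rewrite -(subnDr b n g).
rewrite -(@count_interval (n + b) (g + b) (n + b)); last by lia.
rewrite natr_sum mulr_suml; apply: eq_bigr => i _.
by rewrite /P /=; case: ifP; rewrite ?mul1r ?mul0r.
Qed.

Lemma fps_sum_direct (A : comNzRingType) n m (c : fps A) :
  fps_sum [set z | touch 0 n z m] (fun=> c) = (n + m)%:R * c.
Proof.
have -> : [set z | touch 0 n z m] = (fun k : nat => k%:Z - m%:Z) @` `I_(n + m).
  apply/seteqP; split=> [z|_ [k /= knm <-]]; rewrite /touch /=; last by lia.
  by move=> zt; exists (absz (z + m%:Z)) => /=; lia.
rewrite fps_sum_image; last by move=> k k' _ _ /=; lia.
rewrite (@fps_sum_finite _ _ _ (index_iota 0 (n + m))) ?iota_uniq //; last first.
  by move=> k; rewrite mem_index_iota.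
by rewrite big_const_nat subn0 iter_addr_0 mulr_natl.
Qed.

Definition sizes (t : gapped) := (low t, high t).

Lemma fps_sum_tails n : (0 < n)%N ->
  fps_sum (tails n) wt_opt = 1 + wt_gapped * 'C(n, 2)%:R.
Proof.
move=> n0; pose T := [set x : int * gapped | tail_ok n (Some x)].
have TE : tails n = [set None] `|` Some @` T.
  apply/seteqP; split=> [[x|] ok|o [->|[x ok <-]]] //; last by left.
  by right; exists x.
have sT : summable (tails n) wt_opt.
  apply: (@summable_order _ _ _ _ area_opt); first by move=> o _; exists (w ^+ isSome o).
  exact: finite_tails.
rewrite TE in sT *.
rewrite fps_sumU //; last by move=> _ -> [].
rewrite fps_sum1 {1}/wt_opt mul1r expr0; congr (_ + _).
rewrite fps_sum_image; last by move=> x y _ _ [].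
have sT' : summable T (wt_opt \o Some).
  apply: (@summable_order _ _ _ _ (area_opt \o Some)); first by move=> o _; exists (w ^+ 1).
  move=> N; apply: (@sub_finite_set _ _ ((odflt (0, (0, 0, 0)%N)) @`
     [set o | tail_ok n o /\ (area_opt o <= N)%N])); first by move=> x [ok ar]; exists (Some x).
  exact/finite_image/finite_tails.
rewrite (fps_sum_fibre (p := sizes \o snd) (E := pos_pairs) sT'); last first.
  by case=> z t /and3P[/and3P[? ? ?] _ _]; apply/andP.
pose X : series := w * 'C(n, 2)%:R.
rewrite (eq_fps_sum (G := fun ab => q ^+ (ab.1 + ab.2) * (X + (ab.1 + ab.2)%:R * 0))).
  rewrite (fps_sum_pos_pairs X 0) mulr0 addr0 /wt_gapped /X; ring.
move=> [a b] /andP[/= a0 b0]; rewrite mulr0 addr0.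
have -> : [set x | T x /\ (sizes \o snd) x = (a, b)] =
   (fun gi : nat * nat => (gi.2%:Z - (a + gi.1 + b)%:Z, (a, gi.1, b))) @` end_offsets n b.
  apply/seteqP; split=> [[z [[a' g] b']]|_ [[g i] [/= g0 gi] <-]].
    rewrite /T /= /gapped_ok /hits_low /hits_high /touch /sizes /low /gap /high /=.
    move=> [ok [? ?]]; subst a' b'; exists (g, absz (z + (a + g + b)%:Z)).
      by rewrite /end_offsets /=; lia.
    by congr (_, _); rewrite /=; lia.
  rewrite /T /= /gapped_ok /hits_low /hits_high /touch /sizes /low /gap /high /=.
  by split=> //; lia.
rewrite fps_sum_image; last first.
  by move=> [g i] [g' i'] _ _ /= [ii gg]; congr (_, _); [| move: ii gg]; lia.
rewrite (eq_fps_sum (G := fun=> q ^+ (a + b) * w)) // fps_sum_end /X; ring.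
Qed.

(** * The height system of the continuations *)

Definition via_sizes (st : step) : option (nat * nat) := omap (sizes \o snd) st.1.

(** Sorts the steps by the height m reached and by the run sizes of the
    two-component column passed. cD m and cV m a b are the numbers of
    placements for fixed sizes, which carry no weight of their own since area
    does not depend on offsets or gaps. *)
Lemma fps_sum_steps (S : set step) (cD : nat -> series) (cV : nat -> nat -> nat -> series) :
  summable S (fun st => wt_step st * cont_gf (height st)) ->
  (forall st, S st -> (0 < height st)%N /\
     if st.1 is Some (_, t) then gapped_ok t else true) ->
  (forall m (c : series), (0 < m)%N ->
     fps_sum [set st | S st /\ (height st, via_sizes st) = (m, None)] (fun=> c) = cD m * c) ->
  (forall m a b (c : series), (0 < m)%N -> (0 < a)%N -> (0 < b)%N ->
     fps_sum [set st | S st /\ (height st, via_sizes st) = (m, Some (a, b))] (fun=> c)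
     = cV m a b * c) ->
  fps_sum S (fun st => wt_step st * cont_gf (height st)) =
  qsum (fun m => cont_gf m *
    (cD m + w * fps_sum pos_pairs (fun ab => q ^+ (ab.1 + ab.2) * cV m ab.1 ab.2))).
Proof.
move=> sS S0 SD SV.
pose E := [set k : nat * option (nat * nat) | (0 < k.1)%N /\
   if k.2 is Some ab then pos_pairs ab else True].
have SE st : S st -> E (height st, via_sizes st).
  move=> /S0[st0 H]; split=> //; rewrite /via_sizes.
  by case: st {st0} H => -[[z t]|] y //= /and3P[? ? ?]; apply/andP.
pose wk (k : nat * option (nat * nat)) : series := q ^+ k.1 * cont_gf k.1 *
  (if k.2 is Some ab then cV k.1 ab.1 ab.2 * (q ^+ (ab.1 + ab.2) * w) else cD k.1).
have fibE k : E k ->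
    fps_sum [set st | S st /\ (height st, via_sizes st) = k]
      (fun st => wt_step st * cont_gf (height st)) = wk k.
  case: k => m [[a b]|] [/= m0 ab0].
    case/andP: ab0 => /= a0 b0.
    rewrite (eq_fps_sum (G := fun=> q ^+ (a + b) * w * (q ^+ m * cont_gf m))) => [|st].
      by rewrite SV // /wk /=; ring.
    move=> [_ []]; rewrite /via_sizes; case: st => -[[z t]|] [y m'] //= hm [<- <-].
    by rewrite /wt_step /wt_opt /= -hm /height /=; ring.
  rewrite (eq_fps_sum (G := fun=> q ^+ m * cont_gf m)) => [|st].
    by rewrite SD // /wk /=; ring.
  move=> [_ []]; rewrite /via_sizes; case: st => -[[z t]|] [y m'] //= hm _.
  by rewrite /wt_step /wt_opt /= -hm /height /=; ring.
rewrite (fps_sum_fibre (p := fun st => (height st, via_sizes st)) (E := E) sS) //.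
rewrite (eq_fps_sum fibE).
have sE : summable E wk := eq_summable fibE (@summable_fibre _ _ _ S E (fun st => (height st, via_sizes st)) _ sS).
rewrite (fps_sum_fibre (p := fst) (E := [set m | (0 < m)%N]) sE) => [|k [] //].
apply: fps_sum_qsum => m m0; last by case: m m0 => [_|m []] //; rewrite mul0r.
have sEm : summable [set k | E k /\ k.1 = m] wk by apply: summableS sE => k [].
have EmE : [set k | E k /\ k.1 = m] =
   [set (m, None)] `|` (fun ab => (m, Some ab)) @` pos_pairs.
  apply/seteqP; split=> [[m' [ab|]] [[/= _ abp] <-]|k [->|[ab abp <-]]] //; last by left.
  by right; exists ab.
rewrite EmE in sEm *.
rewrite fps_sumU //; last by move=> _ -> [].
rewrite fps_sum1 fps_sum_image; last by move=> ab ab' _ _ [].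
pose W : series := q ^+ m * cont_gf m * w.
rewrite (eq_fps_sum (G := fun ab => W * (q ^+ (ab.1 + ab.2) * cV m ab.1 ab.2))).
  by rewrite fps_sumZ; [rewrite /wk /W /=; ring | exact: summable_pos_pairs].
by move=> ab _; rewrite /wk /W /=; ring.
Qed.

Definition moment0 := qsum cont_gf.
Definition moment1 := qsum (fun m => m%:R * cont_gf m).
Definition moment2 := qsum (fun m => 'C(m, 2)%:R * cont_gf m).

Definition firsts := [set st | first_ok st].

Lemma fps_sum_steps_ok n : (0 < n)%N ->
  fps_sum (steps n) (fun st => wt_step st * cont_gf (height st)) =
  qsum (fun m => cont_gf m * ((n + m)%:R + w * (q ^+ 2 / (1 - q) ^+ 2 *
     ('C(n, 2)%:R * (2%:R * m%:R) + 'C(m, 2)%:R * (2%:R * n%:R) - 3%:R * (double_hits n m)%:R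
      + 2%:R / (1 - q) * ('C(n, 2)%:R + 'C(m, 2)%:R))))).
Proof.
move=> n0; have [_ sS] := cont_gf_split n0.
rewrite (@fps_sum_steps _ (fun m => (n + m)%:R)
  (fun m a b => fps_const (via_count {poly rat} n m a b)) sS).
- apply: eq_qsum => m; congr (_ * (_ + _ * _)).
  rewrite -fps_sum_pos_pairs; apply: eq_fps_sum => -[a b] _ /=; congr (_ * _).
  rewrite /via_count !(rmorphB, rmorphD, rmorphM, rmorph_nat) /= !rmorph1.
  ring.
- by move=> st /andP[st0 ok]; split=> //; case: st ok {st0} => -[[z t]|] //= y /andP[].
- move=> m c m0.
  have -> : [set st | steps n st /\ (height st, via_sizes st) = (m, None)] =
      (fun z : int => (None, (z, m))) @` [set z | touch 0 n z m].
    apply/seteqP; split=> [[[[z t]|] [y m']] [/andP[st0 ok] []] //= <-|_ [z zt <-]].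
      by exists y.
    by split=> //; apply/andP.
  rewrite fps_sum_image; last by move=> z z' _ _ [].
  exact: fps_sum_direct.
move=> m a b c m0 a0 b0.
have -> : [set st | steps n st /\ (height st, via_sizes st) = (m, Some (a, b))] =
  (fun x : nat * (nat * nat) => (Some (x.2.1%:Z - (a + x.1 + b)%:Z, (a, x.1, b)),
      (x.2.2%:Z - m%:Z, m))) @` via_offsets n m a b.
  apply/seteqP; split=> [[[[z [[a' g] b']]|] [y m']] [/andP[st0 /= ok] []] //|].
    rewrite /height /sizes /low /high /= => mm aa bb; subst m' a' b'.
    move: ok; rewrite /gapped_ok /linked /hits_low /hits_high /low_hits /high_hits /touch.
    rewrite /low /high /gap /= => ok.
    exists (g, (absz (z + (a + g + b)%:Z), absz (y + m%:Z))).
      by rewrite /via_offsets /linked /=; lia.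
    by congr (Some (_, _), (_, _)); rewrite /=; lia.
  move=> _ [[g [i j]] [/= g0 ok] <-]; split=> //; apply/andP; split=> //=.
  move: ok; rewrite /gapped_ok /linked /hits_low /hits_high /low_hits /high_hits /touch.
  by rewrite /low /high /gap /=; lia.
rewrite fps_sum_image; last first.
  move=> [g [i j]] [g' [i' j']] _ _ /= [ii gg jj]; congr (_, (_, _)) => //; lia.
exact: fps_sum_via.
Qed.

(** Once the placement counts are expanded, every term is a polynomial in n
    times a moment, except for the double_hits sum. *)
Lemma cont_gf_system : height_system cont_gf moment0 moment1 moment2.
Proof.
split=> // n; have [-> _] := cont_gf_split (ltn0Sn n).
rewrite fps_sum_tails // fps_sum_steps_ok //; set N := n.+1.
pose v : series := (1 - q)^-1.
have wpE : wt_gapped = w * (q ^+ 2 * v ^+ 2) by rewrite /wt_gapped -exprVn.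
pose cN : series := 'C(N, 2)%:R.
rewrite (eq_qsum (v := fun m =>
   ((N%:R + 2%:R * wt_gapped * v * cN) * cont_gf m + (1 + 2%:R * wt_gapped * cN) * (m%:R * cont_gf m))
   + ((2%:R * wt_gapped * N%:R + 2%:R * wt_gapped * v) * ('C(m, 2)%:R * cont_gf m)
   - 3%:R * wt_gapped * ((double_hits N m)%:R * cont_gf m)))) => [|m].
  rewrite qsumD qsumD qsumB !qsumZ -/moment0 -/moment1 -/moment2 -/v -/cN.
  move: (qsum _) => K; ring.
rewrite -exprVn -/v -/cN wpE natrD; move: (cont_gf m) (double_hits N m)%:R => x y; ring.
Qed.

Definition codes := [set c : step * cont | firsts c.1 /\ conts (height c.1) c.2].

Lemma finite_firsts N : finite_set (firsts `&` [set st | (area_step st <= N)%N]).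
Proof.
pose K := (2 * N)%N.
pose O := [set o : option (int * gapped) | if o is Some (z, t) then
    [/\ (`|z| <= K)%N, (low t <= K)%N, (gap t <= K)%N & (high t <= K)%N]
  else True].
apply: (@sub_finite_set _ _ (O `*` ([set z : int | (`|z| <= K)%N] `*` [set m | (m <= K)%N]))).
  case=> -[[z [[a g] b]]|] [y m] [/= + ar]; rewrite /area_step /height /= in ar *.
    rewrite /firsts /= /first_ok /= /height /gapped_ok /low_hits /high_hits /touch.
    rewrite /low /gap /high /= in ar * => ok.
    by split=> /=; [split | split => /=]; rewrite /K; lia.
  by rewrite /firsts /= /first_ok /= /height => ok; split=> //=; split=> /=; rewrite /K; lia.
apply: finite_setX; first exact: finite_opt.
by apply: finite_setX; [exact: finite_int_ball | exact: finite_nat_le].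
Qed.

Lemma wt_codeE c : wt_code c = q ^+ (area_step c.1 + area_cont c.2) *
                               w ^+ (isSome c.1.1 + twos_cont c.2).
Proof.
rewrite /wt_code /wt_step /wt_opt /wt_cont /area_step !exprD; ring.
Qed.

Lemma summable_codes : summable codes wt_code.
Proof.
apply: (@summable_order _ _ _ _ (fun c => area_step c.1 + area_cont c.2)%N).
  by move=> c _; rewrite wt_codeE; exists (w ^+ (isSome c.1.1 + twos_cont c.2)).
move=> N; pose S := firsts `&` [set st | (area_step st <= N)%N].
apply: (@sub_finite_set _ _ (\bigcup_(st in S) ((fun c => (st, c)) @`
    (conts (height st) `&` [set c | (area_cont c <= N)%N])))).
  case=> st c [[fst cst] /= ar]; exists st; first by split=> //=; lia.
  by exists c => //; split=> //=; lia.
apply: bigcup_finite => [|st _]; first exact: finite_firsts.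
exact/finite_image/finite_conts.
Qed.

(** A leftmost two-component column can be placed before a run of m cells in
    C(m, 2) ways for given run sizes, whence the second moment. *)
Lemma fps_sum_codes : fps_sum codes wt_code = moment0 + wt_gapped * moment2.
Proof.
have P0 st : firsts st -> (0 < height st)%N by case/andP.
have [-> sF] := fps_sum_first_step P0 summable_codes.
rewrite (@fps_sum_steps _ (fun=> 1) (fun m _ _ => 'C(m, 2)%:R) sF).
- rewrite /moment0 /moment2 -qsumZ -qsumD; apply: eq_qsum => m.
  rewrite (eq_fps_sum (G := fun ab => q ^+ (ab.1 + ab.2) *
    ('C(m, 2)%:R + (ab.1 + ab.2)%:R * 0))) => [|ab _]; last by rewrite mulr0 addr0.
  rewrite fps_sum_pos_pairs /wt_gapped; ring.
- move=> st /andP[st0 ok]; split=> //; move: ok.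
  by case: st {st0} => -[[z t]|] //= y /and4P[].
- move=> m c m0.
  have -> : [set st | firsts st /\ (height st, via_sizes st) = (m, None)] =
      [set (None, (0, m))].
    apply/seteqP; split=> [[[[z t]|] [y m']] [/andP[st0 /= ok] []] //= <-|_ ->].
      by rewrite (eqP ok).
    by split=> //; apply/andP.
  by rewrite fps_sum1 mul1r.
move=> m a b c m0 a0 b0.
have -> : [set st | firsts st /\ (height st, via_sizes st) = (m, Some (a, b))] =
  (fun x : nat * nat => (Some (0, (a, x.1, b)), (x.2%:Z - m%:Z, m))) @` end_offsets m a.
  apply/seteqP; split=> [[[[z [[a' g] b']]|] [y m']] [/andP[st0 /= ok] []] //|].
    rewrite /height /sizes /low /high /= => mm aa bb; subst m' a' b'.
    move: ok; rewrite /gapped_ok /low_hits /high_hits /touch.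
    rewrite /low /high /gap /= => /and4P[/eqP -> ok1 ok2 ok3].
    exists (g, absz (y + m%:Z)); first by rewrite /end_offsets /=; lia.
    by congr (_, (_, _)); rewrite /=; lia.
  move=> _ [[g i] [/= g0 ok] <-]; split=> //; apply/andP; split=> //=.
  move: ok; rewrite /gapped_ok /low_hits /high_hits /touch.
  by rewrite /low /high /gap /=; lia.
rewrite fps_sum_image; last first.
  by move=> [g i] [g' i'] _ _ /= [gg ii]; congr (_, _) => //; lia.
exact: fps_sum_end.
Qed.

End Enumeration.

(** * Components of a column *)

Section Geometry.
Implicit Types (P : {fset cell}) (x y M : int).

(** Cells of a column with nothing directly above. Each component has exactly
    one, which makes counting components a matter of membership. *)
Definition tops (P : {fset cell}) (x : int) : {fset cell} :=
  [fset c in P | (c.1 == x) && ((x, (c.2 + 1)%R) \notin P)]%fset.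

Section NumComponents.
Variables (P : {fset cell}) (x : int).

Let e := @stacked P x.

Definition level (c : column P x) : int := (fsval c).2.

Lemma stackedE c d : e c d = (`|level c - level d| == 1).
Proof. by []. Qed.

Lemma mem_column c : (c \in column P x) = (c \in P) && (c.1 == x).
Proof. by rewrite !inE. Qed.

Lemma levelE (c : column P x) : fsval c = (x, level c).
Proof.
have := fsvalP c; rewrite mem_column /level.
by case: (fsval c) => a b /andP[_ /eqP /= ->].
Qed.

Lemma level_mem (c : column P x) : (x, level c) \in P.
Proof. by have := fsvalP c; rewrite mem_column => /andP[cP _]; rewrite -levelE. Qed.

Lemma level_inj : injective level.
Proof. by move=> c d cd; apply: val_inj; rewrite /= !levelE cd. Qed.

Lemma level_onto y : (x, y) \in P -> exists c, level c = y.
Proof.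
move=> yP; have yc : (x, y) \in column P x by rewrite mem_column yP eqxx.
by exists [` yc]%fset.
Qed.

Lemma stacked_sym : connect_sym e.
Proof. by apply: sym_connect_sym => c d; rewrite !stackedE distrC. Qed.

(** A path changes level by one at each step, so it visits every level between
    its ends. *)
Lemma connect_stacked_between (c d : column P x) (y : int) : connect e c d ->
  level c <= y <= level d \/ level d <= y <= level c -> (x, y) \in P.
Proof.
case/connectP => p; elim: p c => [|c1 p IHp] c.
  move=> _ -> yc; have <- : level c = y by rewrite /= in yc; lia.
  exact: level_mem.
move=> /= /andP[ec1 pc1] dl.
have [-> _|yc ycd] := eqVneq y (level c); first exact: level_mem.
by apply: (IHp c1 pc1 dl); move: ec1; rewrite stackedE; lia.
Qed.

(** Two tops are not connected, because a path would pass through the empty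
    cell above the lower one; and the highest cell connected to a given cell is
    a top. *)
Lemma num_components_tops : num_components P x = #|` tops P x|.
Proof.
have topE (c : column P x) : (fsval c \in tops P x) = ((x, level c + 1) \notin P).
  by rewrite levelE !inE level_mem eqxx.
have topP (c : cell) : c \in tops P x -> c \in column P x.
  by rewrite mem_column !inE => /and3P[-> ->].
pose istop := [pred c : column P x | (x, level c + 1) \notin P].
have -> : #|` tops P x| = #|istop|.
  rewrite cardE -(size_map (@fsval _ (column P x))); apply: perm_size; apply: uniq_perm.
  - exact: fset_uniq.
  - by rewrite map_inj_uniq ?enum_uniq //; exact: val_inj.
  move=> c; apply/idP/mapP => [ct|[d]]; last by rewrite mem_enum inE -topE => + ->.
  by exists [` topP c ct]%fset => //; rewrite mem_enum inE -topE.
have rootI : {in istop &, injective (fingraph.root e)}.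
  move=> c d; rewrite !inE => ct dt /eqP; rewrite (root_connect stacked_sym) => cd.
  apply: level_inj; apply/eqP/negPn/negP => ne.
  have [lt|ge] := ltP (level c) (level d).
    by move/negP: ct; apply; apply: (connect_stacked_between cd); lia.
  by move/negP: dt; apply; apply: (connect_stacked_between cd); lia.
rewrite /num_components /n_comp_mem -(card_in_image rootI).
apply: eq_card => r; rewrite inE andbT. apply/idP/fintype.imageP => [/eqP rr|[c _ ->]]; last first.
  by rewrite (roots_root stacked_sym).
(* The highest cell connected to r. *)
case: (@Order.TotalTheory.arg_maxP _ _ _ r (connect e r) level) => // m rm mmax.
exists m; last by rewrite -rr; apply/eqP; rewrite (root_connect stacked_sym).
rewrite inE; apply/negP => /level_onto[m' m'E].
have /mmax : connect e r m'.
  by apply: connect_trans rm (connect1 _); rewrite stackedE m'E; lia.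
by rewrite m'E => H; lia.
Qed.
End NumComponents.

Definition in_run (u : int) (a : nat) (y : int) : bool := (u <= y) && (y < u + a%:Z).

Definition in_gapped (u : int) (t : gapped) (y : int) : bool :=
  in_run u (low t) y || in_run (u + (low t + gap t)%:Z) (high t) y.

Definition column_eq (P : {fset cell}) (x : int) (S : int -> bool) : Prop :=
  forall y, ((x, y) \in P) = S y.

Lemma tops_run P x u a : (0 < a)%N -> column_eq P x (in_run u a) -> #|` tops P x| = 1%N.
Proof.
move=> a0 Pu; suff -> : tops P x = [fset (x, u + a%:Z - 1)%R]%fset by rewrite cardfs1.
apply/fsetP => -[x' y]; rewrite !inE /= xpair_eqE.
have [->|] := eqVneq x' x; last by rewrite andbF.
by rewrite !Pu /in_run /=; apply/idP/idP; lia.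
Qed.

Lemma tops_gapped P x u t : gapped_ok t -> column_eq P x (in_gapped u t) ->
  #|` tops P x| = 2%N.
Proof.
case: t => -[a g] b /and3P[/= a0 g0 b0] Pu.
suff -> : tops P x = [fset (x, u + a%:Z - 1)%R; (x, u + (a + g + b)%:Z - 1)%R]%fset.
  by rewrite cardfs2 xpair_eqE eqxx /=; case: eqP => //; rewrite /low /gap /high /= in a0 g0 b0 *; lia.
apply/fsetP => -[x' y]; rewrite !inE /= !xpair_eqE.
have [->|] := eqVneq x' x; last by rewrite andbF.
rewrite !Pu /in_gapped /in_run /low /gap /high /= in a0 g0 b0 *.
by apply/idP/idP; lia.
Qed.

Lemma tops_empty P x : column_eq P x (fun=> false) -> #|` tops P x| = 0%N.
Proof.
move=> P0; apply/eqP; rewrite cardfs_eq0; apply/eqP/fsetP => -[x' y]; rewrite !inE /=.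
by have [->|] := eqVneq x' x; rewrite ?P0 // andbF.
Qed.

Lemma eq_tops (P Q : {fset cell}) x : column_eq P x (fun y => (x, y) \in Q) -> #|` tops P x| = #|` tops Q x|.
Proof.
move=> PQ; congr #|` _ |; apply/fsetP => -[x' y]; rewrite !inE /=.
by have [->|] := eqVneq x' x; rewrite ?PQ // !andbF.
Qed.

Lemma fset_bounded (P : {fset cell}) : exists B : nat,
  forall c : cell, c \in P -> (`|c.1| <= B)%N /\ (`|c.2| <= B)%N.
Proof.
exists (\max_(c <- P) (absz c.1 + absz c.2))%N => c cP.
have : (absz c.1 + absz c.2 <= \max_(c <- P) (absz c.1 + absz c.2))%N.
  by rewrite (big_fsetD1 c) //= leq_max leqnn.
by lia.
Qed.

(** Descend from a cell until the first empty one; a finite set has one. *)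
Lemma run_below P x M : (x, M) \in P -> exists a : nat,
  [/\ (0 < a)%N, (x, M - a%:Z) \notin P & forall y, in_run (M - a%:Z + 1) a y -> (x, y) \in P].
Proof.
move=> MP; have [B PB] := fset_bounded P.
have ex : exists k : nat, (x, M - k%:Z) \notin P.
  exists (absz M + B).+1; apply/negP => /PB[_ /=]; lia.
case: (ex_minnP ex) => a aP amin; exists a; split=> //.
  by rewrite lt0n; apply: contraNneq aP => ->; rewrite subr0.
move=> y ya; apply/negPn/negP => yP; have := amin (absz (M - y)%R).
rewrite (_ : M - _ = y); first by move/(_ yP); move: ya; rewrite /in_run; lia.
by move: ya; rewrite /in_run; lia.
Qed.

Lemma top_above P x y : (x, y) \in P -> exists k : nat,
  (x, y + k%:Z) \in tops P x /\ forall z, in_run y k.+1 z -> (x, z) \in P.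
Proof.
move=> yP; have [B PB] := fset_bounded P.
have ex : exists k : nat, (x, y + k%:Z + 1) \notin P.
  exists (absz y + B)%N; apply/negP => /PB[_ /=]; lia.
case: (ex_minnP ex) => k kP kmin; exists k.
have run z : in_run y k.+1 z -> (x, z) \in P.
  move=> zk; have [<-//|yz] := eqVneq y z; apply/negPn/negP => zP.
  have := kmin (absz (z - y - 1)%R).
  rewrite (_ : y + _ + 1 = z); first by move/(_ zP); move: zk yz; rewrite /in_run; lia.
  by move: zk yz; rewrite /in_run; lia.
split=> //; rewrite !inE /= eqxx kP !andbT.
by apply: run; rewrite /in_run; lia.
Qed.

Lemma mem_tops P x c : c \in tops P x ->
  exists2 M, c = (x, M) & (x, M) \in P /\ (x, M + 1) \notin P.
Proof.
case: c => x' M; rewrite !inE /= => /and3P[MP /eqP xx nM].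
by exists M; rewrite ?xx //; split=> //; rewrite -xx.
Qed.

Lemma one_top P x : #|` tops P x| = 1%N ->
  exists u a, (0 < a)%N /\ column_eq P x (in_run u a).
Proof.
move=> /eqP/cardfs1P[c tE].
have [|M cM [MP M1]] := @mem_tops P x c; first by rewrite tE fset11.
have [a [a0 aP run]] := run_below MP.
exists (M - a%:Z + 1), a; split=> // y; apply/idP/idP => [yP|]; last exact: run.
have [k [kt yrun]] := top_above yP.
have kM : y + k%:Z = M by move: kt; rewrite tE inE cM xpair_eqE eqxx => /eqP.
have ya : y <> M - a%:Z by move=> E; rewrite E (negPf aP) in yP.
rewrite /in_run; apply/andP; split; last by lia.
rewrite leNgt; apply/negP => lt; move/negP: aP; apply; apply: yrun.
by rewrite /in_run; lia.
Qed.

(** The runs ending at the two tops cover the column, since the top above any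
    cell is one of them, and the run below the upper top stops above the lower
    one because the cell over that top is empty. *)
Lemma two_tops P x : #|` tops P x| = 2%N ->
  exists u t, gapped_ok t /\ column_eq P x (in_gapped u t).
Proof.
move=> t2.
have [M1 [M2 [M12 tE]]] : exists M1 M2, M1 < M2 /\ tops P x = [fset (x, M1); (x, M2)]%fset.
  have [c ct] : exists c, c \in tops P x by apply/fset0Pn; rewrite -cardfs_gt0 t2.
  have := cardfsD1 c (tops P x); rewrite ct t2 => -[/esym/eqP/cardfs1P[d dE]].
  have td : d \in tops P x by have := fset11 d; rewrite -dE => /fsetD1P[].
  have cd : c != d by have := fset11 d; rewrite -dE eq_sym => /fsetD1P[].
  have tE : tops P x = [fset c; d]%fset by rewrite -(fsetD1K ct) dE.
  have [M cM _] := mem_tops ct; have [N dN _] := mem_tops td.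
  subst c d; rewrite xpair_eqE eqxx /= in cd.
  have [lt|ge] := ltP M N; first by exists M, N.
  by exists N, M; split; [lia | rewrite tE fsetUC].
have [|? [<-] [MP1 nM1]] := @mem_tops P x (x, M1); first by rewrite tE !inE eqxx.
have [|? [<-] [MP2 nM2]] := @mem_tops P x (x, M2); first by rewrite tE !inE eqxx orbT.
have [a [a0 aP arun]] := run_below MP1; have [b [b0 bP brun]] := run_below MP2.
have gapP : M1 + 1 <= M2 - b%:Z.
  rewrite leNgt; apply/negP => lt; move/negP: nM1; apply; apply: brun.
  by rewrite /in_run; lia.
exists (M1 - a%:Z + 1), (a, absz (M2 - b%:Z - M1)%R, b); split.
  by rewrite /gapped_ok /low /gap /high /=; lia.
move=> y; rewrite /in_gapped /low /gap /high /=.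
apply/idP/orP => [yP|[/arun //|yb]]; last by apply: brun; move: yb; rewrite /in_run; lia.
have [k [kt yrun]] := top_above yP.
have ya : y <> M1 - a%:Z by move=> E; rewrite E (negPf aP) in yP.
have yb : y <> M2 - b%:Z by move=> E; rewrite E (negPf bP) in yP.
move: kt; rewrite tE !inE !xpair_eqE eqxx /= => /orP[/eqP kM|/eqP kM]; [left|right].
  rewrite /in_run; apply/andP; split; last by lia.
  rewrite leNgt; apply/negP => lt; move/negP: aP; apply; apply: yrun.
  by rewrite /in_run; lia.
rewrite /in_run; apply/andP; split; last by lia.
rewrite leNgt; apply/negP => lt; move/negP: bP; apply; apply: yrun.
by rewrite /in_run; lia.
Qed.

(** * Connected sets of cells and decoding *)

Implicit Types (Q X Y : {fset cell}) (c d : cell).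

(** The six neighbours of a cell. Stack x + 1 is half a cell higher than stack
    x, so a cell at level y touches levels y and y - 1 there. *)
Definition adj c d : bool :=
  [|| (c.1 == d.1) && ((d.2 == c.2 + 1) || (c.2 == d.2 + 1)),
      (d.1 == c.1 + 1) && ((d.2 == c.2) || (d.2 == c.2 - 1)) |
      (c.1 == d.1 + 1) && ((c.2 == d.2) || (c.2 == d.2 - 1))].

Lemma adj_sym : symmetric adj.
Proof. by move=> c d; rewrite /adj; apply/idP/idP; lia. Qed.

Definition locally_constant P (A : cell -> bool) : Prop :=
  forall c d, c \in P -> d \in P -> adj c d -> A c = A d.

(** Connectedness of the adjacency graph, stated without paths: no set of cells
    closed under adjacency separates two cells. This matches the topological
    definition, where A is the indicator of a clopen part. *)
Definition conn P : Prop :=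
  forall A, locally_constant P A -> forall c d, c \in P -> d \in P -> A c = A d.

Definition joined X Y : Prop := exists c d, [/\ c \in X, d \in Y & adj c d].

Lemma joined_sym X Y : joined X Y -> joined Y X.
Proof. by case=> c [d [cX dY cd]]; exists d, c; rewrite adj_sym. Qed.

Lemma joinedUl X X' Y : joined X Y -> joined (X `|` X')%fset Y.
Proof. by case=> c [d [cX dY cd]]; exists c, d; rewrite inE cX. Qed.

Lemma conn_union X Y : conn X -> conn Y -> joined X Y -> conn (X `|` Y)%fset.
Proof.
move=> Xc Yc [c0 [d0 [c0X d0Y cd0]]] A Aloc.
have AX c : c \in X -> A c = A c0.
  by move=> cX; apply: Xc => // a b aX bX; apply: Aloc; rewrite inE ?aX ?bX.
have AY c : c \in Y -> A c = A d0.
  by move=> cY; apply: Yc => // a b aY bY; apply: Aloc; rewrite inE ?aY ?bY orbT.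
have cd : A c0 = A d0 by apply: Aloc => //; rewrite inE ?c0X ?d0Y ?orbT.
have AXY c : c \in (X `|` Y)%fset -> A c = A c0.
  by rewrite inE => /orP[/AX //|/AY ->]; rewrite cd.
by move=> c d /AXY -> /AXY ->.
Qed.

(** If X can enter Y only through a connected set Y0, then X cannot help to
    connect Y: extend a locally constant function on Y to X by its value on Y0.
    *)
Lemma conn_strip X Y Y0 c0 : conn (X `|` Y)%fset -> conn Y0 -> c0 \in Y0 ->
  {subset Y0 <= Y} -> (forall c d, c \in X -> d \in Y -> adj c d -> d \in Y0) ->
  conn Y.
Proof.
move=> XYc Y0c c0Y0 sub gate A Aloc c d cY dY.
pose B c := if c \in Y then A c else A c0.
have Y0B a : a \in Y0 -> A a = A c0.
  move=> aY0; apply: Y0c => // a1 a2 /sub a1Y /sub a2Y; exact: Aloc.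
have -> : A c = B c by rewrite /B cY.
have -> : A d = B d by rewrite /B dY.
apply: XYc; rewrite ?inE ?cY ?dY ?orbT // => a b.
rewrite !inE /B; case: ifP => aY; case: ifP => bY; rewrite ?orbT ?orbF //.
- by move=> _ _; exact: Aloc.
- by move=> _ bX ab; apply: Y0B; apply: gate bX aY _; rewrite adj_sym.
- by move=> aX _ ab; apply/esym/Y0B; apply: gate aX bY _.
Qed.

Definition run_cells x (u : int) (a : nat) : {fset cell} :=
  [fset (x, u + (i : nat)%:Z)%R | i in iota 0 a]%fset.

Lemma mem_run x u a c : (c \in run_cells x u a) = (c.1 == x) && in_run u a c.2.
Proof.
apply/imfsetP/andP => [[i /= + ->]|[/eqP cx ca]].
  by rewrite mem_iota /in_run /= => ia; split=> //; lia.
exists (absz (c.2 - u)%R); first by rewrite /= mem_iota; move: ca; rewrite /in_run; lia.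
by case: c cx ca => a1 b /= -> ca; congr (_, _); move: ca; rewrite /in_run; lia.
Qed.

Lemma card_run x u a : #|` run_cells x u a| = a.
Proof.
rewrite card_imfset /= ?undup_id ?iota_uniq ?size_iota // => i j [] /eqP; lia.
Qed.

Lemma conn_run x u a : conn (run_cells x u a).
Proof.
move=> A Aloc.
have Au k : (k < a)%N -> A (x, u + k%:Z) = A (x, u).
  elim: k => [|k IHk] ka; first by rewrite addr0.
  rewrite -IHk; last exact: ltnW.
  by apply: Aloc; rewrite ?mem_run /in_run /adj /= ?eqxx /=; lia.
have Ac c : c \in run_cells x u a -> A c = A (x, u).
  rewrite mem_run => /andP[/eqP cx ca]; rewrite -(Au (absz (c.2 - u)%R)).
    by congr A; case: c cx ca => c1 c2 /= -> ca; congr (_, _); move: ca; rewrite /in_run; lia.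
  by move: ca; rewrite /in_run; lia.
by move=> c d /Ac -> /Ac ->.
Qed.

(** The adjacent cells are found at the lowest level common to both runs, or at
    the corner where the right run ends one level below the left one. *)
Lemma touch_joined x u a v b : (0 < a)%N -> (0 < b)%N ->
  touch u a v b -> joined (run_cells x u a) (run_cells (x + 1) v b).
Proof.
move=> a0 b0 ab; have [uv|vu] := leP u v.
  exists (x, v), (x + 1, v); rewrite !mem_run /in_run /adj /= !eqxx.
  by move: ab; rewrite /touch; split; lia.
have [ub|bu] := ltP u (v + b%:Z).
  exists (x, u), (x + 1, u); rewrite !mem_run /in_run /adj /= !eqxx.
  by move: ab; rewrite /touch; split; lia.
exists (x, u), (x + 1, u - 1); rewrite !mem_run /in_run /adj /= !eqxx.
by move: ab; rewrite /touch; split; lia.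
Qed.

Lemma adj_touch x u a v b c d : c \in run_cells x u a -> d \in run_cells (x + 1) v b ->
  adj c d -> touch u a v b.
Proof.
by rewrite !mem_run /in_run /adj /touch => /andP[/eqP -> ?] /andP[/eqP -> ?]; lia.
Qed.

Definition gapped_cells x (u : int) (t : gapped) : {fset cell} :=
  (run_cells x u (low t) `|` run_cells x (u + (low t + gap t)%:Z)%R (high t))%fset.

Lemma mem_gapped x u t c : (c \in gapped_cells x u t) = (c.1 == x) && in_gapped u t c.2.
Proof. by rewrite inE !mem_run /in_gapped andb_orr. Qed.

Lemma card_gapped x u t : #|` gapped_cells x u t| = (low t + high t)%N.
Proof.
rewrite cardfsU !card_run (_ : _ `&` _ = fset0)%fset ?cardfs0 ?subn0 //.
apply/fsetP => c; rewrite !inE !mem_run /in_run; apply/negbTE/negP; lia.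
Qed.

(** The cells described by a continuation whose first column is x, y being the
    lowest level of the preceding one-component column. *)
Fixpoint decode x y (ss : seq step) (o : option (int * gapped)) : {fset cell} :=
  match ss with
  | [::] => if o is Some (z, t) then gapped_cells x (y + z) t else fset0
  | (None, (z, m)) :: ss' => (run_cells x (y + z)%R m `|` decode (x + 1) (y + z)%R ss' o)%fset
  | (Some (z, t), (z', m)) :: ss' =>
      (gapped_cells x (y + z)%R t `|` (run_cells (x + 1)%R (y + z + z')%R m
        `|` decode (x + 2%:Z)%R (y + z + z')%R ss' o))%fset
  end.

(** The conditions on a step that do not involve its neighbours; these are
    enough to read off the columns. *)
Definition shape_ok (st : step) : bool :=
  (0 < height st)%N && (if st.1 is Some (_, t) then gapped_ok t else true).

Lemma step_shape n st : step_ok n st -> shape_ok st.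
Proof.
by move=> /andP[st0 ok]; rewrite /shape_ok st0; case: st.1 ok => // -[z t] /andP[].
Qed.

Lemma first_shape st : first_ok st -> shape_ok st.
Proof.
by move=> /andP[st0 ok]; rewrite /shape_ok st0; case: st.1 ok => // -[z t] /and4P[].
Qed.

Definition tail_shape (o : option (int * gapped)) : bool :=
  if o is Some (_, t) then gapped_ok t else true.

Lemma steps_shape n ss o : steps_ok n ss o -> all shape_ok ss && tail_shape o.
Proof.
elim: ss n => [|st ss IHss] n /=; first by case: o => // -[z t] /and3P[].
by move=> /andP[/step_shape -> /IHss].
Qed.

Lemma decode_right x y ss o c : c \in decode x y ss o -> x <= c.1.
Proof.
elim: ss x y => [|[[[z t]|] [z' m]] ss IHss] x y /=.
- case: o => [[z t]|]; last by rewrite inE.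
  by rewrite mem_gapped => /andP[/eqP ->].
- rewrite in_fsetU mem_gapped in_fsetU mem_run.
  by case/or3P => [/andP[/eqP cx _]|/andP[/eqP cx _]|/IHss]; lia.
- by rewrite in_fsetU mem_run => /orP[/andP[/eqP cx _]|/IHss]; lia.
Qed.

Lemma decode_translate x y ss o v :
  decode (x + v.1) (y + v.2) ss o = translate v (decode x y ss o).
Proof.
have trE P c : (c \in translate v P) = ((c.1 - v.1, c.2 - v.2) \in P).
  apply/imfsetP/idP => [[d dP ->]|cP] /=; first by rewrite !addrK; case: d dP.
  by exists (c.1 - v.1, c.2 - v.2) => //=; rewrite !subrK; case: c {cP}.
have trU P Q : translate v (P `|` Q)%fset = (translate v P `|` translate v Q)%fset.
  by apply/fsetP => c; rewrite inE !trE inE.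
have trR x' u a : run_cells (x' + v.1) (u + v.2) a = translate v (run_cells x' u a).
  by apply/fsetP => c; rewrite trE !mem_run /in_run /=; apply/idP/idP; lia.
have trG x' u t : gapped_cells (x' + v.1) (u + v.2) t = translate v (gapped_cells x' u t).
  by rewrite /gapped_cells trU -!trR addrAC.
elim: ss x y => [|[[[z t]|] [z' m]] ss IHss] x y /=.
- case: o => [[z t]|]; first by rewrite -trG addrAC.
  by apply/fsetP => c; rewrite trE !inE.
- by rewrite trU -trG trU -trR -IHss !(addrAC _ v.1) !(addrAC _ v.2).
- by rewrite trU -trR -IHss !(addrAC _ v.1) !(addrAC _ v.2).
Qed.

Lemma card_fsetU_dis P Q : (forall c, c \in P -> c \in Q -> False) ->
  #|` (P `|` Q)%fset| = (#|` P| + #|` Q|)%N.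
Proof.
move=> dis; rewrite cardfsU (_ : _ `&` _ = fset0)%fset ?cardfs0 ?subn0 //.
apply/fsetP => c; rewrite !inE; apply/negbTE/negP => /andP[]; exact: dis.
Qed.

Lemma card_decode x y ss o : #|` decode x y ss o| = area_cont (ss, o).
Proof.
rewrite /area_cont /=; elim: ss x y => [|[[[z t]|] [z' m]] ss IHss] x y /=.
- by rewrite big_nil; case: o => [[z t]|]; rewrite ?card_gapped ?cardfs0.
- rewrite big_cons {1}/area_step /= card_fsetU_dis => [|c]; last first.
    rewrite mem_gapped in_fsetU mem_run => /andP[/eqP cx _].
    by case/orP => [/andP[/eqP]|/decode_right]; lia.
  rewrite card_fsetU_dis => [|c]; last by rewrite mem_run => /andP[/eqP cx _] /decode_right; lia.
  by rewrite card_gapped card_run IHss /height /= !addnA.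
- rewrite big_cons {1}/area_step /= card_fsetU_dis => [|c]; last first.
    by rewrite mem_run => /andP[/eqP cx _] /decode_right; lia.
  by rewrite card_run IHss /height /= !addnA.
Qed.

Lemma column_eq_gapped_decode x y z t z' m ss o :
  column_eq (decode x y ((Some (z, t), (z', m)) :: ss) o) x (in_gapped (y + z) t).
Proof.
move=> y' /=; rewrite in_fsetU mem_gapped in_fsetU mem_run /= eqxx /=.
case: in_gapped => //=; apply/negbTE/negP => /orP[/andP[/eqP]|/decode_right /=]; lia.
Qed.

Lemma column_eq_via_decode x y z t z' m ss o :
  column_eq (decode x y ((Some (z, t), (z', m)) :: ss) o) (x + 1) (in_run (y + z + z') m).
Proof.
move=> y' /=; rewrite in_fsetU mem_gapped in_fsetU mem_run /= eqxx /=.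
rewrite (_ : (x + 1 == x) = false) /=; last by apply/negbTE/eqP; lia.
case: in_run => //=; apply/negbTE/negP => /decode_right /=; lia.
Qed.

Lemma column_eq_run_decode x y z m ss o :
  column_eq (decode x y ((None, (z, m)) :: ss) o) x (in_run (y + z) m).
Proof.
move=> y' /=; rewrite in_fsetU mem_run /= eqxx /=.
case: in_run => //=; apply/negbTE/negP => /decode_right /=; lia.
Qed.

Lemma column_eq_gapped x u t : column_eq (gapped_cells x u t) x (in_gapped u t).
Proof. by move=> y; rewrite mem_gapped eqxx. Qed.

Lemma column_eq_left x y ss o x' : x' < x ->
  column_eq (decode x y ss o) x' (fun=> false).
Proof. by move=> lt y'; apply/negbTE/negP => /decode_right /=; lia. Qed.

Lemma column_eq_decode_run x y z m ss o x' : x < x' ->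
  column_eq (decode x y ((None, (z, m)) :: ss) o) x' (fun y' => (x', y') \in decode (x + 1) (y + z) ss o).
Proof.
move=> lt y' /=; rewrite in_fsetU mem_run /= (_ : (x' == x) = false) //.
by apply/negbTE/eqP; lia.
Qed.

Lemma column_eq_decode_via x y z t z' m ss o x' : x + 1 < x' ->
  column_eq (decode x y ((Some (z, t), (z', m)) :: ss) o) x'
    (fun y' => (x', y') \in decode (x + 2%:Z) (y + z + z') ss o).
Proof.
move=> lt y' /=; rewrite in_fsetU mem_gapped in_fsetU mem_run /=.
have -> : (x' == x) = false by apply/negbTE/eqP; lia.
by have -> : (x' == x + 1) = false by apply/negbTE/eqP; lia.
Qed.

Definition twos P : {fset int} := [fset x in columns P | #|` tops P x| == 2%N]%fset.

Lemma mem_twos P x : (x \in twos P) = (#|` tops P x| == 2%N).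
Proof.
rewrite !inE; case: eqP => [t2|]; rewrite ?andbF // andbT.
have [c ct] : exists c, c \in tops P x by apply/fset0Pn; rewrite -cardfs_gt0 t2.
have [M _ [MP _]] := mem_tops ct.
by apply/imfsetP; exists (x, M).
Qed.

Lemma two_component_columnsE P : two_component_columns P = twos P.
Proof. by apply/fsetP => x; rewrite !inE num_components_tops. Qed.

(** A gapped column is followed by a single run or by nothing, so two-component
    columns are isolated, and each is recorded by one entry of the code. *)
Lemma tops_decode x y ss o : all shape_ok ss -> tail_shape o ->
  (forall x', (#|` tops (decode x y ss o) x'| <= 2)%N) /\
  (forall x', ~ (x' \in twos (decode x y ss o) /\ x' + 1 \in twos (decode x y ss o))) /\
  #|` twos (decode x y ss o)| = twos_cont (ss, o).
Proof.
rewrite /twos_cont /=.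
elim: ss x y => [|[[[z t]|] [z' m]] ss IHss] x y.
- move=> _; case: o => [[z t]|] /= tok; rewrite big_nil.
    have t2 := tops_gapped tok (@column_eq_gapped x (y + z) t).
    have t0 x' : x' != x -> #|` tops (gapped_cells x (y + z) t) x'| = 0%N.
      by move=> xx; apply: tops_empty => y'; rewrite mem_gapped /= (negPf xx).
    split=> [x'|]; first by have [->|/t0 ->] := eqVneq x' x; rewrite ?t2.
    have -> : twos (gapped_cells x (y + z) t) = [fset x]%fset.
      apply/fsetP => x'; rewrite mem_twos inE.
      by have [->|/t0 ->] := eqVneq x' x; rewrite ?t2.
    by split; [move=> x'; rewrite !inE; lia | rewrite cardfs1].
  have t0 x' : #|` tops fset0 x'| = 0%N by apply: tops_empty => y'; rewrite inE.
  have -> : twos fset0 = fset0 by apply/fsetP => x'; rewrite mem_twos t0 inE.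
  by split=> [x'|]; rewrite ?t0 // cardfs0; split=> // x'; rewrite inE => -[].
- move=> /= /andP[/andP[m0 tok] ssok] ook.
  have [IH2 [IHs IHc]] := IHss (x + 2%:Z) (y + z + z') ssok ook.
  rewrite -/(decode x y ((Some (z, t), (z', m)) :: ss) o).
  set D := decode x y _ o; set D' := decode _ _ ss o in IH2 IHs IHc.
  have tx : #|` tops D x| = 2%N := tops_gapped tok (@column_eq_gapped_decode x y z t z' m ss o).
  have tx1 : #|` tops D (x + 1)| = 1%N := tops_run m0 (@column_eq_via_decode x y z t z' m ss o).
  have tr x' : x + 1 < x' -> #|` tops D x'| = #|` tops D' x'|.
    by move=> lt; apply: eq_tops; apply: column_eq_decode_via.
  have tl x' : x' < x -> #|` tops D x'| = 0%N.
    by move=> lt; apply: tops_empty; apply: column_eq_left.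
  have tD' x' : x' <= x + 1 -> #|` tops D' x'| = 0%N.
    by move=> lt; apply: tops_empty; apply: column_eq_left; lia.
  have pos x' : [\/ x' < x, x' = x, x' = x + 1 | x + 1 < x'].
    have [lt|ge] := ltP x' x; first by constructor 1.
    have [->|ne] := eqVneq x' x; first by constructor 2.
    have [->|ne1] := eqVneq x' (x + 1); first by constructor 3.
    by constructor 4; lia.
  have DE : twos D = (x |` twos D')%fset.
    apply/fsetP => x'; rewrite in_fset1U !mem_twos.
    case: (pos x') => [lt|->|->|lt]; rewrite ?tx ?tx1 ?eqxx //.
    - by rewrite tl // tD' ?orbF; [apply/esym/negbTE/eqP |]; lia.
    - by rewrite tD' // orbF; apply/esym/negbTE/eqP; lia.
    - by rewrite tr // (_ : (x' == x) = false) //; apply/negbTE/eqP; lia.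
  split=> [x'|]; first by case: (pos x') => [/tl ->|->|->|/tr ->]; rewrite ?tx1 ?tx.
  split=> [x'|].
    rewrite !mem_twos => -[/eqP a2 /eqP b2].
    case: (pos x') => [/tl|xx|xx|lt]; first by rewrite a2.
    - by rewrite xx tx1 in b2.
    - by rewrite xx tx1 in a2.
    apply: (IHs x'); rewrite !mem_twos -!tr ?a2 ?b2 //; lia.
  by rewrite DE cardfsU1 IHc mem_twos tD' ?big_cons //=; lia.
- move=> /= /andP[/andP[m0 _] ssok] ook.
  have [IH2 [IHs IHc]] := IHss (x + 1) (y + z') ssok ook.
  rewrite -/(decode x y ((None, (z', m)) :: ss) o).
  set D := decode x y _ o; set D' := decode _ _ ss o in IH2 IHs IHc.
  have tx : #|` tops D x| = 1%N := tops_run m0 (@column_eq_run_decode x y z' m ss o).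
  have tr x' : x < x' -> #|` tops D x'| = #|` tops D' x'|.
    by move=> lt; apply: eq_tops; apply: column_eq_decode_run.
  have tl x' : x' < x -> #|` tops D x'| = 0%N.
    by move=> lt; apply: tops_empty; apply: column_eq_left.
  have tD' x' : x' <= x -> #|` tops D' x'| = 0%N.
    by move=> lt; apply: tops_empty; apply: column_eq_left; lia.
  have DE : twos D = twos D'.
    apply/fsetP => x'; rewrite !mem_twos.
    have [lt|lt|->] := ltgtP x' x; last by rewrite tx tD'.
      by rewrite tl // tD' // ltW.
    by rewrite tr.
  rewrite DE; split=> [x'|].
    by have [/tl ->|/tr ->|->] := ltgtP x' x; rewrite ?tx.
  by split=> //; rewrite IHc big_cons.
Qed.

Lemma touch_shift k u a v b : touch (k + u) a (k + v) b = touch u a v b.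
Proof. by rewrite /touch; apply/idP/idP; lia. Qed.

Lemma touch_shift0 k a v b : touch k a (k + v) b = touch 0 a v b.
Proof. by rewrite -{1}[k]addr0 touch_shift. Qed.

(** Induction from the right: the rest, together with the run before it, is
    connected, and the contacts of the current step attach the preceding run.
    Under linked, first attach both runs of the gapped column to the side
    touching both, then the other side. *)
Lemma conn_decode x y n ss o : (0 < n)%N -> steps_ok n ss o ->
  conn (run_cells x y n `|` decode (x + 1) y ss o)%fset.
Proof.
elim: ss x y n => [|[[[z t]|] [z' m]] ss IHss] x y n n0 /=.
- case: o => [[z t]|] /=; last by rewrite fsetU0 => _; exact: conn_run.
  move=> /and3P[/and3P[t0 _ t1] hl hh]; rewrite /gapped_cells fsetUA.
  have j1 : joined (run_cells x y n) (run_cells (x + 1) (y + z) (low t)).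
    by apply: touch_joined => //; rewrite touch_shift0.
  have j2 : joined (run_cells x y n) (run_cells (x + 1) (y + z + (low t + gap t)%:Z) (high t)).
    by apply: touch_joined => //; rewrite -addrA touch_shift0.
  apply: conn_union (conn_union _ _ j1) _ (joinedUl _ j2); exact: conn_run.
- move=> /andP[/andP[m0 /= /andP[/and3P[t0 _ t1] lk]] ssok].
  rewrite /height /= in m0 ssok.
  have IH := IHss (x + 1 + 1) (y + z + z') m m0 ssok.
  rewrite -[x + 1 + 1 + 1]addrA -/(2%:Z) in IH.
  set Q := (_ `|` _)%fset in IH; rewrite -[(run_cells _ _ m `|` _)%fset]/Q.
  set L := run_cells x y n.
  set C1 := run_cells (x + 1) (y + z) (low t).
  set C2 := run_cells (x + 1) (y + z + (low t + gap t)%:Z) (high t).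
  rewrite /gapped_cells -/C1 -/C2.
  have j1 : hits_low n z t -> joined L C1.
    by move=> h; apply: touch_joined => //; rewrite touch_shift0.
  have j2 : hits_high n z t -> joined L C2.
    by move=> h; apply: touch_joined => //; rewrite -addrA touch_shift0.
  have k1 : low_hits t z' m -> joined Q C1.
    move=> h; apply/joinedUl/joined_sym/touch_joined => //.
    by rewrite touch_shift0.
  have k2 : high_hits t z' m -> joined Q C2.
    move=> h; apply/joinedUl/joined_sym/touch_joined => //.
    by rewrite touch_shift.
  have cL : conn L by exact: conn_run.
  have c1 : conn C1 by exact: conn_run.
  have c2 : conn C2 by exact: conn_run.
  case/orP: lk => /and3P[].
    move=> a1 a2 b; rewrite fsetUA [(L `|` _)%fset]fsetUA.
    apply: (conn_union _ IH); first exact: conn_union (conn_union cL c1 (j1 a1)) c2 (joinedUl _ (j2 a2)).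
    apply: joined_sym; case/orP: b => [/k1|/k2] [c [d [cQ dC cd]]]; exists c, d; split=> //.
      by rewrite !in_fsetU dC orbT.
    by rewrite !in_fsetU dC orbT.
  move=> a b1 b2; rewrite fsetUC [(C1 `|` C2 `|` Q)%fset]fsetUC fsetUA.
  apply: (conn_union _ cL).
    exact: conn_union (conn_union IH c1 (k1 b1)) c2 (joinedUl _ (k2 b2)).
  apply: joined_sym; case/orP: a => [/j1|/j2] [c [d [cQ dC cd]]]; exists c, d; split=> //.
    by rewrite !in_fsetU dC orbT.
  by rewrite !in_fsetU dC orbT.
- move=> /andP[/andP[m0 /= tc] ssok]; rewrite /height /= in m0 ssok.
  have IH := IHss (x + 1) (y + z') m m0 ssok.
  apply: conn_union; [exact: conn_run | exact: IH |].
  apply/joined_sym/joinedUl/joined_sym.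
  by apply: touch_joined => //; rewrite touch_shift0.
Qed.

Definition polyomino_of x y (c : code) : {fset cell} := decode x y (c.1 :: c.2.1) c.2.2.

Lemma conn_polyomino_of x y (c : code) : code_ok c -> conn (polyomino_of x y c).
Proof.
case: c => -[[[z t]|] [z' m]] [ss o] /andP[/andP[m0 /= fok] cok]; rewrite /polyomino_of /=.
  case/and4P: fok => [/eqP z0 /and3P[t0 _ t1] b1 b2]; rewrite z0 addr0.
  have IH := @conn_decode (x + 1) (y + z') m ss o m0 cok.
  rewrite -[x + 1 + 1]addrA -/(2%:Z) in IH.
  set Q := (_ `|` _)%fset in IH; rewrite -[(run_cells _ _ m `|` _)%fset]/Q.
  rewrite fsetUC /gapped_cells fsetUA.
  have k1 : joined Q (run_cells x y (low t)).
    by apply/joinedUl/joined_sym/touch_joined => //; rewrite touch_shift0.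
  have k2 : joined Q (run_cells x (y + (low t + gap t)%:Z) (high t)).
    by apply/joinedUl/joined_sym/touch_joined => //; rewrite touch_shift.
  apply: conn_union (conn_union IH _ k1) _ (joinedUl _ k2); exact: conn_run.
rewrite (eqP fok) addr0; exact: conn_decode.
Qed.

Lemma adj_near c d : adj c d -> (c.1 - 1 <= d.1 <= c.1 + 1) && (c.2 - 1 <= d.2 <= c.2 + 1).
Proof. by rewrite /adj; lia. Qed.

Section Blocks.
Variables (P : {fset cell}) (x u : int) (t : gapped) (a1 a2 b1 b2 : bool).
Hypotheses (Pc : conn P) (tok : gapped_ok t).
Hypothesis colx : forall c, c \in P -> c.1 = x -> in_gapped u t c.2.
Hypothesis A1 : forall c d, c \in P -> d \in P -> adj c d -> c.1 < x -> d.1 = x ->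
  in_run u (low t) d.2 -> a1.
Hypothesis A2 : forall c d, c \in P -> d \in P -> adj c d -> c.1 < x -> d.1 = x ->
  in_run (u + (low t + gap t)%:Z) (high t) d.2 -> a2.
Hypothesis B1 : forall c d, c \in P -> d \in P -> adj c d -> x < c.1 -> d.1 = x ->
  in_run u (low t) d.2 -> b1.
Hypothesis B2 : forall c d, c \in P -> d \in P -> adj c d -> x < c.1 -> d.1 = x ->
  in_run (u + (low t + gap t)%:Z) (high t) d.2 -> b2.
Variables (vL v1 v2 vR : bool).
Hypotheses (e1 : a1 -> vL = v1) (e2 : a2 -> vL = v2) (f1 : b1 -> v1 = vR) (f2 : b2 -> v2 = vR).

(** A function on the cells that is constant on the part left of column x, on
    each of the two runs of column x, and on the part right of it. If it
    respects the contacts that exist, it is locally constant, hence constant on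
    a connected P; this shows which contacts must exist. *)
Definition block_value c : bool :=
  if c.1 < x then vL else if c.1 == x then (if in_run u (low t) c.2 then v1 else v2) else vR.

(** The hypotheses A1, A2, B1, B2 say that an adjacency between blocks forces
    the corresponding contact bit. *)
Lemma block_value_const c d : c \in P -> d \in P -> block_value c = block_value d.
Proof.
have half c' d' : c' \in P -> d' \in P -> adj c' d' -> d'.1 = x -> block_value c' = block_value d'.
  move=> cP dP cd dx; have := colx dP dx; rewrite /in_gapped /block_value dx ltxx eqxx.
  have [lt|gt|cx] := ltgtP c'.1 x.
  - by case: ifP => [dl _|_ /= dh]; [exact/e1/(A1 cP dP) | exact/e2/(A2 cP dP)].
  - by case: ifP => [dl _|_ /= dh]; apply/esym; [exact/f1/(B1 cP dP) | exact/f2/(B2 cP dP)].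
  have := colx cP cx; case/and3P: tok => t0 g0 t1; case/andP: (adj_near cd) => _ near.
  rewrite /in_gapped /in_run in near *; clear - near g0; move: near.
  by case: ifP; case: ifP => //; lia.
move=> cP dP; apply: (Pc _ cP dP) => {c d cP dP} c d cP dP cd.
have [dx|dx] := eqVneq d.1 x; first exact: half.
have [cx|cx] := eqVneq c.1 x; first by apply/esym/half => //; rewrite adj_sym.
rewrite /block_value (negPf cx) (negPf dx).
case/andP: (adj_near cd) => near _; clear - near cx dx; move: near.
by case: ifP; case: ifP => //; lia.
Qed.
End Blocks.

(** * Every simple-2-column polyomino has a code *)

Definition simple_columns P : Prop :=
  (forall c, c \in P -> #|` tops P c.1| = 1%N \/ #|` tops P c.1| = 2%N) /\
  (forall x, ~ (#|` tops P x| = 2%N /\ #|` tops P (x + 1)| = 2%N)).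

Lemma mem_run_pair x u a y : ((x, y) \in run_cells x u a) = in_run u a y.
Proof. by rewrite mem_run eqxx. Qed.

(** What remains of P once the columns up to x have been decoded. *)
Definition beyond P x : {fset cell} := [fset c in P | (x < c.1)%R]%fset.

Lemma mem_beyond P x c : (c \in beyond P x) = (c \in P) && (x < c.1).
Proof. by rewrite !inE. Qed.

Lemma tops_beyond P x x' : x < x' -> #|` tops (beyond P x) x'| = #|` tops P x'|.
Proof. by move=> lt; apply: eq_tops => y; rewrite mem_beyond lt andbT. Qed.

Lemma simple_beyond P x : simple_columns P -> simple_columns (beyond P x).
Proof.
move=> [P12 Ps]; split=> [c|x' [a b]].
  by rewrite mem_beyond => /andP[cP lt]; rewrite tops_beyond //; exact: P12.
have [lt|ge] := ltP x x'.
  by apply: (Ps x'); rewrite -!(tops_beyond P (x := x)) //; lia.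
by move: a; rewrite tops_empty // => y; rewrite mem_beyond /= ltNge ge andbF.
Qed.

Lemma card_beyond P x y x' : (x, y) \in P -> x <= x' -> (#|` beyond P x'| < #|` P|)%N.
Proof.
move=> yP xx'; rewrite (cardfsD1 (x, y) P) yP add1n ltnS.
apply: fsubset_leq_card; apply/fsubsetP => c; rewrite in_fsetD1 mem_beyond.
case/andP=> -> lt; rewrite andbT; apply: contraTneq lt => ->.
by rewrite /= -leNgt.
Qed.

(** No adjacency jumps over an empty column, so a connected set has no cells on
    its far side. *)
Lemma column_nonempty P x c0 : conn P -> c0 \in P -> c0.1 < x ->
  (forall c, c \in P -> c.1 != x) -> forall c, c \in P -> c.1 < x.
Proof.
move=> Pc c0P c0x Px c cP; suff -> : (c.1 < x) = (c0.1 < x) by [].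
apply: (Pc (fun c => c.1 < x)) => // a b aP bP ab.
have := Px a aP; have := Px b bP; case/andP: (adj_near ab) => near _ nb na /=.
by apply/idP/idP; lia.
Qed.

Lemma column_split P x S : (forall c, c \in P -> x <= c.1) -> column_eq P x S ->
  forall c, (c \in P) = ((c.1 == x) && S c.2) || (c \in beyond P x).
Proof.
move=> Px PS c; rewrite mem_beyond; case: c => a y /=.
have [->|ax] := eqVneq a x; first by rewrite PS ltxx andbF orbF.
by apply/idP/andP => [aP|[]//]; split=> //; have := Px _ aP => /=; lia.
Qed.

(** The converse for the cycle of four blocks: if two contacts were missing,
    some 0-1 labelling of the blocks would respect the other two without being
    constant. *)
Lemma linkedP (a1 a2 b1 b2 : bool) :
  (forall vl v1 v2 vr : bool, (a1 -> vl = v1) -> (a2 -> vl = v2) ->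
     (b1 -> v1 = vr) -> (b2 -> v2 = vr) -> [/\ vl = v1, vl = v2 & vl = vr]) ->
  linked a1 a2 b1 b2.
Proof.
move=> H; have h1 := H true false false false; have h2 := H false true false false.
have h3 := H false false true false; have h4 := H false false false true.
have h5 := H true false true false; have h6 := H true true false false.
move: h1 h2 h3 h4 h5 h6; clear H.
case: a1 a2 b1 b2 => [] [] [] [] //= h1 h2 h3 h4 h5 h6; exfalso.
all: first [by case: h1 | by case: h2 | by case: h3 | by case: h4 | by case: h5 | by case: h6].
Qed.

(** P is what lies to the right of a run of a connected set. Its first column
    is a run, whose contact with the preceding one is forced by connectedness,
    or a gapped column, whose contacts are forced through block_value; in that
    case the following column, if any, is a run because two-component columns
    are isolated. The remaining part is connected by conn_strip, the run being
    the only gate. k bounds the number of cells. *)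
Lemma decode_onto k : forall P x y n, (#|` P| <= k)%N -> (0 < n)%N ->
  (forall c, c \in P -> x < c.1) -> conn (run_cells x y n `|` P)%fset ->
  simple_columns P ->
  exists ss o, steps_ok n ss o /\ P = decode (x + 1) y ss o.
Proof.
elim: k => [|k IHk] P x y n Pk n0 Px Lc Ps.
  by exists [::], None; split=> //=; apply/eqP; rewrite -cardfs_eq0; lia.
have [->|[c0 c0P]] : P = fset0 \/ exists c0 : cell, c0 \in P.
- by case: (fset_0Vmem P) => [|[c0]]; [left | right; exists c0].
- by exists [::], None.
set L := run_cells x y n in Lc.
have yL : (x, y) \in L by rewrite mem_run_pair /in_run; lia.
have Pc1 c : c \in P -> x + 1 <= c.1 by move=> /Px; lia.
have mL c : c \in (L `|` P)%fset -> c.1 < x + 1 -> c \in L.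
  by rewrite in_fsetU => /orP[//|/Px]; lia.
have mP c : c \in (L `|` P)%fset -> x < c.1 -> c \in P.
  by rewrite in_fsetU mem_run => /orP[/andP[/eqP ->]|//]; rewrite ltxx.
have LP c : c \in L -> c \in (L `|` P)%fset by rewrite in_fsetU => ->.
have PL c : c \in P -> c \in (L `|` P)%fset by rewrite in_fsetU orbC => ->.
have Lx c : c \in L -> c.1 = x by rewrite mem_run => /andP[/eqP].
have [y1 y1P] : exists y1, (x + 1, y1) \in P.
  apply: contrapT => nex; have := Px _ c0P.
  have : c0.1 < x + 1; last by lia.
  apply: (@column_nonempty _ (x + 1) (x, y) Lc) => [||c|]; [exact: LP | by rewrite /=; lia | | exact: PL].
  rewrite in_fsetU => /orP[/Lx ->|cP]; first by apply/eqP; lia.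
  by apply/negP => /eqP cx; apply: nex; exists c.2; rewrite -cx; case: (c) cP.
have [t1|t2] := (Ps.1 _ y1P : #|` tops P (x + 1)| = 1%N \/ #|` tops P (x + 1)| = 2%N).
  have [v [m [m0 Pv]]] := one_top t1.
  have PE := column_split Pc1 Pv.
  set P' := beyond P (x + 1).
  have PE' : P = (run_cells (x + 1) v m `|` P')%fset.
    by apply/fsetP => c; rewrite PE in_fsetU mem_run.
  have vr : (x + 1, v) \in run_cells (x + 1) v m by rewrite mem_run_pair /in_run; lia.
  have Pconn : conn (run_cells (x + 1) v m `|` P')%fset.
    rewrite -PE'; apply: (conn_strip Lc (@conn_run (x + 1) v m) vr).
      by move=> c cr; rewrite PE' in_fsetU cr.
    move=> c d /Lx cx dP /adj_near /andP[near _]; move: dP; rewrite PE mem_run.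
    by rewrite mem_beyond; case/orP => // /andP[_]; lia.
  have tch : touch y n v m.
    have [c [d [cL [dP cd]]]] : exists c d, c \in L /\ d \in P /\ adj c d.
      apply: contrapT => nex; have : (x, y).1 < x + 1 = (c0.1 < x + 1).
        apply: (Lc (fun c => c.1 < x + 1)); [|exact: LP|exact: PL].
        move=> a b; rewrite !in_fsetU => /orP[aL|aP] /orP[bL|bP] ab.
        - by rewrite (Lx _ aL) (Lx _ bL).
        - by case: nex; exists a, b.
        - by case: nex; exists b, a; rewrite adj_sym.
        - by have := Px _ aP; have := Px _ bP; lia.
      by have := Px _ c0P => /=; lia.
    have dr : d \in run_cells (x + 1) v m.
      move: dP; rewrite PE mem_run mem_beyond; case/orP => // /andP[_].
      by case/andP: (adj_near cd) => near _; have := Lx _ cL; lia.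
    exact: adj_touch cL dr cd.
  have [||c|||ss [o [ssok P'E]]] := IHk P' (x + 1) v m.
  - rewrite -ltnS; apply: leq_trans Pk; exact: (card_beyond y1P (lexx _)).
  - exact: m0.
  - by rewrite mem_beyond => /andP[].
  - exact: Pconn.
  - exact: simple_beyond.
  exists ((None, (v - y, m)) :: ss), o; split.
    rewrite /= ssok andbT /step_ok /= /height /= m0 /=.
    by rewrite -(touch_shift0 y) addrC subrK.
  by rewrite PE' P'E /= [y + _]addrC subrK.
have [u [t [tok Pu]]] := two_tops t2.
have PE := column_split Pc1 Pu.
set P' := beyond P (x + 1) in PE.
have t_0 := tok; case/and3P: t_0 => t0 g0 h0.
have inx c : c \in (L `|` P)%fset -> c.1 = x + 1 -> in_gapped u t c.2.
  rewrite in_fsetU => /orP[/Lx -> /esym|cP cx]; first by lia.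
  by rewrite -Pu -cx; case: (c) cP.
have nearL c d (u' : int) (a : nat) : c \in (L `|` P)%fset -> adj c d -> c.1 < x + 1 ->
    d.1 = x + 1 -> in_run u' a d.2 -> touch y n u' a.
  move=> cLP cd cx dx da; apply: (adj_touch (mL _ cLP cx) _ cd).
  by rewrite mem_run dx eqxx.
have c1P : (x + 1, u) \in (L `|` P)%fset.
  by apply: PL; rewrite Pu /in_gapped /in_run; lia.
have c2P : (x + 1, u + (low t + gap t)%:Z) \in (L `|` P)%fset.
  by apply: PL; rewrite Pu /in_gapped /in_run; lia.
have vL vl v1 v2 vr : block_value (x + 1) u t vl v1 v2 vr (x, y) = vl.
  by rewrite /block_value (_ : (x, y).1 < x + 1) //=; lia.
have vC1 vl v1 v2 vr : block_value (x + 1) u t vl v1 v2 vr (x + 1, u) = v1.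
  by rewrite /block_value /= ltxx eqxx (_ : in_run _ _ _) // /in_run; lia.
have vC2 vl v1 v2 vr :
    block_value (x + 1) u t vl v1 v2 vr (x + 1, u + (low t + gap t)%:Z) = v2.
  by rewrite /block_value /= ltxx eqxx (_ : in_run _ _ _ = false) // /in_run; lia.
have yu : y + (u - y) = u by rewrite addrC subrK.
have [[y2 y2P]|n2] := pselect (exists y2, (x + 1 + 1, y2) \in P); last first.
  (* The gapped column is the last one: it is the tail. *)
  have far c : c \in (L `|` P)%fset -> c.1 < x + 1 + 1.
    apply: (column_nonempty Lc (LP _ yL)) => [|d]; first by rewrite /=; lia.
    rewrite in_fsetU => /orP[/Lx ->|dP]; first by apply/eqP; lia.
    by apply/negP => /eqP dx; apply: n2; exists d.2; rewrite -dx; case: (d) dP.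
  have PG : P = gapped_cells (x + 1) u t.
    apply/fsetP => c; rewrite PE mem_gapped mem_beyond.
    by case: (boolP (c \in P)) => [/PL/far cx|_]; rewrite ?orbF //= ltNge -ltzD1 cx orbF.
  have H := @block_value_const _ (x + 1) u t (touch y n u (low t))
    (touch y n (u + (low t + gap t)%:Z) (high t)) false false Lc tok inx
    (fun c d cP _ cd cx dx => nearL c d _ _ cP cd cx dx)
    (fun c d cP _ cd cx dx => nearL c d _ _ cP cd cx dx).
  have noR c : c \in (L `|` P)%fset -> x + 1 < c.1 -> false.
    by move=> /far; lia.
  have {}H := H (fun c d cP _ _ cx _ _ => noR c cP cx) (fun c d cP _ _ cx _ _ => noR c cP cx)
    true (touch y n u (low t)) (touch y n (u + (low t + gap t)%:Z) (high t)) true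
    (fun e => esym e) (fun e => esym e).
  have noF (b b' : bool) : false -> b = b' by [].
  have := H (noF _ _) (noF _ _) _ _ (LP _ yL) c1P; rewrite vL vC1 => hl.
  have := H (noF _ _) (noF _ _) _ _ (LP _ yL) c2P; rewrite vL vC2 => hh.
  exists [::], (Some (u - y, t)); split; last by rewrite PG /= yu.
  rewrite /= tok /hits_low /hits_high -(touch_shift0 y n (u - y)) yu.
  by rewrite -(touch_shift0 y n (u - y + _)) addrA yu -hl -hh.
have t1 : #|` tops P (x + 1 + 1)| = 1%N.
  by case: (Ps.1 _ y2P) => // t2'; case: (Ps.2 (x + 1)).
have [v [m [m0 Pv]]] := one_top t1.
have uv : u + (v - u) = v by rewrite addrC subrK.
set P2 := beyond P (x + 1 + 1).
set R := run_cells (x + 1 + 1) v m.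
have PE2 : P = (gapped_cells (x + 1) u t `|` (R `|` P2))%fset.
  apply/fsetP => c; rewrite PE in_fsetU mem_gapped in_fsetU mem_run !mem_beyond; congr (_ || _).
  case: c => a b /=; have [->|ne] := eqVneq a (x + 1 + 1).
    by rewrite Pv ltxx andbF orbF (_ : x + 1 < x + 1 + 1) ?andbT //; lia.
  by congr (_ && _); clear -ne; apply/idP/idP; lia.
have vR : (x + 1 + 1, v) \in R by rewrite mem_run_pair /in_run; lia.
have vP : (x + 1 + 1, v) \in P by rewrite PE2 !in_fsetU vR orbT.
have LPE : (L `|` P = (L `|` gapped_cells (x + 1) u t) `|` (R `|` P2))%fset.
  by rewrite {1}PE2 fsetUA.
have Rconn : conn (R `|` P2)%fset.
  rewrite LPE in Lc; apply: (conn_strip Lc (@conn_run (x + 1 + 1) v m) vR).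
    by move=> c cR; rewrite in_fsetU cR.
  move=> c d cX; rewrite in_fsetU mem_beyond => /orP[//|/andP[_ dx]] /adj_near /andP[near _].
  have : c.1 <= x + 1.
    by move: cX; rewrite in_fsetU mem_gapped => /orP[/Lx ->|/andP[/eqP -> _]] //; rewrite lerDl.
  by clear -near dx; lia.
have nearR c d (u' : int) (a : nat) : c \in (L `|` P)%fset -> adj c d -> x + 1 < c.1 ->
    d.1 = x + 1 -> in_run u' a d.2 -> touch u' a v m.
  move=> cLP cd cx dx da; have cR : c \in R.
    have : c \in P by apply: mP cLP _; clear -cx; lia.
    rewrite PE2 in_fsetU mem_gapped in_fsetU mem_beyond => /or3P[/andP[/eqP E _]|//|/andP[_ lt]].
      by clear -E cx; lia.
    by case/andP: (adj_near cd) => near _; clear -near lt cx dx; lia.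
  rewrite adj_sym in cd; apply: (adj_touch _ cR cd).
  by rewrite mem_run dx eqxx.
have lk : linked (touch y n u (low t)) (touch y n (u + (low t + gap t)%:Z) (high t))
    (touch u (low t) v m) (touch (u + (low t + gap t)%:Z) (high t) v m).
  apply: linkedP => vl v1 v2 vr e1 e2 f1 f2.
  have H := @block_value_const _ (x + 1) u t _ _ _ _ Lc tok inx
    (fun c d cP _ cd cx dx => nearL c d _ _ cP cd cx dx)
    (fun c d cP _ cd cx dx => nearL c d _ _ cP cd cx dx)
    (fun c d cP _ cd cx dx => nearR c d _ _ cP cd cx dx)
    (fun c d cP _ cd cx dx => nearR c d _ _ cP cd cx dx) vl v1 v2 vr e1 e2 f1 f2 (x, y).
  have := H _ (LP _ yL) c1P; rewrite vL vC1 => q1.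
  have := H _ (LP _ yL) c2P; rewrite vL vC2 => q2.
  have := H _ (LP _ yL) (PL _ vP).
  have [xx xx'] : (x + 1 + 1 < x + 1 = false) /\ ((x + 1 + 1 == x + 1) = false) by clear; lia.
  by rewrite vL /block_value /= xx xx' => q3.
have [||c|||ss [o [ssok P2E]]] := IHk P2 (x + 1 + 1) v m.
- rewrite -ltnS; apply: leq_trans Pk; exact: (card_beyond y2P (lexx _)).
- exact: m0.
- by rewrite mem_beyond => /andP[].
- exact: Rconn.
- exact: simple_beyond.
exists ((Some (u - y, t), (v - u, m)) :: ss), o; split.
  rewrite /= ssok andbT /step_ok /= /height /= m0 tok /=.
  rewrite /hits_low /hits_high /low_hits /high_hits.
  rewrite -(touch_shift0 y n (u - y)) yu -(touch_shift0 y n (u - y + _)) addrA yu.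
  by rewrite -(touch_shift0 u _ (v - u)) -(touch_shift u (low t + gap t)%:Z) uv.
rewrite {1}PE2 P2E /= yu uv.
by rewrite -[x + 1 + 1 + 1]addrA.
Qed.

Lemma leftmost P d : d \in P ->
  exists x y, (x, y) \in P /\ forall c, c \in P -> x <= c.1.
Proof.
move=> dP; have [B PB] := fset_bounded P.
have ex : exists k : nat, `[< exists y, (k%:Z - B%:Z, y) \in P >].
  exists (absz (d.1 + B%:Z)%R); apply/asboolP; exists d.2.
  rewrite (_ : _ - _ = d.1); first by case: (d) dP.
  by have [d1 _] := PB _ dP; clear -d1; lia.
case: (ex_minnP ex) => k /asboolP[y yP] kmin; exists (k%:Z - B%:Z), y; split=> // c cP.
have [c1 _] := PB _ cP.
have /kmin : `[< exists y, ((absz (c.1 + B%:Z)%R)%:Z - B%:Z, y) \in P >].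
  apply/asboolP; exists c.2; rewrite (_ : _ - _ = c.1); first by case: (c) cP.
  by clear -c1; lia.
by clear -c1; lia.
Qed.

(** Split off the leftmost column; a leftmost gapped column must be followed by
    a run touching both of its runs, since nothing else can connect them. *)
Lemma polyomino_of_onto P : P != fset0 -> conn P -> simple_columns P ->
  exists x y (cd : code), code_ok cd /\ P = polyomino_of x y cd.
Proof.
move=> /fset0Pn[d0 d0P] Pc Ps; have [x [y0 [y0P Px]]] := leftmost d0P.
have [t1|t2] := (Ps.1 _ y0P : #|` tops P x| = 1%N \/ #|` tops P x| = 2%N).
  have [u [n [n0 Pu]]] := one_top t1; have PE := column_split Px Pu.
  have PE' : P = (run_cells x u n `|` beyond P x)%fset.
    by apply/fsetP => c; rewrite PE in_fsetU mem_run.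
  have [||c|||ss [o [ok bE]]] := @decode_onto #|` beyond P x| (beyond P x) x u n.
  - exact: leqnn.
  - exact: n0.
  - by rewrite mem_beyond => /andP[].
  - by rewrite -PE'.
  - exact: simple_beyond.
  exists x, u, ((None, (0, n)), (ss, o)); split.
    by rewrite /code_ok /first_ok /= /height /= n0 eqxx.
  by rewrite /polyomino_of /= addr0 -bE.
have [u [t [tok Pu]]] := two_tops t2; have PE := column_split Px Pu.
have inx c : c \in P -> c.1 = x -> in_gapped u t c.2.
  by move=> cP cx; rewrite -Pu -cx; case: (c) cP.
have t_0 := tok; case/and3P: t_0 => t0 g0 h0.
have c1P : (x, u) \in P by rewrite Pu /in_gapped /in_run; clear -t0; lia.
have c2P : (x, u + (low t + gap t)%:Z) \in P.
  by rewrite Pu /in_gapped /in_run; clear -h0; lia.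
have vC1 vl v1 v2 vr : block_value x u t vl v1 v2 vr (x, u) = v1.
  by rewrite /block_value /= ltxx eqxx (_ : in_run _ _ _) // /in_run; clear -t0; lia.
have vC2 vl v1 v2 vr : block_value x u t vl v1 v2 vr (x, u + (low t + gap t)%:Z) = v2.
  by rewrite /block_value /= ltxx eqxx (_ : in_run _ _ _ = false) // /in_run; clear -g0; lia.
have noL c : c \in P -> c.1 < x -> false by move=> /Px; rewrite ltNge => ->.
have noF (b b' : bool) : false -> b = b' by [].
have H b1 b2 := @block_value_const P x u t false false b1 b2 Pc tok inx
  (fun c _ cP _ _ cx _ _ => noL c cP cx) (fun c _ cP _ _ cx _ _ => noL c cP cx).
have [[y2 y2P]|n2] := pselect (exists y2, (x + 1, y2) \in P); last first.
  have far c : c \in P -> x < c.1 -> false.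
    have lt : (x, u).1 < x + 1 by rewrite ltrDl.
    move=> cP; have : c.1 < x + 1; last by clear; lia.
    apply: (column_nonempty Pc c1P lt) cP => d dP.
    by apply/negP => /eqP dx; apply: n2; exists d.2; rewrite -dx; case: (d) dP.
  (* A gapped column on its own: its two runs are separated. *)
  have := H false false (fun c _ cP _ _ cx _ _ => far c cP cx)
    (fun c _ cP _ _ cx _ _ => far c cP cx) true true false true
    (noF _ _) (noF _ _) (noF _ _) (noF _ _) _ _ c1P c2P.
  by rewrite vC1 vC2.
have t1 : #|` tops P (x + 1)| = 1%N.
  by case: (Ps.1 _ y2P) => // t2'; case: (Ps.2 x).
have [v [m [m0 Pv]]] := one_top t1.
have uv : u + (v - u) = v by rewrite addrC subrK.
set P2 := beyond P (x + 1).
set R := run_cells (x + 1) v m.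
have PE2 : P = (gapped_cells x u t `|` (R `|` P2))%fset.
  apply/fsetP => c; rewrite PE in_fsetU mem_gapped in_fsetU mem_run !mem_beyond; congr (_ || _).
  case: c => a b /=; have [->|ne] := eqVneq a (x + 1).
    by rewrite Pv ltxx andbF orbF ltrDl ltr01 andbT.
  by congr (_ && _); clear -ne; apply/idP/idP; lia.
have vR : (x + 1, v) \in R by rewrite mem_run_pair /in_run; clear -m0; lia.
have vP : (x + 1, v) \in P by rewrite PE2 !in_fsetU vR orbT.
have Rconn : conn (R `|` P2)%fset.
  rewrite PE2 in Pc; apply: (conn_strip Pc (@conn_run (x + 1) v m) vR).
    by move=> c cR; rewrite in_fsetU cR.
  move=> c d; rewrite mem_gapped in_fsetU mem_beyond => /andP[/eqP cx _].
  by move=> /orP[//|/andP[_ dx]] /adj_near /andP[near _]; clear -near cx dx; lia.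
have nearR c d (u' : int) (a : nat) : c \in P -> adj c d -> x < c.1 ->
    d.1 = x -> in_run u' a d.2 -> touch u' a v m.
  move=> cP cd cx dx da; have cR : c \in R.
    move: cP; rewrite PE2 in_fsetU mem_gapped in_fsetU mem_beyond.
    move=> /or3P[/andP[/eqP E _]|//|/andP[_ lt]]; first by clear -E cx; lia.
    by case/andP: (adj_near cd) => near _; clear -near lt cx dx; lia.
  rewrite adj_sym in cd; apply: (adj_touch _ cR cd).
  by rewrite mem_run dx eqxx.
have {}H := H (touch u (low t) v m) (touch (u + (low t + gap t)%:Z) (high t) v m)
  (fun c d cP _ cd cx dx => nearR c d _ _ cP cd cx dx)
  (fun c d cP _ cd cx dx => nearR c d _ _ cP cd cx dx) true
  (touch u (low t) v m) (touch (u + (low t + gap t)%:Z) (high t) v m) true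
  (noF _ _) (noF _ _) id id.
have vV vl v1 v2 vr : block_value x u t vl v1 v2 vr (x + 1, v) = vr.
  have [xx xx'] : (x + 1 < x = false) /\ ((x + 1 == x) = false) by clear; lia.
  by rewrite /block_value /= xx xx'.
have := H _ _ c1P vP; rewrite vC1 vV => b1.
have := H _ _ c2P vP; rewrite vC2 vV => b2.
have [||c|||ss [o [ok bE]]] := @decode_onto #|` P2| P2 (x + 1) v m.
- exact: leqnn.
- exact: m0.
- by rewrite mem_beyond => /andP[].
- exact: Rconn.
- exact: simple_beyond.
exists x, u, ((Some (0, t), (v - u, m)), (ss, o)); split.
  rewrite /code_ok /first_ok /= /height /= m0 tok /low_hits /high_hits.
  by rewrite -(touch_shift0 u _ (v - u)) -(touch_shift u (low t + gap t)%:Z) uv b1 b2.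
by rewrite /polyomino_of /= addr0 uv {1}PE2 bE -[x + 1 + 1]addrA.
Qed.

(** * The code is unique *)

Lemma run_inj u a v b : (0 < a)%N -> (0 < b)%N -> in_run u a =1 in_run v b ->
  u = v /\ a = b.
Proof.
move=> a0 b0 H; have uv : u = v.
  have := H u; have := H v; rewrite /in_run; clear -a0 b0; lia.
subst v; split=> //.
have := H (u + a%:Z - 1); have := H (u + b%:Z - 1); rewrite /in_run; clear -a0 b0; lia.
Qed.

(** The ends of the runs are read off one after the other, by testing
    membership of the levels where the two descriptions would differ. *)
Lemma gapped_inj u t v t' : gapped_ok t -> gapped_ok t' ->
  in_gapped u t =1 in_gapped v t' -> u = v /\ t = t'.
Proof.
case: t t' => [[a g] b] [[a' g'] b'] /and3P[/= a0 g0 b0] /and3P[/= a0' g0' b0'] H.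
rewrite /low /gap /high /= in a0 g0 b0 a0' g0' b0'.
have {}H y : (in_run u a y || in_run (u + (a + g)%:Z) b y) =
             (in_run v a' y || in_run (v + (a' + g')%:Z) b' y) := H y.
have uv : u = v.
  by have := H u; have := H v; rewrite /in_run; clear -a0 g0 a0' g0'; lia.
subst v; have aa : a = a'.
  have := H (u + a%:Z); have := H (u + a'%:Z); rewrite /in_run; clear -a0 g0 a0' g0'; lia.
subst a'; have gg : g = g'.
  have := H (u + (a + g)%:Z); have := H (u + (a + g')%:Z); rewrite /in_run; clear -b0 b0'; lia.
subst g'; have bb : b = b'.
  have := H (u + (a + g + b)%:Z); have := H (u + (a + g + b')%:Z); rewrite /in_run.
  by clear -b0 b0'; lia.
by rewrite bb.
Qed.

Lemma beyond_run_decode x y z m ss o :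
  beyond (decode x y ((None, (z, m)) :: ss) o) x = decode (x + 1) (y + z) ss o.
Proof.
apply/fsetP => c; rewrite mem_beyond /= in_fsetU mem_run.
case: (boolP (c \in decode (x + 1) (y + z) ss o)) => [/decode_right cx|_].
  by rewrite orbT; clear -cx; lia.
by rewrite orbF; case: eqP => //= ->; rewrite ltxx andbF.
Qed.

Lemma beyond_via_decode x y z t z' m ss o :
  beyond (decode x y ((Some (z, t), (z', m)) :: ss) o) (x + 1) = decode (x + 2%:Z) (y + z + z') ss o.
Proof.
apply/fsetP => c; rewrite mem_beyond /= in_fsetU mem_gapped in_fsetU mem_run.
case: (boolP (c \in decode (x + 2%:Z) (y + z + z') ss o)) => [/decode_right cx|_].
  by rewrite !orbT; clear -cx; lia.
rewrite orbF; case: eqP => [->|_] /=; first by rewrite ltNge lerDl ler01 andbF.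
by case: eqP => //= ->; rewrite ltxx andbF.
Qed.

Lemma tops_nil_decode x y o : tail_shape o ->
  #|` tops (decode x y [::] o) x| = (if o is Some _ then 2 else 0)%N /\
  #|` tops (decode x y [::] o) (x + 1)| = 0%N.
Proof.
case: o => [[z t]|] /= tok; split; try by apply: tops_empty => y'; rewrite inE.
  exact: tops_gapped tok (@column_eq_gapped x (y + z) t).
apply: tops_empty => y'; rewrite mem_gapped /= (_ : (x + 1 == x) = false) //.
by clear; lia.
Qed.

Lemma tops_run_decode x y z m ss o : (0 < m)%N ->
  #|` tops (decode x y ((None, (z, m)) :: ss) o) x| = 1%N.
Proof. by move=> m0; apply: tops_run m0 (@column_eq_run_decode x y z m ss o). Qed.

Lemma tops_via_decode x y z t z' m ss o : gapped_ok t -> (0 < m)%N ->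
  #|` tops (decode x y ((Some (z, t), (z', m)) :: ss) o) x| = 2%N /\
  #|` tops (decode x y ((Some (z, t), (z', m)) :: ss) o) (x + 1)| = 1%N.
Proof.
move=> tok m0; split.
  exact: tops_gapped tok (@column_eq_gapped_decode x y z t z' m ss o).
exact: tops_run m0 (@column_eq_via_decode x y z t z' m ss o).
Qed.

(** The number of tops in columns x and x + 1 reveals the form of the first
    step, the column itself its offset and sizes, and beyond the rest. *)
Lemma decode_inj x y ss o ss' o' : all shape_ok ss -> tail_shape o ->
  all shape_ok ss' -> tail_shape o' ->
  decode x y ss o = decode x y ss' o' -> ss = ss' /\ o = o'.
Proof.
elim: ss x y ss' => [|[[[z t]|] [z' m]] ss IHss] x y ss'.
- move=> _ ook; have [n0 n1] := tops_nil_decode x y ook.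
  case: ss' => [|[[[z2 t2]|] [z2' m2]] ss'].
  + move=> _ ook' E; split=> //; have [n0' _] := tops_nil_decode x y ook'.
    rewrite E in n0; rewrite n0 in n0'.
    case: o o' ook ook' n0' E {n0 n1} => [[z t]|] [[z2 t2]|] //= tok tok2 _ E.
    have [|yz ->] := @gapped_inj (y + z) t (y + z2) t2 tok tok2.
      by move=> y'; rewrite -!(@column_eq_gapped x) E.
    by rewrite (@addrI _ y _ _ yz).
  + move=> /andP[/andP[m0 tok] _] _ E.
    have [_ E1] := @tops_via_decode x y z2 t2 z2' m2 ss' o' tok m0.
    by rewrite E E1 in n1.
  + move=> /andP[/andP[m0 _] _] _ E.
    have := @tops_run_decode x y z2' m2 ss' o' m0.
    by rewrite -E n0; case: (o).
- move=> /andP[/andP[m0 tok] ssok] ook.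
  have [E0 E1] := @tops_via_decode x y z t z' m ss o tok m0.
  case: ss' => [|[[[z2 t2]|] [z2' m2]] ss'].
  + by move=> _ ook' E; have [_] := tops_nil_decode x y ook'; rewrite -E E1.
  + move=> /andP[/andP[m20 tok2] ssok'] ook' E.
    have [|yz tt] := @gapped_inj (y + z) t (y + z2) t2 tok tok2.
      move=> y'; rewrite -(@column_eq_gapped_decode x y z t z' m ss o).
      by rewrite -(@column_eq_gapped_decode x y z2 t2 z2' m2 ss' o') E.
    have zz := @addrI _ y _ _ yz; subst z2 t2.
    have [|yz' mm] := @run_inj (y + z + z') m (y + z + z2') m2 m0 m20.
      move=> y'; rewrite -(@column_eq_via_decode x y z t z' m ss o).
      by rewrite -(@column_eq_via_decode x y z t z2' m2 ss' o') E.
    have zz' := @addrI _ (y + z) _ _ yz'; subst z2' m2.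
    have := congr1 (beyond^~ (x + 1)) E; rewrite /= !beyond_via_decode => E'.
    by have [-> ->] := IHss _ _ _ ssok ook ssok' ook' E'.
  + move=> /andP[/andP[m20 _] _] _ E.
    by have := @tops_run_decode x y z2' m2 ss' o' m20; rewrite -E E0.
move=> /andP[/andP[m0 _] ssok] ook.
have E0 := @tops_run_decode x y z' m ss o m0.
case: ss' => [|[[[z2 t2]|] [z2' m2]] ss'].
+ by move=> _ ook' E; have [+ _] := tops_nil_decode x y ook'; rewrite -E E0; case: (o').
+ move=> /andP[/andP[m20 tok2] _] _ E.
  by have [+ _] := @tops_via_decode x y z2 t2 z2' m2 ss' o' tok2 m20; rewrite -E E0.
move=> /andP[/andP[m20 _] ssok'] ook' E.
have [|yz mm] := @run_inj (y + z') m (y + z2') m2 m0 m20.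
  move=> y'; rewrite -(@column_eq_run_decode x y z' m ss o).
  by rewrite -(@column_eq_run_decode x y z2' m2 ss' o') E.
have zz := @addrI _ y _ _ yz; subst z2' m2.
have := congr1 (beyond^~ x) E; rewrite /= !beyond_run_decode => E'.
by have [-> ->] := IHss _ _ _ ssok ook ssok' ook' E'.
Qed.

Lemma code_shape (cd : code) : code_ok cd ->
  all shape_ok (cd.1 :: cd.2.1) /\ tail_shape cd.2.2.
Proof.
case: cd => st [ss o] /= /andP[/= /first_shape -> ok].
by have /andP[] := steps_shape ok.
Qed.

(** The position of a decoded polyomino is determined by the lowest cell of its
    leftmost column. *)
Lemma polyomino_of_corner x y (cd : code) : code_ok cd ->
  [/\ (x, y) \in polyomino_of x y cd, forall c, c \in polyomino_of x y cd -> x <= c.1 &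
      forall y', (x, y') \in polyomino_of x y cd -> y <= y'].
Proof.
case: cd => -[o0 [z' m]] [ss o] /andP[/andP[m0 /= fok] _].
rewrite -[polyomino_of _ _ _]/(decode x y ((o0, (z', m)) :: ss) o); rewrite /height /= in m0.
split; last 2 first.
- by move=> c; exact: decode_right.
- case: o0 fok => [[z t] /and4P[/eqP -> _ _ _]|/eqP ->] y'.
    rewrite (@column_eq_gapped_decode x y 0 t z' m ss o) addr0 /in_gapped /in_run; clear; lia.
  by rewrite (@column_eq_run_decode x y 0 m ss o) addr0 /in_run; clear; lia.
case: o0 fok => [[z t] /and4P[/eqP -> /and3P[t0 _ _] _ _]|/eqP ->].
  rewrite (@column_eq_gapped_decode x y 0 t z' m ss o) addr0 /in_gapped /in_run; clear -t0; lia.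
by rewrite (@column_eq_run_decode x y 0 m ss o) addr0 /in_run; clear -m0; lia.
Qed.

Lemma polyomino_of_inj x y x' y' (cd cd' : code) : code_ok cd -> code_ok cd' ->
  polyomino_of x y cd = polyomino_of x' y' cd' -> cd = cd'.
Proof.
move=> ok ok' E; have [xy low_x low_y] := @polyomino_of_corner x y cd ok.
have [xy' low_x' low_y'] := @polyomino_of_corner x' y' cd' ok'.
have xx : x = x'.
  apply/le_anti; rewrite -E in xy'; rewrite E in xy.
  by rewrite (low_x _ xy') (low_x' _ xy).
subst x'; have yy : y = y'.
  apply/le_anti; rewrite -E in xy'; rewrite E in xy.
  by rewrite (low_y _ xy') (low_y' _ xy).
subst y'; have [sok tok] := code_shape ok; have [sok' tok'] := code_shape ok'.
have [] := decode_inj sok tok sok' tok' E.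
by case: cd cd' {ok ok' E xy low_x low_y xy' low_x' low_y' sok tok sok' tok'}
  => st [ss o] [st' [ss' o']] /= [-> ->] ->.
Qed.

(** * Connectedness in the plane *)

Local Open Scope classical_set_scope.

Section Topology.
Variable R : realType.
Implicit Types (p r : R * R).

Let sqrt3 : R := Num.sqrt 3%:R.

Lemma sqrt3_gt0 : 0 < sqrt3.
Proof. by rewrite sqrtr_gt0 ltr0n. Qed.

(** Linear forms in the coordinates x and y / sqrt 3, which clear all square
    roots. *)
Definition lin (a b : R) p : R := a * p.1 + b * (p.2 / sqrt3).

(** vcoord and wcoord are the values at the centre of c of the forms x + y /
    sqrt 3 and x - y / sqrt 3; vpos and wpos are these forms recentred at c. *)
Definition vcoord c : int := 2%:Z * c.1 + c.2.
Definition wcoord c : int := c.1 - c.2.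
Definition vpos c p : R := lin 1 1 p - (vcoord c)%:~R.
Definition wpos c p : R := lin 1 (-1) p - (wcoord c)%:~R.

(** A hexagon is the unit ball of the norm max (|v|, |w|, |v - w|); e selects
    the closed ball (true) or the open one (false). *)
Definition hexball (e : bool) c : set (R * R) :=
  [set p | [/\ `|vpos c p| < 1 ?<= if e, `|wpos c p| < 1 ?<= if e &
                `|vpos c p - wpos c p| < 1 ?<= if e]].

Lemma center2 c : (Defs.center R c).2 / sqrt3 = c.2%:~R + c.1%:~R / 2%:R.
Proof. by rewrite /Defs.center /= mulrAC divff ?mul1r // gt_eqF // sqrt3_gt0. Qed.

Lemma norm_hexagon (x y : R) : (2%:R * `|y| <= 1 /\ `|x| + `|y| <= 1) <->
  [/\ `|x + y| <= 1, `|x - y| <= 1 & `|2%:R * y| <= 1].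
Proof.
rewrite !ler_norml; case: (ger0P x) => x0; case: (ger0P y) => y0; split.
all: try by move=> [h1 h2]; split; apply/andP; split; lra.
all: move=> [/andP[? ?] /andP[? ?] /andP[? ?]]; split; lra.
Qed.

Lemma hexagonE c : hexagon (R := R) c = hexball true c.
Proof.
apply/seteqP; rewrite /hexagon /hexball /=.
have E p : `|p.2 - (Defs.center R c).2| = sqrt3 * `|p.2 / sqrt3 - (c.2%:~R + c.1%:~R / 2%:R)|.
  have s3V : 0 < sqrt3^-1 by rewrite invr_gt0 sqrt3_gt0.
  rewrite -center2 -mulrBl normrM (gtr0_norm s3V).
  by rewrite mulrCA mulfV ?mulr1 // gt_eqF // sqrt3_gt0.
have hexE p : hexagon (R := R) c p <->
    2%:R * `|p.2 / sqrt3 - (c.2%:~R + c.1%:~R / 2%:R)| <= 1 /\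
    `|p.1 - 3%:R / 2%:R * c.1%:~R| + `|p.2 / sqrt3 - (c.2%:~R + c.1%:~R / 2%:R)| <= 1.
  have M a : (sqrt3 * a <= sqrt3) = (a <= 1) by rewrite -{2}[sqrt3]mulr1 (ler_pM2l sqrt3_gt0).
  by rewrite /hexagon /= E -/sqrt3 mulrCA -mulrDr !M.
suff H p : hexagon (R := R) c p <-> hexball true c p by split=> p /H.
rewrite hexE /hexball /=.
set X := p.1 - _; set Y := p.2 / sqrt3 - _.
have -> : vpos c p = X + Y.
  by rewrite /vpos /lin /vcoord /X /Y !(intrD, intrM) /=; lra.
have -> : wpos c p = X - Y.
  by rewrite /wpos /lin /wcoord /X /Y !(intrB) /=; lra.
have -> : X + Y - (X - Y) = 2%:R * Y by ring.
exact: norm_hexagon.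
Qed.

Lemma lin_continuous a b : continuous (lin a b).
Proof.
move=> p; apply: cvgD.
  by apply: cvgM; [exact: cvg_cst | exact: cvg_fst].
by apply: cvgM; [exact: cvg_cst | apply: cvgM; [exact: cvg_snd | exact: cvg_cst]].
Qed.

Lemma vpos_continuous c : continuous (vpos c).
Proof. by move=> p; apply: cvgB; [exact: lin_continuous | exact: cvg_cst]. Qed.

Lemma wpos_continuous c : continuous (wpos c).
Proof. by move=> p; apply: cvgB; [exact: lin_continuous | exact: cvg_cst]. Qed.

Lemma vwpos_continuous c : continuous (fun p => vpos c p - wpos c p).
Proof. by move=> p; apply: cvgB; [exact: vpos_continuous | exact: wpos_continuous]. Qed.

Lemma norm_comp_continuous (f : R * R -> R) : continuous f -> continuous (fun p => `|f p|).
Proof. by move=> fc p; apply: cvg_norm; exact: fc. Qed.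

Lemma open_preimage (f : R * R -> R) (D : set R) : continuous f -> open D -> open (f @^-1` D).
Proof. by move=> fc; apply: open_comp => p _; exact: fc. Qed.

Lemma closed_preimage (f : R * R -> R) (D : set R) : continuous f -> closed D -> closed (f @^-1` D).
Proof. by move=> fc; apply: preimage_closed => p _; exact: fc. Qed.

Lemma hexball_open c : open (hexball false c).
Proof.
have -> : hexball false c = (fun p => `|vpos c p|) @^-1` [set x | x < 1] `&`
    (fun p => `|wpos c p|) @^-1` [set x | x < 1] `&`
    (fun p => `|vpos c p - wpos c p|) @^-1` [set x | x < 1].
  by apply/seteqP; split=> p; [case=> ? ? ? | case=> -[? ?] ?].
by do 2?apply: openI; apply: (open_preimage _ (@open_lt R 1)); apply: norm_comp_continuous;
  [exact: vpos_continuous | exact: wpos_continuous | exact: vwpos_continuous].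
Qed.

Lemma hexball_closed c : closed (hexball true c).
Proof.
have -> : hexball true c = (fun p => `|vpos c p|) @^-1` [set x | x <= 1] `&`
    (fun p => `|wpos c p|) @^-1` [set x | x <= 1] `&`
    (fun p => `|vpos c p - wpos c p|) @^-1` [set x | x <= 1].
  by apply/seteqP; split=> p; [case=> ? ? ? | case=> -[? ?] ?].
by do 2?apply: closedI; apply: (closed_preimage _ (@closed_le R 1)); apply: norm_comp_continuous;
  [exact: vpos_continuous | exact: wpos_continuous | exact: vwpos_continuous].
Qed.

Definition segpt p r (t : R) : R * R := (p.1 + t * (r.1 - p.1), p.2 + t * (r.2 - p.2)).

Lemma segpt_continuous p r : continuous (segpt p r).
Proof.
have affine (a b : R) : continuous (fun t : R => a + t * b).
  move=> t; apply: cvgD; first exact: cvg_cst.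
  by apply: cvgM; [exact: cvg_id | exact: cvg_cst].
move=> t; exact: (cvg_pair (affine p.1 (r.1 - p.1) t) (affine p.2 (r.2 - p.2) t)).
Qed.

Definition segset p r : set (R * R) := segpt p r @` `[0, 1].

Lemma segset_connected p r : connected (segset p r).
Proof.
apply: connected_continuous_connected; first exact: segment_connected.
exact/continuous_subspaceT/segpt_continuous.
Qed.

Lemma segset0 p r : segset p r p.
Proof.
by exists 0; rewrite ?/segpt /= ?in_itv /= ?lexx ?ler01 // !mul0r !addr0; case: p.
Qed.

Lemma segset1 p r : segset p r r.
Proof.
exists 1; rewrite ?/segpt /= ?in_itv /= ?lexx ?ler01 // !mul1r !(addrC _ (_ - _)) !subrK.
by case: r.
Qed.

Lemma vpos_seg c p r t : vpos c (segpt p r t) = vpos c p + t * (vpos c r - vpos c p).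
Proof. by rewrite /vpos /lin /segpt /=; ring. Qed.

Lemma wpos_seg c p r t : wpos c (segpt p r t) = wpos c p + t * (wpos c r - wpos c p).
Proof. by rewrite /wpos /lin /segpt /=; ring. Qed.

Lemma vpos_center c d : vpos c (Defs.center R d) = (vcoord d - vcoord c)%:~R.
Proof.
by rewrite /vpos /lin /vcoord center2 /= !(intrD, intrB, intrM) /=; lra.
Qed.

Lemma wpos_center c d : wpos c (Defs.center R d) = (wcoord d - wcoord c)%:~R.
Proof.
by rewrite /wpos /lin /wcoord center2 /= !(intrD, intrB, intrM) /=; lra.
Qed.

Lemma vpos_shift c d p : vpos d p = vpos c p - (vcoord d - vcoord c)%:~R.
Proof. by rewrite /vpos intrB; ring. Qed.

Lemma wpos_shift c d p : wpos d p = wpos c p - (wcoord d - wcoord c)%:~R.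
Proof. by rewrite /wpos intrB; ring. Qed.

Lemma hexball_center c : hexball false c (Defs.center R c).
Proof. by rewrite /hexball /= vpos_center wpos_center !subrr normr0 ltr01. Qed.

Lemma hexball_sub c : hexball false c `<=` hexball true c.
Proof. by move=> p [/= h1 h2 h3]; split; exact: ltW. Qed.

(** A ball is star-shaped about its centre, and moving towards it leaves the
    boundary at once. *)
Lemma seg_to_center c p t : hexball true c p -> 0 < t -> t <= 1 ->
  hexball false c (segpt p (Defs.center R c) t).
Proof.
move=> [/= h1 h2 h3] t0 t1.
rewrite /hexball /= vpos_seg wpos_seg vpos_center wpos_center !subrr.
have key (a : R) : `|a| <= 1 -> `|a + t * (0 - a)| < 1.
  have -> : a + t * (0 - a) = (1 - t) * a by ring.
  move=> a1; rewrite normrM (@ger0_norm _ (1 - t)) ?subr_ge0 //.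
  by apply: le_lt_trans (_ : 1 - t < 1); [rewrite ler_piMr ?subr_ge0 | rewrite ltrBlDr ltrDl].
split; try exact: key.
have -> : vpos c p + t * (0 - vpos c p) - (wpos c p + t * (0 - wpos c p)) =
  (vpos c p - wpos c p) + t * (0 - (vpos c p - wpos c p)) by ring.
exact: key.
Qed.

(** If two balls meet, the differences v and w of the coordinates of their
    centres satisfy |v|, |w|, |v - w| <= 2. As v + w is a multiple of 3, this
    leaves only the same cell and its six neighbours. *)
Lemma hexball_meet c d p : hexball true c p -> hexball true d p -> c = d \/ adj c d.
Proof.
move=> [/= a1 a2 a3] [/= b1 b2 b3].
have bound (a : R) (n : int) : `|a| <= 1 -> `|a - n%:~R| <= 1 -> (-2 <= n) && (n <= 2).
  rewrite !ler_norml => /andP[? ?] /andP[? ?].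
  by rewrite -!(ler_int R); apply/andP; split; lra.
have v2 : (-2 <= vcoord d - vcoord c) && (vcoord d - vcoord c <= 2).
  by apply: (bound (vpos c p)) => //; rewrite -vpos_shift.
have w2 : (-2 <= wcoord d - wcoord c) && (wcoord d - wcoord c <= 2).
  by apply: (bound (wpos c p)) => //; rewrite -wpos_shift.
have u2 : (-2 <= (vcoord d - vcoord c) - (wcoord d - wcoord c)) &&
          ((vcoord d - vcoord c) - (wcoord d - wcoord c) <= 2).
  apply: (bound (vpos c p - wpos c p)) => //.
  have -> // : vpos c p - wpos c p - (vcoord d - vcoord c - (wcoord d - wcoord c))%:~R
      = vpos d p - wpos d p.
  by rewrite (vpos_shift c d) (wpos_shift c d) !intrB; ring.
rewrite /vcoord /wcoord in v2 w2 u2.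
have [cd|ncd] := boolP (adj c d); [by right | left].
case: c d {a1 a2 a3 b1 b2 b3} v2 w2 u2 ncd => c1 c2 [d1 d2] /=.
rewrite /adj /= => v2 w2 u2 ncd; congr (_, _); clear bound; lia.
Qed.

Local Notation fig P := (figure (R := R) P).
Local Notation ctr c := (Defs.center R c).

Lemma figureP P p : fig P p <-> exists2 c, c \in P & hexball true c p.
Proof.
by split=> [[c cP]|[c cP]]; rewrite ?hexagonE => cp; exists c; rewrite ?hexagonE.
Qed.

Lemma hexball_interior P c : c \in P -> hexball false c `<=` interior (fig P).
Proof.
move=> cP; rewrite -open_subsetE; last exact: hexball_open.
by move=> p /hexball_sub cp; apply/figureP; exists c.
Qed.

(** Up to symmetry there are three directions. In each, the open rhombus whose
    diagonals are the common edge and the segment between the centres lies in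
    the union of the two hexagons. *)
Lemma bridge_interior P c d t : c \in P -> d \in P ->
  d \in [:: (c.1, c.2 + 1); (c.1 + 1, c.2); (c.1 + 1, c.2 - 1)] ->
  0 < t -> t < 1 -> interior (fig P) (segpt (ctr c) (ctr d) t).
Proof.
move=> cP dP; rewrite !inE => dE t0 t1.
pose f p : R := vpos c p; pose g p : R := wpos c p; pose k p : R := vpos c p - wpos c p.
have opn (u v : R * R -> R) (l1 l2 : R) : continuous u -> continuous v ->
    open [set p | [/\ l1 < u p, u p < l1 + 1, l2 < v p & v p < l2 + 1]].
  move=> uc vc.
  have -> : [set p | [/\ l1 < u p, u p < l1 + 1, l2 < v p & v p < l2 + 1]] =
     u @^-1` [set x | l1 < x] `&` u @^-1` [set x | x < l1 + 1] `&`
     (v @^-1` [set x | l2 < x] `&` v @^-1` [set x | x < l2 + 1]).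
    by apply/seteqP; split=> p; [case=> ? ? ? ? | case=> -[? ?] [? ?]].
  by apply: openI; apply: openI; apply: open_preimage => //;
    (exact: open_gt || exact: open_lt).
have fc : continuous f := @vpos_continuous c.
have gc : continuous g := @wpos_continuous c.
have kc : continuous k := @vwpos_continuous c.
suff [O [Oo Of Ot]] : exists O, [/\ open O, O `<=` fig P & O (segpt (ctr c) (ctr d) t)].
  by move: Of; rewrite (open_subsetE _ Oo); apply.
have cell_or p : hexball true c p \/ hexball true d p -> fig P p.
  by move=> [cp|dp]; apply/figureP; [exists c | exists d].
case/or3P: dE => /eqP dE; rewrite dE.
- exists [set p | [/\ 0 < f p, f p < 0 + 1, -1 < g p & g p < -1 + 1]]; split; first exact: opn.
    move=> p [/= f0 f1 g0 g1]; apply: cell_or.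
    rewrite /hexball /= (vpos_shift c d) (wpos_shift c d) -/(f p) -/(g p).
    rewrite dE /vcoord /wcoord /= !(intrD, intrB, intrM) /= !ler_norml.
    have [fg|fg] := lerP (f p - g p) 1; [left|right]; split; apply/andP; split; lra.
  rewrite /f /g /= vpos_seg wpos_seg !vpos_center !wpos_center.
  by rewrite /vcoord /wcoord /= !(intrD, intrB, intrM) /=; split; lra.
- exists [set p | [/\ 0 < g p, g p < 0 + 1, 0 < k p & k p < 0 + 1]]; split; first exact: opn.
    move=> p [/= f0 f1 g0 g1]; apply: cell_or.
    rewrite /hexball /= (vpos_shift c d) (wpos_shift c d).
    rewrite /g /k in f0 f1 g0 g1.
    rewrite dE /vcoord /wcoord /= !(intrD, intrB, intrM) /= !ler_norml.
    have [fg|fg] := lerP (vpos c p) 1; [left|right]; split; apply/andP; split; lra.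
  rewrite /g /k /= vpos_seg wpos_seg !vpos_center !wpos_center.
  by rewrite /vcoord /wcoord /= !(intrD, intrB, intrM) /=; split; lra.
exists [set p | [/\ 0 < f p, f p < 0 + 1, -1 < k p & k p < -1 + 1]]; split; first exact: opn.
  move=> p [/= f0 f1 g0 g1]; apply: cell_or.
  rewrite /hexball /= (vpos_shift c d) (wpos_shift c d).
  rewrite /f /k in f0 f1 g0 g1.
  rewrite dE /vcoord /wcoord /= !(intrD, intrB, intrM) /= !ler_norml.
  have [fg|fg] := lerP (wpos c p) 1; [left|right]; split; apply/andP; split; lra.
rewrite /f /k /= vpos_seg wpos_seg !vpos_center !wpos_center.
by rewrite /vcoord /wcoord /= !(intrD, intrB, intrM) /=; split; lra.
Qed.

Lemma adj_cases c d : adj c d ->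
  (d \in [:: (c.1, c.2 + 1); (c.1 + 1, c.2); (c.1 + 1, c.2 - 1)]) ||
  (c \in [:: (d.1, d.2 + 1); (d.1 + 1, d.2); (d.1 + 1, d.2 - 1)]).
Proof.
case: c d => c1 c2 [d1 d2]; rewrite /adj !inE !xpair_eqE /=.
by move=> H; clear -H; lia.
Qed.

Lemma bridge P c d : c \in P -> d \in P -> adj c d ->
  exists S, [/\ connected S, S `<=` interior (fig P), S (ctr c) & S (ctr d)].
Proof.
have main c' d' : c' \in P -> d' \in P ->
    d' \in [:: (c'.1, c'.2 + 1); (c'.1 + 1, c'.2); (c'.1 + 1, c'.2 - 1)] ->
    segset (ctr c') (ctr d') `<=` interior (fig P).
  move=> cP dP dE _ [t /= + <-]; rewrite in_itv /= => /andP[].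
  rewrite le_eqVlt => /predU1P[<- _|t0].
    rewrite /segpt !mul0r !addr0 -surjective_pairing.
    exact: hexball_interior cP _ (hexball_center c').
  rewrite le_eqVlt => /predU1P[->|t1]; last exact: bridge_interior.
  rewrite /segpt !mul1r ![_ + (_ - _)]addrC !subrK -surjective_pairing.
  exact: hexball_interior dP _ (hexball_center d').
move=> cP dP /adj_cases/orP[/(main _ _ cP dP) S|/(main _ _ dP cP) S].
  by exists (segset (ctr c) (ctr d)); split=> //;
    [exact: segset_connected | exact: segset0 | exact: segset1].
by exists (segset (ctr d) (ctr c)); split=> //;
  [exact: segset_connected | exact: segset1 | exact: segset0].
Qed.

(** Only the starting point can lie on the boundary of the cell, and that point
    is interior to the figure. *)
Lemma spoke P c p : c \in P -> interior (fig P) p -> hexball true c p ->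
  segset p (ctr c) `<=` interior (fig P).
Proof.
move=> cP pI cp _ [t /= + <-]; rewrite in_itv /= => /andP[].
rewrite le_eqVlt => /predU1P[<- _|t0 t1].
  by rewrite /segpt !mul0r !addr0 -surjective_pairing.
exact: hexball_interior cP _ (seg_to_center cp t0 t1).
Qed.

(** A clopen part of the interior contains the centre of a cell as soon as it
    contains a point of that cell, and passes from a centre to those of
    adjacent cells along bridges; so membership of centres is a locally
    constant function of the cell. *)
Lemma connected_interior P : conn P -> connected (interior (fig P)).
Proof.
move=> Pc B [p0 Bp0] [O Oo BO] [D Dc BD].
set I := interior (fig P) in BO BD *.
have spread S p r : connected S -> S `<=` I -> S p -> S r -> B p -> B r.
  move=> Sc SI Sp Sr Bp; have E : B `&` S = S.
    apply: Sc; first by exists p.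
      by exists O => //; rewrite BO; apply/seteqP; split=> z; [case=> -[? ?] ? | case=> Sz ?; do 2?split => //; exact: SI].
    by exists D => //; rewrite BD; apply/seteqP; split=> z; [case=> -[? ?] ? | case=> Sz ?; do 2?split => //; exact: SI].
  by have : S r by []; rewrite -E => -[].
have BI : B `<=` I by rewrite BO => z [].
have toc p c : c \in P -> I p -> hexball true c p -> B p <-> B (ctr c).
  move=> cP pI cp; have S := spoke cP pI cp; have Sc := @segset_connected p (ctr c).
  by split; apply: (spread _ _ _ Sc S); (exact: segset0 || exact: segset1).
have cell p : I p -> exists2 c, c \in P & hexball true c p.
  by move=> /interior_subset /figureP.
apply/seteqP; split=> // p pI; have [c cP cp] := cell p pI.
have [c0 c0P c0p] := cell p0 (BI _ Bp0).
apply/(toc p c cP pI cp).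
have Bc0 : B (ctr c0) by apply/(toc p0 c0 c0P (BI _ Bp0) c0p).
have : `[< B (ctr c) >] = `[< B (ctr c0) >].
  apply: (Pc (fun c => `[< B (ctr c) >])) => // a b aP bP ab.
  have [S [Sc SI Sa Sb]] := bridge aP bP ab.
  by apply/asboolP/asboolP => [Ba|Bb]; [exact: spread Sc SI Sa Sb Ba | exact: spread Sc SI Sb Sa Bb].
by rewrite (asboolT Bc0) => /asboolP.
Qed.

(** Closed hexagons that meet are adjacent, so the cells of either value of a
    locally constant function cover disjoint closed sets, which split the
    interior. *)
Lemma conn_of_connected P : connected (interior (fig P)) -> conn P.
Proof.
move=> Ic A Aloc c d cP dP.
have same a b p : a \in P -> b \in P -> hexball true a p -> hexball true b p -> A a = A b.
  by move=> aP bP ap bp; have [->//|ab] := hexball_meet ap bp; exact: Aloc.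
pose part v := \bigcup_(e in [set e | e \in P /\ A e = v]) hexball true e.
have part_closed v : closed (part v).
  apply: closed_bigcup => [|e _]; last exact: hexball_closed.
  by apply: (@sub_finite_set _ _ [set` P]) => [e []|]; last exact: finite_fset.
pose B := interior (fig P) `&` part (A c).
have BI : B = interior (fig P).
  apply: Ic.
  - exists (ctr c); split; first exact: hexball_interior cP _ (hexball_center c).
    by exists c => //; apply: hexball_sub; exact: hexball_center.
  - exists (~` part (~~ A c)); first by rewrite openC.
    apply/seteqP; split=> p [pI]; split=> //.
      move: b => [e [eP Ae] ep] [e' [e'P Ae'] e'p].
      by have := same _ _ _ eP e'P ep e'p; rewrite Ae Ae'; case: (A c).
    have /figureP[e eP ep] := interior_subset pI.
    exists e => //; split=> //; apply: contrapT => ne; apply: b.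
    by exists e => //; split=> //; case: (A e) (A c) ne => [] [].
  by exists (part (A c)).
have : B (ctr d) by rewrite BI; exact: hexball_interior dP _ (hexball_center d).
by case=> _ [e [eP <-] ed]; apply: same eP dP ed _; apply: hexball_sub; exact: hexball_center.
Qed.

Lemma is_polyominoE P : is_polyomino R P <-> P != fset0 /\ conn P.
Proof.
by split=> -[P0 Pc]; split=> //; [exact: conn_of_connected | exact: connected_interior].
Qed.
End Topology.

End Geometry.

(** * Polyominoes and codes *)

Section Bijection.
Local Open Scope classical_set_scope.

Lemma simple_two_columnE (R : realType) (P : {fset cell}) :
  is_simple_two_column R P <-> [/\ P != fset0, conn P & simple_columns P].
Proof.
have colP (c : cell) : c \in P -> c.1 \in columns P.
  by move=> cP; apply/imfsetP; exists c.
split=> [[[/is_polyominoE[P0 Pc] P12] Ps]|[P0 Pc [P12 Ps]]].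
  split=> //; split=> [c cP|x [a b]]; first by rewrite -num_components_tops; exact: P12 (colP c cP).
  by apply: (Ps x); rewrite !two_component_columnsE !mem_twos a b.
split; first split; first exact/is_polyominoE.
  by move=> x /imfsetP[c /= cP ->]; rewrite num_components_tops; exact: P12.
by move=> x; rewrite !two_component_columnsE !mem_twos => -[/eqP a /eqP b]; exact: (Ps x).
Qed.

Lemma codesE (c : code) : codes c <-> code_ok c.
Proof. by split=> [[a b]|/andP[a b]] //; apply/andP. Qed.

Lemma polyomino_of_translate x y (c : code) :
  polyomino_of x y c = translate (x, y) (polyomino_of 0 0 c).
Proof. by rewrite /polyomino_of -decode_translate !add0r. Qed.

Lemma polyomino_of_simple (R : realType) x y (c : code) : code_ok c ->
  is_simple_two_column R (polyomino_of x y c).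
Proof.
move=> ok; apply/simple_two_columnE; have [xyP _ _] := @polyomino_of_corner x y c ok.
have [sok tok] := code_shape ok.
have [T2 [Ts _]] := @tops_decode x y _ _ sok tok.
split; [by apply/fset0Pn; exists (x, y) | exact: conn_polyomino_of |].
split=> [d dP|x' [a b]]; last by apply: (Ts x'); rewrite !mem_twos a b.
have dP' : (d.1, d.2) \in polyomino_of x y c by case: (d) dP.
have [k [kt _]] := top_above dP'.
have : (0 < #|` tops (polyomino_of x y c) d.1|)%N by rewrite cardfs_gt0; apply/fset0Pn; exists (d.1, d.2 + k%:Z).
have := T2 d.1; rewrite -[decode _ _ _ _]/(polyomino_of x y c).
by case: #|` _| => [|[|[|?]]] // _ _; [left | right].
Qed.

Lemma polyomino_of_weight x y (c : code) : code_ok c ->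
  q ^+ #|` polyomino_of x y c| * w ^+ #|` two_component_columns (polyomino_of x y c)| = wt_code c.
Proof.
move=> ok; have [sok tok] := code_shape ok; have [_ [_ tc]] := @tops_decode x y _ _ sok tok.
rewrite two_component_columnsE [#|` twos _|]tc card_decode wt_codeE.
by rewrite /area_cont /twos_cont !big_cons /= !addnA.
Qed.

Definition class_of_code (c : code) : cells_mod_translation :=
  \pi_(cells_mod_translation)%qT (polyomino_of 0 0 c).

(** The statistics of a class are taken on some representative, which is a
    translate of the decoded figure. *)
Lemma repr_class (c : code) : exists v, repr (class_of_code c) = polyomino_of v.1 v.2 c.
Proof.
have : translated (polyomino_of 0 0 c) (repr (class_of_code c)).
  by apply/(@eqmodP _ translated_equiv); rewrite reprK.
by move=> /asboolP[v ->]; exists v; rewrite (polyomino_of_translate v.1 v.2) -surjective_pairing.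
Qed.

Lemma G_codes (R : realType) : G R = fps_sum codes wt_code.
Proof.
rewrite /G; set F := fun C : cells_mod_translation => _.
have -> : [set C | is_simple_two_column R (repr C)] = class_of_code @` codes.
  apply/seteqP; split=> [C /simple_two_columnE[P0 Pc Ps]|_ [c /codesE ok <-]].
    have [x [y [c [ok CE]]]] := polyomino_of_onto P0 Pc Ps.
    exists c; first exact/codesE.
    rewrite -[RHS]reprK /class_of_code; apply/eqmodP/asboolP.
    by exists (x, y); rewrite CE polyomino_of_translate.
  by have [v] := repr_class c; rewrite /mkset => ->; exact: polyomino_of_simple.
rewrite fps_sum_image; last first.
  move=> c c'; rewrite !inE => /codesE ok /codesE ok' /eqmodP /asboolP[v].
  by case: v => a b; rewrite -polyomino_of_translate => E; apply/esym; exact: polyomino_of_inj ok' ok E.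
apply: eq_fps_sum => c /codesE ok; rewrite /F /=.
by have [v ->] := repr_class c; exact: polyomino_of_weight.
Qed.

End Bijection.

Theorem theorem1 (R : realType) :
  DEN \is a GRing.unit /\ G R = NUM / DEN.
Proof.
split; first exact: unit_DEN.
by rewrite G_codes fps_sum_codes (height_system_solution cont_gf_system).
Qed.
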